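(* There exists a constant $c_1>0$ such that the following holds in the semi-random model described in the context. If $k\ge c_1 n^{2/3}$ and, in addition to the graph $G$, one is given a vertex $u$ chosen uniformly at random from $S$, then there is a polynomial-time algorithm which with high probability outputs exactly the set $S$.
   Context: Semi-random model: Let $V$ be a set of $n$ vertices. (1) An adversary chooses $S\subseteq V$ with $|S|=k$; write $\overline S=V\setminus S$. (2) A random graph $G'=(V,E')$ is formed in which each pair $\{u,v\}$ with $u\in S$, $v\in\overline S$ is an edge independently with probability $1/2$, and no other pairs are edges. (3) The adversary may add arbitrarily any edges not contained in $S\times S$, yielding $G=(V,E)$ with $E\supseteq E'$, so $S$ is an independent set of $G$. ''With high probability'' means with probability tending to $1$ as $n\to\infty$ over the random choice of $E'$ and of the given vertex, regardless of the adversary. *)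

(* Defs.v *)
From HB Require Import structures.
From mathcomp Require Import all_boot all_order all_algebra.
From mathcomp Require Import all_classical all_reals all_analysis.

Set Implicit Arguments.
Unset Strict Implicit.
Unset Printing Implicit Defensive.

Import Order.TTheory GRing.Theory Num.Theory.

Local Open Scope ring_scope.

(** ** Graphs on [n] labelled vertices, as sets of two-element sets *)

Definition edge_set (n : nat) := {set {set 'I_n}}.

Definition is_graph n (E : edge_set n) : bool := [forall e in E, #|e| == 2%N].

Definition is_edge n (E : edge_set n) (x y : 'I_n) : bool := [set x; y] \in E.

(** ** The semi-random model *)

Definition cross_pairs n (S : {set 'I_n}) : edge_set n :=
  [set [set x; y] | x in S, y in ~: S].

(** The probability that the random graph [G'] has edge set exactly [E'], for
    [E'] included in [cross_pairs S]. *)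
Definition random_edges_prob (R : realType) n (S : {set 'I_n})
    (E' : edge_set n) : R :=
  \prod_(e in cross_pairs S) (if e \in E' then 2^-1 else 1 - 2^-1).

(** A monotone adversary sees [E'] (but not the vertex handed to the algorithm,
    which is drawn afterwards) and answers with the final edge set. *)
Definition is_adversary n (S : {set 'I_n}) (adv : edge_set n -> edge_set n) :=
  forall E' : edge_set n, E' \subset cross_pairs S ->
    [/\ E' \subset adv E', is_graph (adv E') &
        forall e, e \in adv E' -> e \notin E' -> ~~ (e \subset S)].

Definition algorithm := forall n : nat, edge_set n -> 'I_n -> {set 'I_n}.

(** The probability, over [E'] and over [u] uniform in [S], that [alg] outputs
    exactly [S]. *)
Definition success_prob (R : realType) n (S : {set 'I_n})
    (adv : edge_set n -> edge_set n) (alg : algorithm) : R :=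
  \sum_(E' : edge_set n | E' \subset cross_pairs S)
    random_edges_prob R S E' *
    \sum_(u in S) (#|S|%:R)^-1 * (alg n (adv E') u == S)%:R.

(** ** Polynomial time

    The machine model is the random access machine with logarithmic cost, with
    structured control flow.  The memory has one natural number in each cell;
    addresses are computed values, so indirect addressing is available. *)

Definition memory := nat -> nat.

Inductive expr : Type :=
| Const of nat
| Read of expr
| Plus of expr & expr
| Minus of expr & expr
| Times of expr & expr
| Quot of expr & expr.

(** Subtraction is truncated at [0], and division by [0] gives [0]. *)
Fixpoint eval_expr (m : memory) (e : expr) : nat :=
  match e with
  | Const c => c
  | Read a => m (eval_expr m a)
  | Plus a b => (eval_expr m a + eval_expr m b)%N
  | Minus a b => (eval_expr m a - eval_expr m b)%N
  | Times a b => (eval_expr m a * eval_expr m b)%N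
  | Quot a b => (eval_expr m a %/ eval_expr m b)%N
  end.

(** The number of binary digits of [x]; it is [1] for [x = 0]. *)
Definition bit_length (x : nat) : nat := (trunc_log 2 x).+1.

(** Every node of an expression is charged the length of its value.  The address
    read by [Read] and the operands of an operation are themselves nodes, so
    their lengths are charged too. *)
Fixpoint expr_cost (m : memory) (e : expr) : nat :=
  (bit_length (eval_expr m e) +
   match e with
   | Const _ => 0
   | Read a => expr_cost m a
   | Plus a b | Minus a b | Times a b | Quot a b => expr_cost m a + expr_cost m b
   end)%N.

Inductive cmd : Type :=
| Skip
| Write of expr & expr
| Seq of cmd & cmd
| If of expr & cmd & cmd
| While of expr & cmd.

Definition update (m : memory) (a v : nat) : memory :=
  fun x => if x == a then v else m x.

(** [exec c m m' t]: started in memory [m], the command [c] halts in memory [m']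
    at total cost [t].  A test succeeds when its value is nonzero. *)
Inductive exec : cmd -> memory -> memory -> nat -> Prop :=
| ExecSkip m : exec Skip m m 1
| ExecWrite m a e :
    exec (Write a e) m (update m (eval_expr m a) (eval_expr m e))
      (expr_cost m a + expr_cost m e).+1
| ExecSeq c1 c2 m1 m2 m3 t1 t2 :
    exec c1 m1 m2 t1 -> exec c2 m2 m3 t2 ->
    exec (Seq c1 c2) m1 m3 (t1 + t2).+1
| ExecIfTrue e c1 c2 m m' t :
    eval_expr m e != 0%N -> exec c1 m m' t ->
    exec (If e c1 c2) m m' (expr_cost m e + t).+1
| ExecIfFalse e c1 c2 m m' t :
    eval_expr m e = 0%N -> exec c2 m m' t ->
    exec (If e c1 c2) m m' (expr_cost m e + t).+1
| ExecWhileTrue e c m1 m2 m3 t1 t2 :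
    eval_expr m1 e != 0%N -> exec c m1 m2 t1 -> exec (While e c) m2 m3 t2 ->
    exec (While e c) m1 m3 (expr_cost m1 e + t1 + t2).+1
| ExecWhileFalse e c m :
    eval_expr m e = 0%N -> exec (While e c) m m (expr_cost m e).+1.

(** Input: cell [0] holds [n], cell [1] holds [u], and cell [2 + i * n + j] holds
    the entry [(i, j)] of the adjacency matrix; all other cells hold [0]. *)
Definition holds_input (m : memory) n (E : edge_set n) (u : 'I_n) : Prop :=
  [/\ m 0%N = n, m 1%N = u,
      forall i j : 'I_n, m (2 + i * n + j)%N = is_edge E i j &
      forall x, (2 + n * n <= x)%N -> m x = 0%N].

(** Output: cells [0], ..., [n - 1] hold the characteristic vector of [X]. *)
Definition holds_output (m : memory) n (X : {set 'I_n}) : Prop :=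
  forall i : 'I_n, m i = (i \in X).

Definition poly_time (alg : algorithm) : Prop :=
  exists (c : cmd) (p : {poly nat}),
  forall n (E : edge_set n) (u : 'I_n) (m : memory),
    is_graph E -> holds_input m E u ->
    exists (m' : memory) (t : nat),
      [/\ exec c m m' t, (t <= p.[n])%N & holds_output m' (alg n E u)].

(* Main.v *)
Require Import Defs.
From HB Require Import structures.
From mathcomp Require Import all_boot all_order all_algebra.
From mathcomp Require Import all_classical all_reals all_analysis.
From mathcomp Require Import zify ring lra.

(** The graph [G] is treated through the semidefinite program that maximises the
    sum of the entries of a Gram matrix [X] of unit vectors with [X i j = 0] on
    the edges of [G].  The program is solved approximately by Frank-Wolfe steps on
    a penalised objective, the top eigenvector being replaced by a normalised high
    power of the shifted gradient, computed in integer arithmetic modulo a power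
    of two.  Collapsing [S] to one unit vector is a feasible modification of [X],
    while by Grothendieck's inequality the entries of [X] between [S] and its
    complement sum to [O(n sqrt k)], because they are supported on the non-edges
    and the signed random bipartite graph has small cut norm.  Since
    [k >= c n^(2/3)] makes this negligible against [k^2], the vectors of [S] are
    nearly parallel, and for most [u] in [S] the ball around the vector of [u],
    corrected by a vote of its members, is exactly [S].
    As [u] may be atypical, the algorithm outputs the union of all sets containing
    [u] that arise in this way from many vertices, are independent and of size at
    least [n^(2/3)], and leave no outside vertex with few neighbours in the set.
    Any such set other than [S] meets [S] in few vertices, since the random graph
    has no large bipartite hole, and there are only [O(n^(1/3))] of them; so few
    [u] in [S] are affected. *)

(** Two obstacles shape the construction. The machine knows only natural numbers, so every matrix is
    scaled to integers, ring operations are done on residues, and a true value is needed only at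
    divisions and comparisons. Spectral theory is avoided too: the quality of the power step follows
    from log-convexity of traces and norms of powers, and positive semidefiniteness is always an
    explicit Gram factorisation. The other obstacle is that the adversary can plant sets that look
    like [S]. The count that defeats this is: a candidate must arise from at least [n ^ (2/3) / 2]
    of the [n] vertices, and a wrong one meets [S] in fewer than about [n ^ (1/6)] vertices, a scale
    at which bipartite holes are already excluded. So about [2 n ^ (1/2)] choices of [u] fail,
    negligible against [k]. The constant [10 ^ 6] turns [k >= c n ^ (2/3)] into
    [k ^ 2 >= 10 ^ 9 n sqrt k], which leaves room for the constant of Grothendieck's inequality and
    for averaging over rows. *)

Set Implicit Arguments.
Unset Strict Implicit.
Unset Printing Implicit Defensive.

Import Order.TTheory GRing.Theory Num.Theory.

Local Open Scope ring_scope.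

(** * Loop programs on the random access machine *)

(* The memory after the input is shared by [narr] interleaved arrays.  Cell [0] of
   array [0] holds the modulus: [HStore] reduces every value modulo it, which
   bounds the cost of each step. *)
Definition narr : nat := 32.

Definition nE : expr := Read (Const 0).

Definition cellE (a : nat) (e : expr) : expr :=
  Plus (Plus (Times nE nE) (Const 2)) (Plus (Times (Const narr) e) (Const a)).

Definition get (a : nat) (e : expr) : expr := Read (cellE a e).

Definition var (a : nat) : expr := get a (Const 0).

Definition cell (n a x : nat) : nat := (n * n + 2 + (narr * x + a))%N.

Definition arr (n : nat) (m : memory) (a x : nat) : nat := m (cell n a x).

Definition modE (e : expr) : expr := Minus e (Times (Quot e (var 0)) (var 0)).

(* [(c, e)] stands for [c * n ^ e] *)
Definition mono := (nat * nat)%type.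

Definition monoE (b : mono) : expr := iter b.2 (Times nE) (Const b.1).

Definition mono_val (n : nat) (b : mono) : nat := (b.1 * n ^ b.2)%N.

(** Every loop length is a monomial in [n], so termination and a polynomial time bound come by
    structural induction. *)
Inductive hcmd : Type :=
| HStore of nat & expr & expr
| HSeq of hcmd & hcmd
| HFor of nat & mono & hcmd.

Fixpoint writes (c : hcmd) : seq nat :=
  match c with
  | HStore d _ _ => [:: d]
  | HSeq c1 c2 => writes c1 ++ writes c2
  | HFor x _ c1 => x :: writes c1
  end.

Fixpoint well_formed (c : hcmd) : bool :=
  match c with
  | HStore d _ _ => (0 < d < narr)%N
  | HSeq c1 c2 => well_formed c1 && well_formed c2
  | HFor x _ c1 => [&& (0 < x < narr)%N, x \notin writes c1 & well_formed c1]
  end.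

(** Loop counters are incremented without reduction, so a loop keeps the memory bounded only if its
    length is at most the modulus. *)
Fixpoint fits (n w : nat) (c : hcmd) : bool :=
  match c with
  | HStore _ _ _ => true
  | HSeq c1 c2 => fits n w c1 && fits n w c2
  | HFor _ b c1 => (mono_val n b <= 2 ^ w)%N && fits n w c1
  end.

Definition incr_var (x : nat) (m : memory) : memory :=
  update m (eval_expr m (cellE x (Const 0)))
    (eval_expr m (Plus (var x) (Const 1))).

Fixpoint hrun (c : hcmd) (m : memory) : memory :=
  match c with
  | HStore d i e => update m (eval_expr m (cellE d i)) (eval_expr m (modE e))
  | HSeq c1 c2 => hrun c2 (hrun c1 m)
  | HFor x b c1 =>
      iter (mono_val (m 0%N) b) (fun m1 => incr_var x (hrun c1 m1))
        (update m (eval_expr m (cellE x (Const 0))) 0%N)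
  end.

Fixpoint compile (c : hcmd) : cmd :=
  match c with
  | HStore d i e => Write (cellE d i) (modE e)
  | HSeq c1 c2 => Seq (compile c1) (compile c2)
  | HFor x b c1 =>
      Seq (Write (cellE x (Const 0)) (Const 0))
        (While (Minus (monoE b) (var x))
           (Seq (compile c1)
              (Write (cellE x (Const 0)) (Plus (var x) (Const 1)))))
  end.

(** The bound is not strict because one cell holds the modulus itself. *)
Definition word_inv (n w : nat) (m : memory) : Prop :=
  [/\ m 0%N = n, forall y, (m y <= 2 ^ w)%N & arr n m 0 0 = (2 ^ w)%N].

Lemma eval_cellE m a e : eval_expr m (cellE a e) = cell (m 0%N) a (eval_expr m e).
Proof. by []. Qed.

Lemma eval_var m a : eval_expr m (var a) = arr (m 0%N) m a 0.
Proof. by rewrite /var /get /= /arr /cell muln0. Qed.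

Lemma eval_modE m e :
  eval_expr m (modE e) = (eval_expr m e %% arr (m 0%N) m 0 0)%N.
Proof.
rewrite -eval_var /modE /=; set w := m _; set x := eval_expr m e.
by rewrite {1}(divn_eq x w) addKn.
Qed.

Lemma eval_monoE m b : eval_expr m (monoE b) = mono_val (m 0%N) b.
Proof.
rewrite /mono_val /monoE; case: b => c e /=; elim: e => [|e IH] /=; first by rewrite muln1.
by rewrite IH expnS mulnCA.
Qed.

Lemma bit_length_le x b : (0 < b)%N -> (x < 2 ^ b)%N -> (bit_length x <= b)%N.
Proof.
move=> b0 hx; rewrite /bit_length; have [->|x0] := posnP x.
  by rewrite trunc_log0.
have /andP[h _] := trunc_log_bounds (isT : 1 < 2)%N x0.
by rewrite -(ltn_exp2l _ _ (isT : 1 < 2)%N); apply: leq_ltn_trans hx.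
Qed.

(** A sum or product is at most as long as its operands together, and a [Read] returns a cell, which
    is short whatever its address. *)
Lemma expr_cost_le e : exists K, (0 < K)%N /\ forall m b, (0 < b)%N -> (forall y, m y < 2 ^ b)%N ->
  (eval_expr m e < 2 ^ (K * b))%N /\ (expr_cost m e <= K * b)%N.
Proof.
have two x b : (x < 2 ^ b)%N -> (x.+1 <= 2 ^ b)%N by [].
elim: e => [c|e [K [K0 IH]]|e1 [K1 [p1 IH1]] e2 [K2 [p2 IH2]]|e1 [K1 [p1 IH1]] e2 [K2 [p2 IH2]]
  |e1 [K1 [p1 IH1]] e2 [K2 [p2 IH2]]|e1 [K1 [p1 IH1]] e2 [K2 [p2 IH2]]].
- exists c.+1; split=> // m b b0 hm /=.
  have h : (c < 2 ^ (c.+1 * b))%N.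
    apply: (leq_trans (ltn_expl c (isT : 1 < 2)%N)); rewrite leq_pexp2l //.
    by rewrite (leq_trans (leqnSn c)) // leq_pmulr.
  by split=> //; rewrite addn0 bit_length_le // muln_gt0.
- exists (K + 1)%N; split=> [|m b b0 hm /=]; first by rewrite addn1.
  have [h1 h2] := IH m b b0 hm; split.
    by apply: leq_trans (hm _) _; rewrite leq_pexp2l // leq_pmull // addn1.
  by rewrite mulnDl mul1n addnC leq_add // bit_length_le.
(* One half pays for the length of the value, the other for the costs of the operands. *)
all: exists ((K1 + K2) + (K1 + K2))%N; split=> [|m b b0 hm /=]; first by rewrite addn_gt0 addn_gt0 p1.
all: have [h1 c1] := IH1 m b b0 hm; have [h2 c2] := IH2 m b b0 hm.
all: set y1 := eval_expr m e1 in h1 *; set y2 := eval_expr m e2 in h2 *.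
all: have q0 : (0 < (K1 + K2) * b)%N by rewrite muln_gt0 addn_gt0 p1.
all: have q1 : (K1 * b <= (K1 + K2) * b)%N by rewrite leq_mul2r leq_addr orbT.
all: match goal with |- context [bit_length ?v] =>
  have hv : (v < 2 ^ ((K1 + K2) * b))%N;
  [|split; [by apply: leq_trans hv _; rewrite leq_pexp2l // leq_mul2r leq_addr orbT
           |by rewrite [X in (_ <= X)%N]mulnDl leq_add ?bit_length_le // [X in (_ <= X)%N]mulnDl leq_add]] end.
- rewrite -addn1 -addnA; apply: leq_trans (leq_add (ltnW h1) _) (_ : (2 ^ (K1 * b) + (2 ^ (K2 * b)) <= _)%N).
    by rewrite addn1.
  rewrite mulnDl expnD.
  have g1 : (2 <= 2 ^ (K1 * b))%N by rewrite -{1}(expn1 2) leq_pexp2l // muln_gt0 p1.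
  have g2 : (2 <= 2 ^ (K2 * b))%N by rewrite -{1}(expn1 2) leq_pexp2l // muln_gt0 p2.
  by nia.
- by apply: leq_ltn_trans (leq_subr _ _) _; apply: leq_trans h1 _; rewrite leq_pexp2l.
- by rewrite mulnDl expnD; apply: ltn_mul.
- by apply: leq_ltn_trans (leq_div _ _) _; apply: leq_trans h1 _; rewrite leq_pexp2l.
Qed.

Lemma eval_Const m c : eval_expr m (Const c) = c. Proof. by []. Qed.
Lemma eval_Read m e : eval_expr m (Read e) = m (eval_expr m e). Proof. by []. Qed.
Lemma eval_Plus m e f : eval_expr m (Plus e f) = (eval_expr m e + eval_expr m f)%N. Proof. by []. Qed.
Lemma eval_Minus m e f : eval_expr m (Minus e f) = (eval_expr m e - eval_expr m f)%N. Proof. by []. Qed.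
Lemma eval_Times m e f : eval_expr m (Times e f) = (eval_expr m e * eval_expr m f)%N. Proof. by []. Qed.
Lemma eval_Quot m e f : eval_expr m (Quot e f) = (eval_expr m e %/ eval_expr m f)%N. Proof. by []. Qed.
Lemma eval_nE m : eval_expr m nE = m 0%N. Proof. by []. Qed.
Lemma eval_get m a e : eval_expr m (get a e) = arr (m 0%N) m a (eval_expr m e).
Proof. by []. Qed.

Definition evalE := (eval_var, eval_cellE, eval_modE, eval_monoE, eval_nE, eval_get, eval_Const,
  eval_Read, eval_Plus, eval_Minus, eval_Times, eval_Quot).

Arguments eval_expr : simpl never.
Arguments nE : simpl never.
Arguments var : simpl never.
Arguments get : simpl never.

Lemma cell_inj n a x b y : (a < narr)%N -> (b < narr)%N ->
  (cell n a x == cell n b y) = (a == b) && (x == y).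
Proof.
move=> ha hb; rewrite /cell eqn_add2l; apply/eqP/andP => [h|[/eqP-> /eqP->]//].
have := congr1 (fun z => z %% narr)%N h; rewrite ![(narr * _)%N]mulnC !modnMDl !modn_small //.
move=> e; rewrite e in h *; split=> //; move/addIn: h => /eqP; rewrite eqn_pmul2l //.
Qed.

Lemma arr_update n m d i v a x : (a < narr)%N -> (d < narr)%N ->
  arr n (update m (cell n d i) v) a x = if (a == d) && (x == i) then v else arr n m a x.
Proof. by move=> ha hd; rewrite /arr /update cell_inj. Qed.

Lemma update_low n m d i v y : (y < n * n + 2)%N -> update m (cell n d i) v y = m y.
Proof. by move=> hy; rewrite /update; case: eqP => // e; move: hy; rewrite e ltnNge /cell leq_addr. Qed.

Lemma iter_inv (T : Type) (P : T -> Prop) (f : T -> T) k x :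
  P x -> (forall y, P y -> P (f y)) -> P (iter k f x).
Proof. by move=> Px Pf; elim: k => //= k; apply: Pf. Qed.

(* Cells below [n * n + 2], which hold [n], [u] and the adjacency matrix, are
   never overwritten. *)
Lemma hrun_low c m y : (y < m 0%N * m 0%N + 2)%N -> hrun c m y = m y.
Proof.
elim: c m y => [d i e|c1 IH1 c2 IH2|x b c IH] m y hy.
- by rewrite [hrun _ _]/= -/(cellE d i) eval_cellE update_low.
- by rewrite /= IH2 ?IH1 // addn2.
- have h0 m1 z : (z < m1 0%N * m1 0%N + 2)%N -> incr_var x m1 z = m1 z.
    by move=> hz; rewrite /incr_var eval_cellE update_low.
  rewrite [hrun _ _]/=.
  set m1 := iter _ _ _; suff [] : m1 0%N = m 0%N /\ m1 y = m y by [].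
  rewrite {}/m1; apply: (iter_inv (P := fun m1 => m1 0%N = m 0%N /\ m1 y = m y)).
    by rewrite !update_low // addn2.
  move=> m1 [e0 ey]; have hh : hrun c m1 0%N = m 0%N by rewrite IH ?addn2.
  split; first by rewrite h0 hh ?addn2.
  by rewrite h0 ?hh // IH ?e0.
Qed.

Lemma hrun0 c m : hrun c m 0%N = m 0%N.
Proof. by rewrite hrun_low // addn2. Qed.

Lemma hrun_frame c m n a x : m 0%N = n -> well_formed c -> (a < narr)%N -> a \notin writes c ->
  arr n (hrun c m) a x = arr n m a x.
Proof.
move=> hn wf ha; elim: c m hn wf => [d i e|c1 IH1 c2 IH2|y b c IH] m hn /=.
- rewrite inE => /andP[_ hd] ne; rewrite eval_cellE hn arr_update //.
  by rewrite (negPf ne).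
- rewrite mem_cat => /andP[w1 w2] /norP[n1 n2]; rewrite IH2 ?IH1 //.
  by rewrite hrun0.
- rewrite inE => /and3P[/andP[_ hy] _ w] /norP[ny nc].
  set m1 := iter _ _ _; suff [] : m1 0%N = n /\ arr n m1 a x = arr n m a x by [].
  rewrite {}/m1; apply: (iter_inv (P := fun m1 => m1 0%N = n /\ arr n m1 a x = arr n m a x)).
    by rewrite eval_cellE hn arr_update // (negPf ny) update_low ?addn2.
  move=> m1 [e0 ey]; rewrite /incr_var eval_cellE.
  have e1 : hrun c m1 0%N = n by rewrite hrun0.
  by rewrite e1 arr_update // (negPf ny) update_low ?addn2 // IH.
Qed.

Lemma incr_varE n m x : m 0%N = n -> incr_var x m = update m (cell n x 0) (arr n m x 0).+1.
Proof. by move=> hn; rewrite /incr_var eval_cellE -[eval_expr _ (Plus _ _)]/(eval_expr m (var x) + 1)%N eval_var hn addn1. Qed.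

Definition for_state (x : nat) (c : hcmd) (m : memory) (i : nat) : memory :=
  iter i (fun m1 => incr_var x (hrun c m1))
    (update m (eval_expr m (cellE x (Const 0))) 0%N).

Lemma for_state_inv x b c m n w i :
  (forall m, word_inv n w m -> word_inv n w (hrun c m)) ->
  (0 < x < narr)%N -> x \notin writes c -> well_formed c ->
  (mono_val n b <= 2 ^ w)%N -> word_inv n w m -> (i <= mono_val n b)%N ->
  word_inv n w (for_state x c m i) /\ arr n (for_state x c m i) x 0 = i.
Proof.
move=> Hc /andP[x0 hx] nx wf hb [e0 hm hW]; elim: i => [|i IH] hi.
  rewrite /for_state /= eval_cellE e0 [eval_expr _ _]/=.
  split; last by rewrite arr_update // !eqxx.
  split; first by rewrite update_low ?addn2.
    by move=> y; rewrite /update; case: ifP.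
  by rewrite arr_update // [0%N == x]eq_sym (gtn_eqF x0).
have [[f0 fm fW] fx] := IH (ltnW hi).
have [g0 gm gW] := Hc _ (And3 f0 fm fW).
rewrite /for_state iterS -/(for_state x c m i) (incr_varE _ g0).
have -> : arr n (hrun c (for_state x c m i)) x 0 = i by rewrite hrun_frame.
split; last by rewrite arr_update // !eqxx.
split; first by rewrite update_low ?addn2.
  by move=> y; rewrite /update; case: ifP => // _; apply: leq_trans hb.
by rewrite arr_update // [0%N == x]eq_sym (gtn_eqF x0).
Qed.

Lemma hrun_inv c n w m : well_formed c -> fits n w c -> word_inv n w m -> word_inv n w (hrun c m).
Proof.
elim: c m => [d i e|c1 IH1 c2 IH2|x b c IH] m.
- move=> /= /andP[d0 hd] _ [e0 hm hW].
  rewrite eval_cellE eval_modE e0 hW.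
  split; first by rewrite update_low ?addn2.
    by move=> y; rewrite /update; case: ifP => // _; apply/ltnW/ltn_pmod; rewrite expn_gt0.
  by rewrite arr_update // [0%N == d]eq_sym (gtn_eqF d0).
- by move=> /= /andP[w1 w2] /andP[f1 f2] I; apply: IH2 => //; apply: IH1.
- move=> /= /and3P[hx nx wf] /andP[hb f] I.
  have e0 : m 0%N = n by case: I.
  rewrite -/(for_state x c m (mono_val (m 0%N) b)) e0.
  by have [] := for_state_inv (fun m => IH m wf f) hx nx wf hb I (leqnn _).
Qed.

Lemma exec_while e c (st : nat -> memory) N C D :
  (forall i, (i < N)%N -> exists t, exec c (st i) (st i.+1) t /\ (t <= C)%N) ->
  (forall i, (i < N)%N -> eval_expr (st i) e != 0%N) -> eval_expr (st N) e = 0%N ->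
  (forall i, (i <= N)%N -> (expr_cost (st i) e <= D)%N) ->
  exists t, exec (While e c) (st 0%N) (st N) t /\ (t <= N * (C + D).+1 + D.+1)%N.
Proof.
elim: N st => [|N IH] st hc ht h0 hD.
  by exists (expr_cost (st 0%N) e).+1; split; [apply: ExecWhileFalse | rewrite mul0n ltnS hD].
have [t1 [e1 l1]] := hc 0%N isT.
have [|||| t2 [e2 l2]] := IH (fun i => st i.+1).
- by move=> i hi; apply: hc.
- by move=> i hi; apply: ht.
- by [].
- by move=> i hi; apply: hD.
exists (expr_cost (st 0%N) e + t1 + t2).+1; split.
  by apply: ExecWhileTrue e1 e2; apply: ht.
by have := hD 0%N isT; nia.
Qed.

Lemma word_lt n w m : word_inv n w m -> forall y, (m y < 2 ^ w.+1)%N.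
Proof. by case=> _ h _ y; apply: leq_ltn_trans (h y) _; rewrite ltn_exp2l. Qed.

(** The polynomial depends on the command only. A loop guard is a truncated difference, nonzero
    exactly while the counter is below the bound, and [word_inv] prices every pass uniformly. *)
Lemma compile_exec c : well_formed c -> exists p : {poly nat}, forall n w m,
  fits n w c -> word_inv n w m ->
  exists t, exec (compile c) m (hrun c m) t /\ (t <= p.[n] * w.+1)%N.
Proof.
elim: c => [d i e|c1 IH1 c2 IH2|x b c IH].
- move=> _; have [K1 [_ h1]] := expr_cost_le (cellE d i); have [K2 [_ h2]] := expr_cost_le (modE e).
  exists (K1 + K2 + 1)%N%:P => n w m _ I.
  exists (expr_cost m (cellE d i) + expr_cost m (modE e)).+1; split; first exact: ExecWrite.
  have [_ l1] := h1 m w.+1 isT (word_lt I); have [_ l2] := h2 m w.+1 isT (word_lt I).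
  by rewrite hornerC; nia.
- move=> /= /andP[w1 w2]; have [p1 h1] := IH1 w1; have [p2 h2] := IH2 w2.
  exists (p1 + p2 + 1) => n w m /andP[f1 f2] I.
  have [t1 [e1 l1]] := h1 n w m f1 I.
  have [t2 [e2 l2]] := h2 n w _ f2 (hrun_inv w1 f1 I).
  exists (t1 + t2).+1; split; first exact: ExecSeq e1 e2.
  have -> : (p1 + p2 + 1).[n] = (p1.[n] + p2.[n] + 1)%N by rewrite !hornerE.
  by nia.
- move=> /= /and3P[hx nx wf]; have [p hp] := IH wf.
  have [K1 [_ h1]] := expr_cost_le (cellE x (Const 0)).
  have [K2 [_ h2]] := expr_cost_le (Plus (var x) (Const 1)).
  have [K3 [_ h3]] := expr_cost_le (Minus (monoE b) (var x)).
  exists ((b.1%:P * 'X^(b.2)) * (p + (K1 + K2 + K3 + 3)%N%:P) + (K1 + K3 + 5)%N%:P) => n w m /andP[hb f] I.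
  have e0 : m 0%N = n by case: I.
  have Inv j : (j <= mono_val n b)%N -> word_inv n w (for_state x c m j) /\ arr n (for_state x c m j) x 0 = j.
    exact: for_state_inv (fun m => hrun_inv wf f) hx nx wf hb I.
  have tst j : (j <= mono_val n b)%N ->
      eval_expr (for_state x c m j) (Minus (monoE b) (var x)) = (mono_val n b - j)%N.
    move=> hj; have [[z0 _ _] vx] := Inv j hj.
    rewrite -[LHS]/(eval_expr _ (monoE b) - eval_expr _ (var x))%N.
    by rewrite eval_monoE eval_var z0 vx.
  have [||||t [ex lt]] := @exec_while (Minus (monoE b) (var x))
     (Seq (compile c) (Write (cellE x (Const 0)) (Plus (var x) (Const 1)))) (for_state x c m)
     (mono_val n b) (p.[n] * w.+1 + (K1 + K2) * w.+1 + 2) (K3 * w.+1).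
  + move=> j hj; have [Ij vx] := Inv j (ltnW hj).
    have [t [ex lt]] := hp n w _ f Ij.
    have J := hrun_inv wf f Ij.
    eexists; split; first by apply: (ExecSeq ex); apply: ExecWrite.
    have [_ l1] := h1 _ w.+1 isT (word_lt J); have [_ l2] := h2 _ w.+1 isT (word_lt J).
    by move: l1 l2; set a := expr_cost _ _; set a' := expr_cost _ _; move=> l1 l2; nia.
  + by move=> j hj; rewrite tst ?(ltnW hj) // -lt0n subn_gt0.
  + by rewrite tst ?subnn.
  + move=> j hj; have [Ij _] := Inv j hj.
    by have [] := h3 _ w.+1 isT (word_lt Ij).
  exists ((expr_cost m (cellE x (Const 0)) + expr_cost m (Const 0)).+1 + t).+1; split.
    by apply: ExecSeq; [exact: ExecWrite | rewrite e0; exact: ex].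
  have [_ l1] := h1 _ w.+1 isT (word_lt I).
  have l0 : (expr_cost m (Const 0) = 1)%N by [].
  rewrite l0.
  have -> : (b.1%:P * 'X^(b.2) * (p + (K1 + K2 + K3 + 3)%N%:P) + (K1 + K3 + 5)%N%:P).[n] =
     (mono_val n b * (p.[n] + (K1 + K2 + K3 + 3)) + (K1 + K3 + 5))%N.
    have E q : (n : nat) ^+ q = (n ^ q)%N by elim: q => // q IHq; rewrite exprS IHq expnS.
    by rewrite !hornerE E.
  move: l1 lt; set a := expr_cost _ _; set N := mono_val _ _; set P := p.[n] => l1 lt.
  by nia.
Qed.

(** * Prologue, epilogue and the algorithm computed by a program *)

Definition initial_memory (n : nat) (E : edge_set n) (u : 'I_n) : memory := fun x =>
  match x with
  | 0 => n
  | 1 => u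
  | y.+2 => [exists i : 'I_n, exists j : 'I_n, (y == i * n + j)%N && is_edge E i j]
  end.

Lemma mem_index_inj n (i j k l : nat) : (j < n)%N -> (l < n)%N ->
  (i * n + j = k * n + l)%N -> i = k /\ j = l.
Proof.
move=> hj hl e; have n0 : (0 < n)%N by apply: leq_ltn_trans hj.
have := congr1 (fun z => z %% n)%N e; rewrite !modnMDl !modn_small // => ejl.
have := congr1 (fun z => z %/ n)%N e; rewrite !divnMDl // !divn_small // !addn0.
by [].
Qed.

Lemma mem_index_lt n (i j : nat) : (i < n)%N -> (j < n)%N -> (i * n + j < n * n)%N.
Proof. by move=> hi hj; nia. Qed.

Lemma holds_initial_memory n (E : edge_set n) (u : 'I_n) : holds_input (initial_memory E u) E u.
Proof.
split=> //.
  move=> i j; rewrite -addnA /=; congr nat_of_bool.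
  apply/existsP/idP => [[i' /existsP[j' /andP[/eqP e h]]]|h].
    have [/val_inj -> /val_inj ->] := mem_index_inj (ltn_ord j) (ltn_ord j') e; exact: h.
  by exists i; apply/existsP; exists j; rewrite eqxx.
move=> [|[|x]] //=; rewrite add2n !ltnS => h.
case: existsP => // -[i /existsP[j /andP[/eqP e _]]].
by have := mem_index_lt (ltn_ord i) (ltn_ord j); rewrite -e ltnNge h.
Qed.

(** The input convention fixes every cell, so one canonical memory can serve to define the algorithm
    as a function of graph and vertex. *)
Lemma holds_input_unique n (E : edge_set n) (u : 'I_n) m :
  holds_input m E u -> m = initial_memory E u.
Proof.
have [h0 h1 hE hz] := holds_initial_memory E u.
move=> [m0 m1 mE mz]; apply/funext => x.
have [hx|hx] := leqP (2 + n * n) x; first by rewrite mz ?hz.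
case: x hx => [_|[_|y hx]]; [by rewrite m0 | by rewrite m1 |].
have hy : (y < n * n)%N by rewrite add2n !ltnS in hx.
have n0 : (0 < n)%N by case: (n) hy.
have hq : (y %/ n < n)%N by rewrite ltn_divLR.
have hr : (y %% n < n)%N by rewrite ltn_pmod.
have <- : (2 + y %/ n * n + y %% n = y.+2)%N by rewrite -addnA -divn_eq add2n.
exact: etrans (mE (Ordinal hq) (Ordinal hr)) (esym (hE (Ordinal hq) (Ordinal hr))).
Qed.

Definition double_word (m : memory) : memory :=
  incr_var 1 (update m (eval_expr m (cellE 0 (Const 0)))
                       (eval_expr m (Times (var 0) (Const 2)))).

Definition prologue_state (m : memory) (i : nat) : memory :=
  iter i double_word
    (let m1 := update m (eval_expr m (cellE 0 (Const 0))) 1%N in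
     update m1 (eval_expr m1 (cellE 1 (Const 0))) 0%N).

(** The modulus [2 ^ w] is exponential in [n], so it is built by [w] doublings; well-formed [hcmd]
    programs never write array [0] afterwards. *)
Definition prologue (b : mono) : cmd :=
  Seq (Seq (Write (cellE 0 (Const 0)) (Const 1)) (Write (cellE 1 (Const 0)) (Const 0)))
    (While (Minus (monoE b) (var 1))
       (Seq (Write (cellE 0 (Const 0)) (Times (var 0) (Const 2)))
            (Write (cellE 1 (Const 0)) (Plus (var 1) (Const 1))))).

Lemma double_wordE n m : m 0%N = n ->
  double_word m = update (update m (cell n 0 0) (arr n m 0 0 * 2)%N) (cell n 1 0) (arr n m 1 0).+1.
Proof.
move=> hn; rewrite /double_word eval_cellE hn.
rewrite -[eval_expr _ (Times _ _)]/(eval_expr m (var 0) * 2)%N eval_var hn.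
by rewrite (@incr_varE n) ?update_low ?addn2 // arr_update.
Qed.

Lemma prologue_state_inv n w m i : m 0%N = n -> (forall y, m y <= 2 ^ w)%N -> (i <= w)%N ->
  [/\ prologue_state m i 0%N = n, (forall y, prologue_state m i y <= 2 ^ w)%N,
     arr n (prologue_state m i) 0 0 = (2 ^ i)%N & arr n (prologue_state m i) 1 0 = i] /\
  (forall y, (y < n * n + 2)%N -> prologue_state m i y = m y).
Proof.
move=> hn hm; elim: i => [|i IH] hi.
  have e0 : update m (cell n 0 0) 1%N 0%N = n by rewrite update_low ?addn2.
  rewrite /prologue_state /= !evalE hn e0 !arr_update //=.
  split; last by move=> y hy; rewrite !update_low ?addn2 // ltnS; lia.
  split=> //; first by rewrite !update_low ?addn2.
  by move=> y; rewrite /update; do 2 (case: ifP => _ //); rewrite expn_gt0.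
have [[p0 pm pW px] pl] := IH (ltnW hi).
rewrite /prologue_state iterS -/(prologue_state m i) (double_wordE p0) pW px.
split; last by move=> y hy; rewrite !update_low ?pl.
split; rewrite ?update_low ?addn2 // ?arr_update // ?expnSr //.
move=> y; rewrite /update; case: ifP => _; first by apply: leq_trans hi _; apply/ltnW/ltn_expl.
by case: ifP => _ //; rewrite -expnSr leq_exp2l.
Qed.

Lemma prologue_exec b : exists p : {poly nat}, forall n m,
  m 0%N = n -> (forall y, m y <= 2 ^ mono_val n b)%N ->
  exists t, exec (prologue b) m (prologue_state m (mono_val n b)) t /\
    (t <= p.[n] * (mono_val n b).+1)%N.
Proof.
have [K1 [_ h1]] := expr_cost_le (cellE 0 (Const 0)).
have [K2 [_ h2]] := expr_cost_le (cellE 1 (Const 0)).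
have [K3 [_ h3]] := expr_cost_le (Times (var 0) (Const 2)).
have [K4 [_ h4]] := expr_cost_le (Plus (var 1) (Const 1)).
have [K5 [_ h5]] := expr_cost_le (Minus (monoE b) (var 1)).
exists ((b.1%:P * 'X^(b.2)) * (K1 + K2 + K3 + K4 + K5 + 4)%N%:P + (K1 + K2 + K5 + 8)%N%:P) => n m hn hm.
set w := mono_val n b in hm *.
have lt j : (j <= w)%N -> forall y, (prologue_state m j y < 2 ^ w.+1)%N.
  move=> hj y; have [[_ h _ _] _] := prologue_state_inv hn hm hj.
  by apply: leq_ltn_trans (h y) _; rewrite ltn_exp2l.
have hm' y : (m y < 2 ^ w.+1)%N by apply: leq_ltn_trans (hm y) _; rewrite ltn_exp2l.
have tst j : (j <= w)%N -> eval_expr (prologue_state m j) (Minus (monoE b) (var 1)) = (w - j)%N.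
  move=> hj; have [[z0 _ _ vx] _] := prologue_state_inv hn hm hj.
  rewrite -[LHS]/(eval_expr _ (monoE b) - eval_expr _ (var 1))%N.
  by rewrite eval_monoE eval_var z0 vx.
have [||||t [ex lt']] := @exec_while (Minus (monoE b) (var 1))
     (Seq (Write (cellE 0 (Const 0)) (Times (var 0) (Const 2)))
            (Write (cellE 1 (Const 0)) (Plus (var 1) (Const 1)))) (prologue_state m)
     w ((K1 + K2 + K3 + K4) * w.+1 + 3) (K5 * w.+1).
- move=> j hj; eexists; split; first by apply: ExecSeq; exact: ExecWrite.
  have [_ l1] := h1 _ w.+1 isT (lt _ (ltnW hj)); have [_ l3] := h3 _ w.+1 isT (lt _ (ltnW hj)).
  set m1 := update _ _ _.
  have hm1 y : (m1 y < 2 ^ w.+1)%N.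
    rewrite /m1 /update; case: ifP => _; last exact: lt (ltnW hj) y.
    have [[z0 _ zW _] _] := prologue_state_inv hn hm (ltnW hj).
    rewrite -[eval_expr _ _]/(eval_expr (prologue_state m j) (var 0) * 2)%N eval_var z0 zW.
    by rewrite -expnSr ltn_exp2l.
  have [_ l2] := h2 _ w.+1 isT hm1; have [_ l4] := h4 _ w.+1 isT hm1.
  by move: l1 l2 l3 l4; move: (expr_cost _ _) (expr_cost _ _) (expr_cost _ _) (expr_cost _ _) => a a1 a2 a3; nia.
- by move=> j hj; rewrite tst ?(ltnW hj) // -lt0n subn_gt0.
- by rewrite tst ?subnn.
- by move=> j hj; have [] := h5 _ w.+1 isT (lt _ hj).
eexists; split.
  by apply: ExecSeq; [apply: ExecSeq; exact: ExecWrite | exact: ex].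
have [_ l1] := h1 _ w.+1 isT hm'.
set m1 := update _ _ _.
have hm1 y : (m1 y < 2 ^ w.+1)%N.
  by rewrite /m1 /update; case: ifP => _ //; rewrite eval_Const; apply: leq_ltn_trans (ltn_expl w.+1 _).
have [_ l2] := h2 _ w.+1 isT hm1.
have -> : (b.1%:P * 'X^(b.2) * (K1 + K2 + K3 + K4 + K5 + 4)%N%:P + (K1 + K2 + K5 + 8)%N%:P).[n] =
     (w * (K1 + K2 + K3 + K4 + K5 + 4) + (K1 + K2 + K5 + 8))%N.
  have E q : (n : nat) ^+ q = (n ^ q)%N by elim: q => // q IHq; rewrite exprS IHq expnS.
  by rewrite !hornerE E.
move: l1 l2 lt'; rewrite -![expr_cost _ (Const _)]/1%N.
by move: (expr_cost _ _) (expr_cost _ _) => a a1; nia.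
Qed.

Definition indE (e : expr) : expr := Minus (Const 1) (Minus (Const 1) e).

Lemma eval_indE m e : eval_expr m (indE e) = (eval_expr m e != 0%N) :> nat.
Proof.
rewrite -[LHS]/(1 - (1 - eval_expr m e))%N.
by case: (eval_expr m e) => [|k]; rewrite ?subnn // subSS sub0n subn0.
Qed.

Definition output_step (o : nat) (m : memory) : memory :=
  let m1 := update m (eval_expr m (var 1)) (eval_expr m (indE (get o (var 1)))) in
  update m1 (eval_expr m1 (cellE 1 (Const 0))) (eval_expr m1 (Minus (var 1) (Const 1))).

Definition output_state (o : nat) (m : memory) (i : nat) : memory :=
  iter i (output_step o)
    (update m (eval_expr m (cellE 1 (Const 0))) (eval_expr m (Minus nE (Const 1)))).

Definition output_result (o : nat) (m : memory) (n : nat) : memory :=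
  let m1 := output_state o m n.-1 in
  update m1 0%N (eval_expr m1 (indE (get o (Const 0)))).

(* Cell [0] is written last because every array address is computed from it. *)
Definition epilogue (o : nat) : cmd :=
  Seq (Seq (Write (cellE 1 (Const 0)) (Minus nE (Const 1)))
    (While (var 1)
       (Seq (Write (var 1) (indE (get o (var 1))))
            (Write (cellE 1 (Const 0)) (Minus (var 1) (Const 1))))))
    (Write (Const 0) (indE (get o (Const 0)))).

(** The output cells lie below all arrays, which start at [n * n + 2]: writing them destroys the
    input but not the result array. The index descends so that it doubles as the loop guard. *)
Lemma output_state_inv o n w m i : (1 < o < narr)%N -> (0 < n)%N -> m 0%N = n -> (n <= 2 ^ w)%N ->
  (forall y, m y <= 2 ^ w)%N -> (i <= n.-1)%N ->
  let s := output_state o m i in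
  [/\ s 0%N = n, (forall y, s y <= 2 ^ w)%N,
     arr n s 1 0 = (n.-1 - i)%N, (forall x, arr n s o x = arr n m o x) &
  (forall y, (n.-1 - i < y < n)%N -> s y = (arr n m o y != 0%N))].
Proof.
move=> /andP[lo ho] n0 hn hw hm; elim: i => [|i IH] hi.
  rewrite /output_state /= eval_cellE hn -[eval_expr _ (Minus _ _)]/(m 0%N - 1)%N hn.
  split; rewrite ?update_low ?addn2 ?subn0 ?subn1 //.
  - by move=> y; rewrite /update; case: ifP => // _; apply: leq_trans hw; rewrite leq_pred.
  - by rewrite arr_update.
  - by move=> x; rewrite arr_update // gtn_eqF.
  - by move=> y; lia.
have [s0 sm s1 so sy] := IH (ltnW hi).
rewrite /output_state iterS -/(output_state o m i) /output_step.
set s := output_state o m i in s0 sm s1 so sy *.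
rewrite eval_indE eval_get eval_var s0 s1 so.
set v := (n.-1 - i)%N; have v0 : (0 < v)%N by rewrite subn_gt0.
have vn : (v < n)%N by apply: leq_ltn_trans (leq_subr _ _) _; rewrite prednK.
have ev a : (a < narr)%N -> (cell n a 0 == v) = false.
  by move=> ha; apply/eqP => e; move: vn; rewrite -e /cell; nia.
have ecv a x : (cell n a x == v) = false.
  by apply/eqP => e; move: vn; rewrite -e /cell; nia.
set m1 := update s v _.
have m10 : m1 0%N = n by rewrite /m1 /update [0%N == v]eq_sym (gtn_eqF v0).
have m1c a x : arr n m1 a x = arr n s a x by rewrite /arr /m1 /update ecv.
rewrite eval_cellE m10 -[eval_expr _ (Minus _ _)]/(eval_expr m1 (var 1) - 1)%N eval_var m10 m1c s1 -/v.
split; rewrite ?update_low ?addn2 //.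
- move=> y; rewrite /update; case: ifP => _; first by apply: leq_trans hw; lia.
  by rewrite /m1 /update; case: ifP => // _; case: (_ != _); rewrite // expn_gt0.
- by rewrite arr_update // !eqxx -subnDA addn1.
- by move=> x; rewrite arr_update // (gtn_eqF lo) /= m1c so.
- move=> y; rewrite subnS -/v => hy; rewrite update_low; last by nia.
  rewrite /m1 /update; case: eqP => [->//|ne]; apply: sy; rewrite -/v; lia.
Qed.

Lemma epilogue_exec o : (1 < o < narr)%N -> exists p : {poly nat}, forall n w m,
  (0 < n)%N -> m 0%N = n -> (n <= 2 ^ w)%N -> (forall y, m y <= 2 ^ w)%N ->
  exists t, exec (epilogue o) m (output_result o m n) t /\ (t <= p.[n] * w.+1)%N.
Proof.
move=> ho.
have [K1 [_ h1]] := expr_cost_le (cellE 1 (Const 0)).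
have [K2 [_ h2]] := expr_cost_le (Minus nE (Const 1)).
have [K3 [_ h3]] := expr_cost_le (var 1).
have [K4 [_ h4]] := expr_cost_le (indE (get o (var 1))).
have [K5 [_ h5]] := expr_cost_le (Minus (var 1) (Const 1)).
have [K6 [_ h6]] := expr_cost_le (indE (get o (Const 0))).
exists ('X * (K1 + K3 + K3 + K4 + K5 + 4)%N%:P + (K1 + K2 + K3 + K6 + 9)%N%:P) => n w m n0 hn hw hm.
have Inv j (hj : (j <= n.-1)%N) := output_state_inv ho n0 hn hw hm hj.
have lt j : (j <= n.-1)%N -> forall y, (output_state o m j y < 2 ^ w.+1)%N.
  move=> hj y; have [_ h _ _ _] := Inv j hj.
  by apply: leq_ltn_trans (h y) _; rewrite ltn_exp2l.
have hm' y : (m y < 2 ^ w.+1)%N by apply: leq_ltn_trans (hm y) _; rewrite ltn_exp2l.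
have tst j : (j <= n.-1)%N -> eval_expr (output_state o m j) (var 1) = (n.-1 - j)%N.
  by move=> hj; have [z0 _ vx _ _] := Inv j hj; rewrite eval_var z0 vx.
have [||||t [ex lt']] := @exec_while (var 1)
     (Seq (Write (var 1) (indE (get o (var 1))))
            (Write (cellE 1 (Const 0)) (Minus (var 1) (Const 1)))) (output_state o m)
     n.-1 ((K1 + K3 + K4 + K5) * w.+1 + 3) (K3 * w.+1).
- move=> j hj; eexists; split; first by apply: ExecSeq; exact: ExecWrite.
  have [_ l3] := h3 _ w.+1 isT (lt _ (ltnW hj)); have [_ l4] := h4 _ w.+1 isT (lt _ (ltnW hj)).
  set m1 := update _ _ _.
  have hm1 y : (m1 y < 2 ^ w.+1)%N.
    rewrite /m1 /update; case: ifP => _; last exact: lt (ltnW hj) y.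
    by rewrite eval_indE; apply: leq_ltn_trans (leq_b1 _) _; apply: leq_ltn_trans (ltn_expl w.+1 _).
  have [_ l1] := h1 _ w.+1 isT hm1; have [_ l5] := h5 _ w.+1 isT hm1.
  by move: l1 l3 l4 l5; move: (expr_cost _ _) (expr_cost _ _) (expr_cost _ _) (expr_cost _ _) => a a1 a2 a3; nia.
- by move=> j hj; rewrite tst ?(ltnW hj) // -lt0n subn_gt0.
- by rewrite tst ?subnn.
- by move=> j hj; have [] := h3 _ w.+1 isT (lt _ hj).
eexists; split.
  by apply: ExecSeq; [apply: ExecSeq; [exact: ExecWrite | exact: ex] | exact: ExecWrite].
have [_ l1] := h1 _ w.+1 isT hm'; have [_ l2] := h2 _ w.+1 isT hm'.
have [_ l6] := h6 _ w.+1 isT (lt _ (leqnn _)).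
have -> : ('X * (K1 + K3 + K3 + K4 + K5 + 4)%N%:P + (K1 + K2 + K3 + K6 + 9)%N%:P).[n] =
   (n * (K1 + K3 + K3 + K4 + K5 + 4) + (K1 + K2 + K3 + K6 + 9))%N by rewrite !hornerE.
have hn1 : (n.-1 <= n)%N by exact: leq_pred.
move: l1 l2 l6 lt' hn1; rewrite -![expr_cost _ (Const _)]/1%N.
by move: (expr_cost _ _) (expr_cost _ _) (expr_cost _ _) => a a1 a2; move: (n.-1) => n1; nia.
Qed.

Lemma output_resultE o w n m : (1 < o < narr)%N -> (0 < n)%N -> m 0%N = n -> (n <= 2 ^ w)%N ->
  (forall y, m y <= 2 ^ w)%N ->
  forall y, (y < n)%N -> output_result o m n y = (arr n m o y != 0%N).
Proof.
move=> ho n0 hn hw hm y hy; rewrite /output_result.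
have [s0 _ _ so sy] := output_state_inv ho n0 hn hw hm (leqnn _).
rewrite eval_indE eval_get s0 so /update; case: eqP => [->//|ne].
by apply: sy; rewrite subnn hy andbT lt0n; apply/eqP.
Qed.

Definition program_output (b : mono) (c : hcmd) n (E : edge_set n) (u : 'I_n) : memory :=
  hrun c (prologue_state (initial_memory E u) (mono_val n b)).

(** The algorithm is whatever the program leaves in array [o]; its running time is then a fact about
    the machine alone, and its combinatorial meaning is a separate matter ([main_alg_spec]). *)
Definition program_alg (b : mono) (c : hcmd) (o : nat) : algorithm := fun n E u =>
  [set v : 'I_n | arr n (program_output b c E u) o v != 0%N].

Lemma mono_gt n (b : mono) : (0 < n)%N -> (0 < b.1)%N -> (0 < b.2)%N -> (n <= mono_val n b)%N.
Proof.
move=> n0 b1 b2; rewrite /mono_val -(prednK b2) expnS mulnA -{1}(mul1n n) -{1}(muln1 (1 * n)%N).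
by rewrite leq_mul ?expn_gt0 ?n0 // leq_mul.
Qed.

Lemma program_start b n (E : edge_set n) (u : 'I_n) : (0 < b.1)%N -> (0 < b.2)%N ->
  let m := prologue_state (initial_memory E u) (mono_val n b) in
  [/\ word_inv n (mono_val n b) m,
      m 1%N = u & forall i j : 'I_n, m (2 + i * n + j)%N = is_edge E i j].
Proof.
move=> b1 b2; set w := mono_val n b.
have n0 : (0 < n)%N by case: (n) u => [[]|].
have hw : (n <= 2 ^ w)%N by apply: leq_trans (mono_gt n0 b1 b2) _; apply/ltnW/ltn_expl.
have hm y : (initial_memory E u y <= 2 ^ w)%N.
  case: y => [|[|y]] //=; first by apply: leq_trans hw; apply: ltnW.
  by case: [exists _, _]; rewrite // expn_gt0.
have [h0 h1 hE _] := holds_initial_memory E u.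
have [[p0 pm pW _] pl] := prologue_state_inv h0 hm (leqnn w).
split=> //; first by rewrite pl ?addn2.
by move=> i j; rewrite pl ?hE // -addnA addnC ltn_add2r mem_index_lt.
Qed.

Lemma program_poly_time b c o : well_formed c -> (1 < o < narr)%N -> (0 < b.1)%N -> (0 < b.2)%N ->
  (forall n, (0 < n)%N -> fits n (mono_val n b) c) -> poly_time (program_alg b c o).
Proof.
move=> wf ho b1 b2 hf.
have [p1 h1] := prologue_exec b; have [p2 h2] := compile_exec wf; have [p3 h3] := epilogue_exec ho.
exists (Seq (prologue b) (Seq (compile c) (epilogue o))).
exists ((p1 + p2 + p3 + 2%N%:P) * (b.1%:P * 'X^(b.2) + 1%N%:P)) => n E u m _ /holds_input_unique ->.
have n0 : (0 < n)%N by case: (n) u => [[]|].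
set w := mono_val n b.
have hw : (n <= 2 ^ w)%N by apply: leq_trans (mono_gt n0 b1 b2) _; apply/ltnW/ltn_expl.
have hm y : (initial_memory E u y <= 2 ^ w)%N.
  case: y => [|[|y]] //=; first by apply: leq_trans hw; apply: ltnW.
  by case: [exists _, _]; rewrite // expn_gt0.
have [I _ _] := program_start E u b1 b2; rewrite -/w in I.
have [t1 [e1 l1]] := h1 n _ erefl hm.
have [t2 [e2 l2]] := h2 n w _ (hf n n0) I.
have [J0 Jm _] := hrun_inv wf (hf n n0) I.
have [t3 [e3 l3]] := h3 n w _ n0 J0 hw Jm.
eexists; eexists; split; first by apply: ExecSeq e1 _; apply: ExecSeq e2 e3.
  have -> : ((p1 + p2 + p3 + 2%N%:P) * (b.1%:P * 'X^(b.2) + 1%N%:P)).[n] = ((p1.[n] + p2.[n] + p3.[n] + 2) * w.+1)%N.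
    have E0 q : (n : nat) ^+ q = (n ^ q)%N by elim: q => // q IHq; rewrite exprS IHq expnS.
    by rewrite -(addn1 w) hornerM !hornerD !hornerC hornerM hornerC hornerXn E0.
  move: l1 l2 l3; rewrite -/w; nia.
by move=> i; rewrite (output_resultE ho n0 J0 hw Jm) // inE.
Qed.

(** * The algorithm *)

Definition mat (n : nat) (m : memory) (a i j : nat) : nat := arr n m a (i * n + j).

Definition getm (a : nat) (i j : expr) : expr := get a (Plus (Times i nE) j).

Definition adjE (i j : expr) : expr := Read (Plus (Plus (Const 2) (Times i nE)) j).

Lemma eval_getm m a i j :
  eval_expr m (getm a i j) = mat (m 0%N) m a (eval_expr m i) (eval_expr m j).
Proof. by []. Qed.

Lemma eval_adjE m i j :
  eval_expr m (adjE i j) = m (2 + eval_expr m i * m 0 + eval_expr m j)%N.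
Proof. by []. Qed.

Definition hmap (d : nat) (e : expr) : hcmd :=
  HFor 2 (1, 1)%N (HFor 3 (1, 1)%N (HStore d (Plus (Times (var 2) nE) (var 3)) e)).

(** The summation index is the outer loop: each pass adds one term to all the partial sums in array
    [d], so [hmap] can be reused. *)
Definition hsum (d : nat) (e : expr) : hcmd :=
  HSeq (hmap d (Const 0)) (HFor 4 (1, 1)%N (hmap d (Plus (getm d (var 2) (var 3)) e))).

(** Invariant rule for loops: [P i] speaks of the memory once the counter has been set to [i]. *)
Lemma HFor_rule n w x b c m (P : nat -> memory -> Prop) :
  well_formed (HFor x b c) -> fits n w (HFor x b c) -> word_inv n w m ->
  P 0%N (update m (cell n x 0) 0%N) ->
  (forall i m1, (i < mono_val n b)%N -> word_inv n w m1 -> arr n m1 x 0 = i -> P i m1 ->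
     word_inv n w (hrun c m1) -> P i.+1 (update (hrun c m1) (cell n x 0) i.+1)) ->
  P (mono_val n b) (hrun (HFor x b c) m).
Proof.
move=> /= /and3P[hx nx wf] /andP[hb f] I; have e0 : m 0%N = n by case: I.
move=> P0 PS; rewrite -/(for_state x c m (mono_val (m 0%N) b)) e0.
have: (mono_val n b <= mono_val n b)%N by [].
elim: {1 3 4}(mono_val n b) => [_|i IH hi]; first by rewrite /for_state /= !evalE e0.
have [Ii vx] := for_state_inv (fun m => hrun_inv wf f) hx nx wf hb I (ltnW hi).
have J := hrun_inv wf f Ii; have [z0 _ _] := J; have [i0 _ _] := Ii.
rewrite /for_state iterS -/(for_state x c m i) (incr_varE _ z0) hrun_frame //; last by case/andP: hx.
by rewrite vx; apply: PS => //; apply: IH; apply: ltnW.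
Qed.

Definition same_but n (ds : seq nat) (m m1 : memory) : Prop :=
  (forall y, (y < n * n + 2)%N -> m1 y = m y) /\
  (forall a x, (a < narr)%N -> a \notin ds -> arr n m1 a x = arr n m a x).

Lemma same_but_update n ds m m1 d i v : (d < narr)%N -> d \in ds ->
  same_but n ds m m1 -> same_but n ds m (update m1 (cell n d i) v).
Proof.
move=> hd ind [h1 h2]; split=> [y hy|a x ha na]; first by rewrite update_low // h1.
rewrite arr_update //; case: eqP => [e|_]; last by rewrite h2.
by rewrite e ind in na.
Qed.

Lemma same_but_refl n ds m : same_but n ds m m. Proof. by []. Qed.

Lemma same_but_trans n ds ds' m1 m2 m3 : {subset ds' <= ds} ->
  same_but n ds m1 m2 -> same_but n ds' m2 m3 -> same_but n ds m1 m3.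
Proof.
move=> sub [a1 a2] [b1 b2]; split=> [y hy|a x ha na]; first by rewrite b1 ?a1.
by rewrite b2 ?a2 //; apply: contra na => /sub.
Qed.

Lemma same_but_hrun n c m : m 0%N = n -> well_formed c -> same_but n (writes c) m (hrun c m).
Proof.
move=> e0 wf; split=> [y hy|a x ha na]; first by rewrite hrun_low // e0.
exact: hrun_frame.
Qed.

Definition array_id (d : nat) := (d \notin [:: 0; 2; 3; 4]%N) && (d < narr)%N.

Lemma hmap_wf d e : array_id d -> well_formed (hmap d e).
Proof.
rewrite /array_id !inE !negb_or => /andP[/and4P[d0 d2 d3 d4] h] /=.
by rewrite !inE !negb_or ![_ == d]eq_sym d2 d3 h lt0n d0.
Qed.

Lemma hmap_writes d e : writes (hmap d e) = [:: 2; 3; d]%N. Proof. by []. Qed.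

Lemma hmap_fits n w d e : (n <= 2 ^ w)%N -> fits n w (hmap d e).
Proof. by move=> h; rewrite /= /mono_val /= mul1n expn1 h. Qed.

Lemma mono11 n : mono_val n (1, 1)%N = n.
Proof. by rewrite /mono_val mul1n expn1. Qed.

(** While it is being filled, array [d] is part new and part old, so the expression may rely only on
    the old value of the very entry it overwrites; this is enough for accumulation. *)
Lemma hmap_spec n w d e m (g : 'I_n -> 'I_n -> nat) :
  word_inv n w m -> array_id d -> (n <= 2 ^ w)%N ->
  (forall m1 (i j : 'I_n), word_inv n w m1 -> same_but n [:: 2; 3; d]%N m m1 ->
     arr n m1 2 0 = i -> arr n m1 3 0 = j -> mat n m1 d i j = mat n m d i j ->
     eval_expr m1 e = g i j) ->
  forall i j : 'I_n, mat n (hrun (hmap d e) m) d i j = (g i j %% 2 ^ w)%N.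
Proof.
move=> I hd hn hg.
have := hd; rewrite /array_id !inE !negb_or => /andP[/and4P[d0 d2 d3 d4] dn].
(* The entries done so far are those lexicographically before [(i, j)]. *)
pose dn' i j (i' j' : nat) := ((i' < i) || (i' == i) && (j' < j))%N.
pose Q i j m1 := same_but n [:: 2; 3; d]%N m m1 /\ (forall i' j' : 'I_n,
  mat n m1 d i' j' = if dn' i j i' j' then (g i' j' %% 2 ^ w)%N else mat n m d i' j').
have wf := hmap_wf e hd; have f := hmap_fits d e hn.
suff H : Q n 0%N (hrun (hmap d e) m).
  by move=> i j; have [_ ->] := H; rewrite /dn' ltn_ord.
rewrite -[X in Q X](mono11 n).
apply: (HFor_rule (P := fun i => Q i 0%N) wf f I) => [|i m1].
  split; first by apply: same_but_update; rewrite ?inE.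
  move=> i' j'; rewrite /dn' /= ltn0 andbF /= /mat arr_update //.
  by rewrite (negPf d2).
rewrite mono11 => hi I1 vi Q1 J1.
set c1 := HFor 3 _ _ in J1 *.
have wf1 : well_formed c1 by case/and3P: wf.
have f1 : fits n w c1 by case/andP: f.
have [z0 _ _] := I1.
have vi' : arr n (hrun c1 m1) 2 0 = i.
  by rewrite (hrun_frame 0 z0 wf1) // -[writes c1]/[:: 3; d]%N !inE negb_or [2%N == d]eq_sym d2.
have [Qs Qm] : Q i n (hrun c1 m1).
  rewrite -[X in Q _ X](mono11 n).
  suff [] : Q i (mono_val n (1, 1)%N) (hrun c1 m1) /\ arr n (hrun c1 m1) 2 0 = i by [].
  apply: (HFor_rule (P := fun j m2 => Q i j m2 /\ arr n m2 2 0 = i) wf1 f1 I1).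
    split; last by rewrite arr_update.
    split; first by apply: same_but_update; rewrite ?inE //; case: Q1.
    by move=> i' j'; rewrite /mat arr_update // (negPf d3); case: Q1 => _; apply.
  move=> j m2; rewrite mono11 => hj I2 vj [[Q2s Q2m] vi2] J2.
  have [y0 _ yW] := I2.
  have E2 : hrun (HStore d (Plus (Times (var 2) nE) (var 3)) e) m2 =
     update m2 (cell n d (i * n + j)) (g (Ordinal hi) (Ordinal hj) %% 2 ^ w)%N.
    rewrite /= !evalE y0 yW vi2 vj (hg m2 (Ordinal hi) (Ordinal hj)) //.
    by rewrite Q2m /dn' /= ltnn eqxx ltnn.
  rewrite {}E2; split; last by rewrite !arr_update // [2%N == d]eq_sym (negPf d2).
  split; first by do 2 (apply: same_but_update; rewrite ?inE ?eqxx ?orbT //).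
  move=> i' j'; rewrite /mat !arr_update // (negPf d3) eqxx /=.
  case: eqP => [h|ne].
    have [ei ej] := mem_index_inj (ltn_ord j') hj h.
    have -> : i' = Ordinal hi by apply/val_inj.
    have -> : j' = Ordinal hj by apply/val_inj.
    by rewrite /dn' /= eqxx ltnS leqnn orbT.
  rewrite -/(mat n m2 d i' j') Q2m; congr (if _ then _ else _).
  rewrite /dn'; congr orb; case: eqP => //= ei; rewrite ltnS [RHS]leq_eqVlt.
  by case: eqP => // ej; case: ne; rewrite ei ej.
split; first by apply: same_but_update; rewrite ?inE.
move=> i' j'; rewrite /mat arr_update // (negPf d2) -/(mat n (hrun c1 m1) d i' j') Qm.
congr (if _ then _ else _); rewrite /dn' ltn_ord andbT ltn0 andbF orbF.
by rewrite ltnS [RHS]leq_eqVlt orbC.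
Qed.

Lemma hsum_wf d e : array_id d -> well_formed (hsum d e).
Proof.
move=> hd; rewrite /hsum.
have := hd; rewrite /array_id !inE !negb_or => /andP[/and4P[d0 d2 d3 d4] dn].
rewrite [well_formed _]/= !inE !negb_or ![_ == d]eq_sym d2 d3 d4 dn lt0n d0 /=.
by [].
Qed.

Lemma hsum_writes d e : writes (hsum d e) = [:: 2; 3; d; 4; 2; 3; d]%N. Proof. by []. Qed.

Lemma hsum_fits n w d e : (n <= 2 ^ w)%N -> fits n w (hsum d e).
Proof. by move=> h; rewrite /= !mono11 h. Qed.

Lemma hsum_spec n w d e m (g : 'I_n -> 'I_n -> 'I_n -> nat) :
  word_inv n w m -> array_id d -> (n <= 2 ^ w)%N ->
  (forall m1 (i j k : 'I_n), word_inv n w m1 -> same_but n [:: 2; 3; 4; d]%N m m1 ->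
     arr n m1 2 0 = i -> arr n m1 3 0 = j -> arr n m1 4 0 = k -> eval_expr m1 e = g i j k) ->
  forall i j : 'I_n, mat n (hrun (hsum d e) m) d i j = ((\sum_k g i j k) %% 2 ^ w)%N.
Proof.
move=> I hd hn hg i j.
have := hd; rewrite /array_id !inE !negb_or => /andP[/and4P[d0 d2 d3 d4] dn].
have wf1 := hmap_wf (Const 0) hd; have f1 := hmap_fits d (Const 0) hn.
have I1 := hrun_inv wf1 f1 I.
have [z0 _ _] := I.
have s1 := same_but_hrun z0 wf1; rewrite hmap_writes in s1.
have v1 := hmap_spec I hd hn (fun m1 i j _ _ _ _ _ => erefl (eval_expr m1 (Const 0)) : _ = 0%N).
have /andP[_ wf2] := hsum_wf e hd; have /andP[_ f2] := hsum_fits d e hn.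
set c2 := hmap d _ in wf2 f2.
rewrite [hrun _ _]/= -/(hmap d (Const 0)) -/c2 -/(hrun (HFor 4 (1, 1)%N c2) _).
set m1 := hrun (hmap _ _) m in I1 s1 v1 *.
pose P k m2 := same_but n [:: 2; 3; 4; d]%N m m2 /\ forall i j : 'I_n,
  mat n m2 d i j = ((\sum_(k' < n | (k' < k)%N) g i j k') %% 2 ^ w)%N.
suff [_ ->] : P n (hrun (HFor 4 (1, 1)%N c2) m1).
  by congr (_ %% _)%N; apply: eq_bigl => k; rewrite ltn_ord.
rewrite -[X in P X](mono11 n); apply: (HFor_rule wf2 f2 I1).
  split; first by apply: same_but_update; rewrite ?inE //; apply: (same_but_trans _ (same_but_refl _ _ _) s1);
    move=> x; rewrite !inE => /or3P[]->; rewrite ?orbT.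
  move=> i' j'; rewrite /mat arr_update // (negPf d4) -/(mat n m1 d i' j') v1 //.
  by rewrite big_pred0 // => k; rewrite ltn0.
move=> k m2; rewrite mono11 => hk I2 vk [P2s P2m] J2.
have wfc : well_formed c2 by case/and3P: wf2.
have [y0 _ _] := I2; have s2 := same_but_hrun y0 wfc; rewrite hmap_writes in s2.
split.
  apply: same_but_update; rewrite ?inE //; apply: (same_but_trans _ P2s s2).
  by move=> x; rewrite !inE => /or3P[]->; rewrite ?orbT.
move=> i' j'; rewrite /mat arr_update // (negPf d4) -/(mat n _ d i' j').
rewrite (hmap_spec (g := fun i j => mat n m2 d i j + g i j (Ordinal hk))%N I2 hd hn).
  rewrite P2m modnDml; congr (_ %% _)%N.
  rewrite (bigD1 (P := fun k' : 'I_n => (k' < k.+1)%N) (Ordinal hk)) //= addnC; congr (_ + _)%N.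
  by apply: eq_bigl => k'; rewrite ltnS -val_eqE /= [RHS]andbC -ltn_neqAle.
move=> m3 i1 j1 I3 s3 vi vj vd; have [x0 _ _] := I3.
rewrite eval_Plus eval_getm x0 !eval_var x0 vi vj vd; congr (_ + _)%N; apply: hg => //.
  apply: (same_but_trans _ P2s s3).
  by move=> x; rewrite !inE => /or3P[]->; rewrite ?orbT.
have [_ ->] := s3; rewrite ?vk //.
by rewrite !inE !negb_or /= [4%N == d]eq_sym.
Qed.

(** The exponents come from the error terms. The penalty [n ^ 9] forces constrained entries to
    within [3 / n ^ 3]; the scale [n ^ 16] keeps rounding negligible even when multiplied by the
    penalty. Gradients are below [n ^ 11], and the shift [n ^ 30] exceeds the roughly
    [n ^ 3 * (n ^ 11) ^ 2] that the power method asks for; the exponent [2 * n ^ 36] makes its loss,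
    of order [shift * n / n ^ 36], small. The number of rounds beats a curvature of order [n ^ 13],
    and [300 * n ^ 37] bits hold entries of size up to [(n ^ 91) ^ (2 * n ^ 36)]. *)
Definition lam_m : mono := (1, 9)%N.
Definition scale_m : mono := (1, 16)%N.
Definition shift_m : mono := (1, 30)%N.
Definition trace_m : mono := (3, 1)%N.
Definition power_m : mono := (2, 36)%N.
Definition rounds_m : mono := (1, 36)%N.
Definition word_m : mono := (300, 37)%N.

Definition mpow (R : nzRingType) n (C : 'M[R]_n) (q : nat) : 'M[R]_n :=
  iter q (mulmx^~ C) 1%:M.

Section Spec.

Variables (n : nat) (E : edge_set n).

Let lam := (mono_val n lam_m)%:Z.
Let scale := (mono_val n scale_m)%:Z.
Let shift := (mono_val n shift_m)%:Z.
Let trb := (mono_val n trace_m)%:Z.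

(** Marks the entries on which the program prescribes [X i j = (i == j)], edges and diagonal
    alike. *)
Definition mask (i j : 'I_n) : nat := (is_edge E i j + (i == j))%N.

(** With [Y = t * scale * X] this is [t * scale] times the shifted gradient of the penalised
    objective at [X], free of denominators (see [grad_mxR]). *)
Definition grad_mx (t : nat) (Y : 'M[int]_n) : 'M[int]_n :=
  \matrix_(i, j) (t%:Z * scale + (i == j)%:Z * (t%:Z * scale * (shift + lam))
                  - Y i j * lam * (mask i j)%:Z).

(** The second term comes from a dummy coordinate on which the gradient vanishes and only the shift
    remains. It keeps the divisor positive and lets the trace of a direction drop below 1. *)
Definition pow_trace (t : nat) (C : 'M[int]_n) : int :=
  \sum_k mpow C (mono_val n power_m) k k
    + (t%:Z * scale * shift) ^+ mono_val n power_m.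

(** With step sizes [1 / (q + 2)] Frank-Wolfe iterates are running averages, so it suffices to
    accumulate the directions and never divide by the round number. *)
Definition fw_step (t : nat) (Y : 'M[int]_n) : 'M[int]_n :=
  let C := grad_mx t Y in
  \matrix_(i, j) (Y i j +
    ((trb * scale * mpow C (mono_val n power_m) i j) %/ pow_trace t C)%Z).

Fixpoint fw_iter (q : nat) : 'M[int]_n :=
  if q is q'.+1 then fw_step q'.+1 (fw_iter q')
  else \matrix_(i, j) ((i == j)%:Z * scale).

End Spec.

Section Residues.

Variable W : nat.

Definition res (x : nat) (z : int) : Prop := exists q : int, x%:Z = z + q * W%:Z.

Lemma res_nat x : res x x%:Z.
Proof. by exists 0; rewrite mul0r addr0. Qed.

Lemma res_mod x z : res x z -> res (x %% W) z.
Proof.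
case=> q e; exists (q - (x %/ W)%:Z).
have h : x%:Z = (x %/ W)%:Z * W%:Z + (x %% W)%:Z by rewrite -PoszM -PoszD -divn_eq.
by apply: (addrI ((x %/ W)%:Z * W%:Z)); rewrite -h e; ring.
Qed.

Lemma res_add x y z t : res x z -> res y t -> res (x + y) (z + t).
Proof. by case=> q e [r f]; exists (q + r); rewrite PoszD e f; ring. Qed.

Lemma res_mul x y z t : res x z -> res y t -> res (x * y) (z * t).
Proof. by case=> q e [r f]; exists (q * t + z * r + q * r * W%:Z); rewrite PoszM e f; ring. Qed.

Lemma res_opp x z : (x <= W)%N -> res x z -> res (W - x) (- z).
Proof. by move=> h [q e]; exists (1 - q); rewrite -subzn // e; ring. Qed.

Lemma res_sum (I : finType) (f : I -> nat) (g : I -> int) :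
  (forall i, res (f i) (g i)) -> res (\sum_i f i) (\sum_i g i).
Proof.
move=> h; elim/big_rec2: _ => [|i x z _ r]; first exact: (res_nat 0).
exact: res_add.
Qed.

(** Residues are enough for ring operations; this recovers the exact value where a division or a
    comparison needs it. *)
Lemma res_eq x z : (x < W)%N -> 0 <= z < W%:Z -> res x z -> x%:Z = z.
Proof.
move=> hx /andP[z0 zW] [q e]; have W0 : 0 < W%:Z by lia.
have [h|[h|h]] : q <= -1 \/ q = 0 \/ 1 <= q by lia.
- by have : q * W%:Z <= -1 * W%:Z by [rewrite ler_pM2r]; lia.
- by rewrite e h mul0r addr0.
- by have : 1 * W%:Z <= q * W%:Z by [rewrite ler_pM2r]; lia.
Qed.

End Residues.

Declare Scope hcmd_scope.
Delimit Scope hcmd_scope with H.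
Notation "c1 ;; c2" := (HSeq c1 c2) (at level 61, right associativity) : hcmd_scope.

Definition eqE (e f : expr) : expr := Minus (Minus (Const 1) (Minus e f)) (Minus f e).

Lemma eval_eqE m e f : eval_expr m (eqE e f) = (eval_expr m e == eval_expr m f) :> nat.
Proof.
rewrite !evalE; move: (eval_expr m e) (eval_expr m f) => x y.
by case: (ltngtP x y) => h /=; lia.
Qed.

(* Arrays 2, 3, 4 are the indices of [hmap] and [hsum]; 5 and 6 count rounds and
   multiplications; 7 holds the Frank-Wolfe sum, 8 the shifted gradient, 9 its
   powers, 10 a temporary, 11 the dummy coordinate, 12 the normalisation. *)
Definition iE := var 2.
Definition jE := var 3.
Definition kE := var 4.
Definition roundE := Plus (var 5) (Const 1).
Definition scaledE := Times roundE (monoE scale_m).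

Definition maskE := Plus (adjE iE jE) (eqE iE jE).

Definition gradE : expr :=
  Plus (Plus scaledE (Times (eqE iE jE) (Times scaledE (Plus (monoE shift_m) (monoE lam_m)))))
    (Times (Times (Minus (var 0) (getm 7 iE jE)) (monoE lam_m)) maskE).

Definition pow_body : hcmd :=
  (hsum 10 (Times (getm 9 iE kE) (getm 8 kE jE)) ;;
   hmap 9 (getm 10 iE jE) ;;
   hmap 11 (Times (getm 11 iE jE) (Times scaledE (monoE shift_m))))%H.

Definition sdE := Times (monoE trace_m) (monoE scale_m).

(** Division needs a true nonnegative numerator, but entries of the power may be negative. Adding
    [sdE] times the divisor makes the numerator nonnegative and raises the floor quotient by exactly
    [sdE], which is then removed modulo the word size as [Minus (var 0) sdE]. *)
Definition round_body : hcmd :=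
  (hmap 8 gradE ;; hmap 9 (eqE iE jE) ;; hmap 11 (Const 1) ;;
   HFor 6 power_m pow_body ;;
   hsum 12 (getm 9 kE kE) ;; hmap 12 (Plus (getm 12 iE jE) (getm 11 iE jE)) ;;
   hmap 10 (Plus (Times sdE (getm 9 iE jE)) (Times sdE (getm 12 iE jE))) ;;
   hmap 7 (Plus (getm 7 iE jE)
             (Plus (Quot (getm 10 iE jE) (getm 12 iE jE)) (Minus (var 0) sdE))))%H.

Definition fw_prog : hcmd :=
  (hmap 7 (Times (eqE iE jE) (monoE scale_m)) ;; HFor 5 rounds_m round_body)%H.

Lemma hrun_seq c1 c2 m : hrun (HSeq c1 c2) m = hrun c2 (hrun c1 m).
Proof. by []. Qed.

Section Correct.

Variables (n w : nat) (E : edge_set n) (u : 'I_n).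

Local Notation W := (2 ^ w)%N.

Hypothesis fit1 : (n <= W)%N.
Hypothesis fit2 : (mono_val n power_m <= W)%N.
Hypothesis fit3 : (mono_val n rounds_m <= W)%N.

Definition env (m : memory) : Prop :=
  [/\ word_inv n w m, m 1%N = u & forall i j : 'I_n, m (2 + i * n + j)%N = is_edge E i j].

Lemma env_word m : env m -> word_inv n w m. Proof. by case. Qed.

Lemma env0 m : env m -> m 0%N = n. Proof. by case=> [[]]. Qed.

Lemma env_same ds m m1 : word_inv n w m1 -> same_but n ds m m1 -> env m -> env m1.
Proof.
move=> I [s _] [_ h1 h2]; split=> // [|i j]; first by rewrite s ?addn2.
by rewrite s ?h2 // -addnA addnC ltn_add2r mem_index_lt.
Qed.

Lemma env_hrun c m : well_formed c -> fits n w c -> env m -> env (hrun c m).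
Proof.
move=> wf f h; have e0 := env0 h; apply: (env_same _ (same_but_hrun e0 wf) h).
exact: hrun_inv wf f (env_word h).
Qed.

Lemma env_adj m e f (i j : 'I_n) : env m -> eval_expr m e = i -> eval_expr m f = j ->
  eval_expr m (adjE e f) = is_edge E i j.
Proof. by move=> h hi hj; rewrite eval_adjE hi hj (env0 h); case: h. Qed.

Definition mres (m : memory) (a : nat) (Z : 'M[int]_n) : Prop :=
  forall i j : 'I_n, res W (mat n m a i j) (Z i j).

Lemma mat_same ds m m1 a i j : same_but n ds m m1 -> (a < narr)%N -> a \notin ds ->
  mat n m1 a i j = mat n m a i j.
Proof. by case=> _ h ha na; rewrite /mat h. Qed.

Lemma mres_same ds m m1 a Z : same_but n ds m m1 -> (a < narr)%N -> a \notin ds ->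
  mres m a Z -> mres m1 a Z.
Proof. by move=> s ha na h i j; rewrite (mat_same _ _ s). Qed.

Lemma mat_lt m a i j : env m -> (mat n m a i j <= W)%N.
Proof. by case=> [[_ h _] _ _]; apply: h. Qed.

Lemma hmap_env d e m : array_id d -> env m -> env (hrun (hmap d e) m).
Proof. by move=> hd; apply: env_hrun; [apply: hmap_wf | apply: hmap_fits]. Qed.

Lemma hsum_env d e m : array_id d -> env m -> env (hrun (hsum d e) m).
Proof. by move=> hd; apply: env_hrun; [apply: hsum_wf | apply: hsum_fits]. Qed.

Lemma hmap_same d e m : array_id d -> env m -> same_but n [:: 2; 3; d]%N m (hrun (hmap d e) m).
Proof. by move=> hd h; rewrite -(hmap_writes d e); apply: same_but_hrun (env0 h) (hmap_wf e hd). Qed.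

Lemma hsum_same d e m : array_id d -> env m -> same_but n [:: 2; 3; 4; d]%N m (hrun (hsum d e) m).
Proof.
move=> hd h; apply: (same_but_trans _ (same_but_refl _ _ _) (same_but_hrun (env0 h) (hsum_wf e hd))).
by move=> x; rewrite hsum_writes !inE; case: (x == 2%N); case: (x == 3%N); case: (x == 4%N); case: (x == d).
Qed.

Lemma hmap_mat d e m (g : 'I_n -> 'I_n -> nat) : array_id d -> env m ->
  (forall m1 (i j : 'I_n), env m1 -> same_but n [:: 2; 3; d]%N m m1 ->
     eval_expr m1 iE = i -> eval_expr m1 jE = j -> mat n m1 d i j = mat n m d i j ->
     eval_expr m1 e = g i j) ->
  forall i j : 'I_n, mat n (hrun (hmap d e) m) d i j = (g i j %% W)%N.
Proof.
move=> hd h hg; apply: hmap_spec (env_word h) hd fit1 _ => m1 i j I s vi vj.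
by apply: hg (env_same I s h) s _ _; rewrite eval_var; case: (I) => -> _ _.
Qed.

Lemma hsum_mat d e m (g : 'I_n -> 'I_n -> 'I_n -> nat) : array_id d -> env m ->
  (forall m1 (i j k : 'I_n), env m1 -> same_but n [:: 2; 3; 4; d]%N m m1 ->
     eval_expr m1 iE = i -> eval_expr m1 jE = j -> eval_expr m1 kE = k ->
     eval_expr m1 e = g i j k) ->
  forall i j : 'I_n, mat n (hrun (hsum d e) m) d i j = ((\sum_k g i j k) %% W)%N.
Proof.
move=> hd h hg; apply: hsum_spec (env_word h) hd fit1 _ => m1 i j k I s vi vj vk.
by apply: hg (env_same I s h) s _ _ _; rewrite eval_var; case: (I) => -> _ _.
Qed.

Lemma same_trans ds ds' m1 m2 m3 : all (mem ds) ds' ->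
  same_but n ds m1 m2 -> same_but n ds' m2 m3 -> same_but n ds m1 m3.
Proof. by move=> /allP; apply: same_but_trans. Qed.

Lemma mmul_mat (A B : 'M[int]_n) (m : memory) a b (i j : 'I_n) :
  mres m a A -> mres m b B ->
  res W (\sum_(k < n) mat n m a i k * mat n m b k j) ((A *m B) i j).
Proof. by move=> ha hb; rewrite mxE; apply: res_sum => k; apply: res_mul. Qed.

Lemma scaled_eval m t : env m -> arr n m 5 0 = t ->
  eval_expr m scaledE = (t.+1 * mono_val n scale_m)%N.
Proof. by move=> h vt; rewrite /scaledE /roundE !evalE (env0 h) vt addn1. Qed.

Local Notation scale := (mono_val n scale_m)%:Z.
Local Notation shift := (mono_val n shift_m)%:Z.

Lemma pow_loop_spec (C : 'M[int]_n) (t : nat) m : env m -> arr n m 5 0 = t -> mres m 8 C ->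
  mres m 9 1%:M -> mres m 11 (const_mx 1) ->
  let m1 := hrun (HFor 6 power_m pow_body) m in
  mres m1 9 (mpow C (mono_val n power_m)) /\
  mres m1 11 (const_mx ((t.+1%:Z * scale * shift) ^+ mono_val n power_m)).
Proof.
move=> h vt hC h9 h11 /=; rewrite -/(hrun (HFor 6 power_m pow_body) m).
have wf : well_formed (HFor 6 power_m pow_body) by [].
have f : fits n w (HFor 6 power_m pow_body).
  by rewrite /= fit2 !mono11 fit1.
have fb : fits n w pow_body by case/andP: f.
pose D := [:: 2; 3; 4; 6; 9; 10; 11]%N.
pose P q m1 := [/\ same_but n D m m1, mres m1 9 (mpow C q) &
   mres m1 11 (const_mx ((t.+1%:Z * scale * shift) ^+ q))].
suff [] : P (mono_val n power_m) (hrun (HFor 6 power_m pow_body) m) by [].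
apply: (HFor_rule wf f (env_word h)).
  split; first exact: same_but_update.
    by move=> i j; rewrite /mat arr_update //; apply: h9.
  by move=> i j; rewrite /mat arr_update //= mxE expr0; have := h11 i j; rewrite mxE.
move=> q m1 hq I1 vq [s1 r9 r11] J1.
have e1 := env_same I1 s1 h.
have vt1 : arr n m1 5 0 = t by case: s1 => _ ->.
have C1 : mres m1 8 C by apply: mres_same s1 _ _ hC.
pose m2 := hrun (hsum 10 (Times (getm 9 iE kE) (getm 8 kE jE))) m1.
pose m3 := hrun (hmap 9 (getm 10 iE jE)) m2.
pose m4 := hrun (hmap 11 (Times (getm 11 iE jE) (Times scaledE (monoE shift_m)))) m3.
rewrite -[hrun pow_body m1]/m4.
have e2 : env m2 by apply: hsum_env.
have e3 : env m3 by apply: hmap_env.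
have s2 : same_but n [:: 2; 3; 4; 10]%N m1 m2 by apply: hsum_same.
have s3 : same_but n [:: 2; 3; 9]%N m2 m3 by apply: hmap_same.
have s4 : same_but n [:: 2; 3; 11]%N m3 m4 by apply: hmap_same.
have r10 : mres m2 10 (mpow C q.+1).
  move=> i j; rewrite (hsum_mat (g := fun i j k => mat n m1 9 i k * mat n m1 8 k j)%N) //.
    by apply: res_mod; apply: mmul_mat.
  move=> m' i' j' k' e' s' vi vj vk; rewrite eval_Times !eval_getm vi vj vk (env0 e').
  by rewrite !(mat_same _ _ s').
have r9' : mres m3 9 (mpow C q.+1).
  move=> i j; rewrite (hmap_mat (g := fun i j => mat n m2 10 i j)%N) //.
    exact: res_mod.
  by move=> m' i' j' e' s' vi vj _; rewrite !eval_getm vi vj (env0 e') (mat_same _ _ s').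
split.
- apply: same_but_update => //; apply: (same_trans _ _ s4) => //.
  by apply: (same_trans _ _ s3) => //; apply: (same_trans _ s1 s2).
- by move=> i j; rewrite /mat arr_update //; apply: mres_same s4 _ _ r9' _ _.
- move=> i j; rewrite /mat arr_update // -/(mat n m4 11 i j).
  have vt3 : arr n m3 5 0 = t by case: s3 => _ ->; first case: s2 => _ ->.
  rewrite (hmap_mat (g := fun i j => mat n m3 11 i j * ((t.+1 * mono_val n scale_m) * mono_val n shift_m))%N) //.
    apply: res_mod; rewrite mxE exprSr; apply: res_mul; last by rewrite -!PoszM; exact: res_nat.
    rewrite (mat_same _ _ s3) // (mat_same _ _ s2) //; have := r11 i j; rewrite mxE; exact.
  move=> m' i' j' e' s' vi vj vd; rewrite eval_Times eval_getm vi vj (env0 e') vd.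
  rewrite eval_Times (scaled_eval e' (t := t)) ?eval_monoE ?(env0 e') //.
  by case: s' => _ ->.
Qed.

Local Notation trb := (mono_val n trace_m)%:Z.

(** Within a round the iterate can cause harm by overflow only at the division, whose divisor and
    shifted numerator must be represented exactly. *)
Definition round_ok (t : nat) (Y : 'M[int]_n) : Prop :=
  let C := grad_mx E t Y in let s := pow_trace t C in
  0 < s < W%:Z /\ forall i j, 0 <= trb * scale * mpow C (mono_val n power_m) i j + trb * scale * s < W%:Z.

Lemma round_spec (Y : 'M[int]_n) (t : nat) m : env m -> arr n m 5 0 = t -> mres m 7 Y ->
  (mono_val n trace_m * mono_val n scale_m <= W)%N ->
  round_ok t.+1 Y ->
  mres (hrun round_body m) 7 (fw_step E t.+1 Y) /\
  same_but n [:: 2; 3; 4; 6; 7; 8; 9; 10; 11; 12]%N m (hrun round_body m).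
Proof.
move=> h vt h7 hsd [hs hP].
set C := grad_mx E t.+1 Y in hs hP; set s := pow_trace _ _ in hs hP.
pose m1 := hrun (hmap 8 gradE) m.
pose m2 := hrun (hmap 9 (eqE iE jE)) m1.
pose m3 := hrun (hmap 11 (Const 1)) m2.
pose m4 := hrun (HFor 6 power_m pow_body) m3.
pose m5 := hrun (hsum 12 (getm 9 kE kE)) m4.
pose m6 := hrun (hmap 12 (Plus (getm 12 iE jE) (getm 11 iE jE))) m5.
pose m7 := hrun (hmap 10 (Plus (Times sdE (getm 9 iE jE)) (Times sdE (getm 12 iE jE)))) m6.
pose m8 := hrun (hmap 7 (Plus (getm 7 iE jE)
             (Plus (Quot (getm 10 iE jE) (getm 12 iE jE)) (Minus (var 0) sdE)))) m7.
have -> : hrun round_body m = m8.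
  by rewrite /round_body hrun_seq -/m1 hrun_seq -/m2 hrun_seq -/m3 hrun_seq -/m4 hrun_seq -/m5
    hrun_seq -/m6 hrun_seq -/m7.
have e1 : env m1 by apply: hmap_env.
have e2 : env m2 by apply: hmap_env.
have e3 : env m3 by apply: hmap_env.
have e4 : env m4 by apply: env_hrun => //; rewrite /= fit2 !mono11 fit1.
have e5 : env m5 by apply: hsum_env.
have e6 : env m6 by apply: hmap_env.
have e7 : env m7 by apply: hmap_env.
have s1 : same_but n [:: 2; 3; 8]%N m m1 by apply: hmap_same.
have s2 : same_but n [:: 2; 3; 9]%N m1 m2 by apply: hmap_same.
have s3 : same_but n [:: 2; 3; 11]%N m2 m3 by apply: hmap_same.
have s4 : same_but n [:: 2; 3; 4; 6; 9; 10; 11]%N m3 m4.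
  apply: (same_but_trans _ (same_but_refl _ _ _) (same_but_hrun (env0 e3) (isT : well_formed (HFor 6 power_m pow_body)))).
  by apply/allP.
have s5 : same_but n [:: 2; 3; 4; 12]%N m4 m5 by apply: hsum_same.
have s6 : same_but n [:: 2; 3; 12]%N m5 m6 by apply: hmap_same.
have s7 : same_but n [:: 2; 3; 10]%N m6 m7 by apply: hmap_same.
have s8 : same_but n [:: 2; 3; 7]%N m7 m8 by apply: hmap_same.
have vt1 : arr n m1 5 0 = t by case: s1 => _ ->.
have vt2 : arr n m2 5 0 = t by case: s2 => _ ->.
have vt3 : arr n m3 5 0 = t by case: s3 => _ ->.
have r8 : mres m1 8 C.
  move=> i j.
  rewrite (hmap_mat (g := fun i j => (t.+1 * mono_val n scale_m +
     (i == j) * (t.+1 * mono_val n scale_m * (mono_val n shift_m + mono_val n lam_m))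
     + (W - mat n m 7 i j) * mono_val n lam_m * mask E i j)%N)) //.
    rewrite mxE; apply: res_mod; apply: res_add.
      by rewrite -!(PoszM, PoszD); exact: res_nat.
    rewrite -!mulNr -mulrA -[X in res _ X]mulrA; apply: res_mul; last first.
      rewrite -!PoszM; exact: res_nat.
    by apply: res_opp; [exact: mat_lt | exact: h7].
  move=> m' i' j' e' s' vi vj _.
  have sc : eval_expr m' scaledE = (t.+1 * mono_val n scale_m)%N.
    by apply: scaled_eval => //; case: s' => _ ->.
  have ma : eval_expr m' maskE = mask E i' j'.
    by rewrite eval_Plus eval_eqE (env_adj e' vi vj) vi vj.
  have lm : eval_expr m' (monoE lam_m) = mono_val n lam_m by rewrite eval_monoE (env0 e').
  have sm : eval_expr m' (monoE shift_m) = mono_val n shift_m by rewrite eval_monoE (env0 e').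
  rewrite /gradE; move: scaledE maskE (monoE lam_m) (monoE shift_m) sc ma lm sm => sE mE lE hE sc ma lm sm.
  rewrite 2!eval_Plus !eval_Times eval_Minus eval_Plus sc ma lm sm.
  rewrite eval_eqE vi vj eval_getm vi vj eval_var (env0 e').
  rewrite (mat_same _ _ s') //.
  by have [[_ _ ->] _ _] := e'.
have r9 : mres m2 9 1%:M.
  move=> i j; rewrite (hmap_mat (g := fun i j => i == j)) //.
    by apply: res_mod; rewrite mxE; case: (i == j); exact: res_nat.
  by move=> m' i' j' e' s' vi vj _; rewrite eval_eqE vi vj.
have r11 : mres m3 11 (const_mx 1).
  move=> i j; rewrite (hmap_mat (g := fun i j => 1%N)) //.
  by apply: res_mod; rewrite mxE; exact: res_nat.
have r8' : mres m3 8 C by apply: mres_same s3 _ _ _ => //; apply: mres_same s2 _ _ _.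
have r9' : mres m3 9 1%:M by apply: mres_same s3 _ _ _.
have [q9 q11] := pow_loop_spec e3 vt3 r8' r9' r11; rewrite -/m4 in q9 q11.
set N := mono_val n power_m in q9 q11 hP.
have q12 : mres m5 12 (const_mx (\sum_(k < n) mpow C N k k)).
  move=> i j; rewrite (hsum_mat (g := fun i j k => mat n m4 9 k k)) //.
    by apply: res_mod; rewrite mxE; apply: res_sum => k.
  by move=> m' i' j' k' e' s' vi vj vk; rewrite eval_getm vk (env0 e') (mat_same _ _ s').
have q12' : mres m6 12 (const_mx s).
  move=> i j; rewrite (hmap_mat (g := fun i j => (mat n m5 12 i j + mat n m5 11 i j)%N)) //.
    apply: res_mod; rewrite mxE; apply: res_add; first by have := q12 i j; rewrite mxE.
    by rewrite (mat_same _ _ s5) //; have := q11 i j; rewrite mxE.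
  move=> m' i' j' e' s' vi vj vd; rewrite eval_Plus !eval_getm vi vj (env0 e') vd.
  by rewrite (mat_same _ _ s').
have sdEe m' : env m' -> eval_expr m' sdE = (mono_val n trace_m * mono_val n scale_m)%N.
  by move=> e'; rewrite eval_Times !eval_monoE (env0 e').
have Wp : (0 < W)%N by rewrite expn_gt0.
have v12 (i j : 'I_n) : (mat n m7 12 i j)%:Z = s.
  rewrite (mat_same _ _ s7) //; apply: (@res_eq W); last by have := q12' i j; rewrite mxE.
    rewrite (hmap_mat (g := fun i j => (mat n m5 12 i j + mat n m5 11 i j)%N)) // ?ltn_pmod //.
    move=> m' i' j' e' s' vi vj vd; rewrite eval_Plus !eval_getm vi vj (env0 e') vd.
    by rewrite (mat_same _ _ s').
  by case/andP: hs => /ltW -> ->.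
have E10 (i j : 'I_n) : mat n m7 10 i j = ((mono_val n trace_m * mono_val n scale_m * mat n m6 9 i j +
    mono_val n trace_m * mono_val n scale_m * mat n m6 12 i j) %% W)%N.
  rewrite (hmap_mat (g := fun i j => (mono_val n trace_m * mono_val n scale_m * mat n m6 9 i j +
    mono_val n trace_m * mono_val n scale_m * mat n m6 12 i j)%N)) //.
  move=> m' i' j' e' s' vi vj vd; have := sdEe m' e'; move: sdE => sE sd.
  by rewrite eval_Plus !eval_Times sd !eval_getm vi vj (env0 e') !(mat_same _ _ s').
have v10 (i j : 'I_n) : (mat n m7 10 i j)%:Z = trb * scale * mpow C N i j + trb * scale * s.
  apply: (@res_eq W); [by rewrite E10 ltn_pmod | exact: hP |].
  rewrite E10; apply: res_mod; apply: res_add; apply: res_mul; rewrite -?PoszM; try exact: res_nat.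
    by rewrite (mat_same _ _ s6) // (mat_same _ _ s5).
  by have := q12' i j; rewrite mxE.
split; last first.
  do 7 (apply: (same_trans _ _ s8) || apply: (same_trans _ _ s7) || apply: (same_trans _ _ s6)
    || apply: (same_trans _ _ s5) || apply: (same_trans _ _ s4) || apply: (same_trans _ _ s3)
    || apply: (same_trans _ _ s2)) => //.
  by apply: (same_trans _ (same_but_refl _ _ _) s1).
move=> i j.
rewrite (hmap_mat (g := fun i j => (mat n m7 7 i j + (mat n m7 10 i j %/ mat n m7 12 i j
   + (W - mono_val n trace_m * mono_val n scale_m)))%N)) //.
  apply: res_mod; rewrite mxE -/C -/s; apply: res_add.
    rewrite (mat_same _ _ s7) // (mat_same _ _ s6) // (mat_same _ _ s5) // (mat_same _ _ s4) //.
    by rewrite (mat_same _ _ s3) // (mat_same _ _ s2) // (mat_same _ _ s1).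
  have -> : ((trb * scale * mpow C (mono_val n power_m) i j) %/ s)%Z =
     (mat n m7 10 i j %/ mat n m7 12 i j)%:Z + (- (trb * scale)).
    rewrite -divz_nat v10 v12 [X in (X %/ _)%Z + _]addrC divzMDl; first by ring.
    by case/andP: hs; lia.
  apply: res_add; first exact: res_nat.
  by apply: res_opp => //; rewrite -PoszM; exact: res_nat.
move=> m' i' j' e' s' vi vj vd.
rewrite !eval_Plus eval_Quot eval_Minus sdEe // !eval_getm vi vj (env0 e') vd eval_var (env0 e').
rewrite !(mat_same _ _ s') //; by have [[_ _ ->] _ _] := e'.
Qed.

Lemma fw_spec m : env m -> (mono_val n trace_m * mono_val n scale_m <= W)%N ->
  (forall q, (q < mono_val n rounds_m)%N -> round_ok q.+1 (fw_iter E q)) ->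
  mres (hrun fw_prog m) 7 (fw_iter E (mono_val n rounds_m)) /\ env (hrun fw_prog m).
Proof.
move=> h hsd hok.
pose c1 := hmap 7 (Times (eqE iE jE) (monoE scale_m)).
have e1 : env (hrun c1 m) by apply: hmap_env.
rewrite -[hrun fw_prog m]/(hrun (HFor 5 rounds_m round_body) (hrun c1 m)).
set m1 := hrun c1 m in e1 *.
have f : fits n w (HFor 5 rounds_m round_body) by rewrite /= fit2 fit3 !mono11 fit1.
split; last by apply: env_hrun.
have r1 : mres m1 7 (fw_iter E 0).
  move=> i j; rewrite (hmap_mat (g := fun i j => ((i == j) * mono_val n scale_m)%N)) //.
    by apply: res_mod; rewrite mxE -PoszM; exact: res_nat.
  by move=> m' i' j' e' s' vi vj _; rewrite eval_Times eval_eqE vi vj eval_monoE (env0 e').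
pose P q m2 := env m2 /\ mres m2 7 (fw_iter E q).
suff [] : P (mono_val n rounds_m) (hrun (HFor 5 rounds_m round_body) m1) by [].
apply: (HFor_rule (P := P) _ f (env_word e1)) => //.
  have e2 : word_inv n w (update m1 (cell n 5 0) 0%N).
    have [[z0 zm zW] _ _] := e1; split; first by rewrite update_low ?addn2.
      by move=> y; rewrite /update; case: ifP.
    by rewrite arr_update.
  split; last by move=> i j; rewrite /mat arr_update //; apply: r1.
  by apply: (env_same e2 (ds := [:: 5]%N) (m := m1)) => //; apply: same_but_update.
move=> q m2 hq I2 vq [e2 r2] J2.
have [] := round_spec e2 vq r2 hsd (hok q hq).
move: (hrun round_body m2) J2 => m3 J2 r3 s3.
split; last by move=> i j; rewrite /mat arr_update //; apply: r3.
have e3 := env_same J2 s3 e2.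
have J3 : word_inv n w (update m3 (cell n 5 0) q.+1).
  have [[z0 zm zW] _ _] := e3; split; first by rewrite update_low ?addn2.
    by move=> y; rewrite /update; case: ifP => // _; apply: leq_trans hq fit3.
  by rewrite arr_update.
by apply: (env_same J3 (ds := [:: 5]%N) (m := m3)) => //; apply: same_but_update.
Qed.

End Correct.

(** * Selecting the output from the approximate solution *)

Section Selection.

Variables (n : nat) (E : edge_set n) (Y : 'M[int]_n).

(** The integer that represents the value 1 after all rounds, so [ball] cuts at one half. *)
Definition threshold : int := (mono_val n rounds_m).+1%:Z * (mono_val n scale_m)%:Z.

Definition ball (i : 'I_n) : {set 'I_n} := [set j | threshold <= 2 * Y i j].

Definition coneighbors (A : {set 'I_n}) (v : 'I_n) : {set 'I_n} :=
  [set w in A | ~~ is_edge E v w].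

(** When the ball is close to [S], a vertex of [S] is non-adjacent to nearly all of it, and an
    outside vertex to at most about three fifths of it; three quarters separates the two. *)
Definition candidate (i : 'I_n) : {set 'I_n} :=
  [set v | (3 * #|ball i| <= 4 * #|coneighbors (ball i) v|)%N].

Definition independent (A : {set 'I_n}) : bool :=
  [forall v in A, forall w in A, ~~ is_edge E v w].

Definition isolated (A : {set 'I_n}) : bool :=
  [forall v in ~: A, (4 * #|coneighbors A v| <= 3 * #|A|)%N].

Definition popularity (i : 'I_n) : nat := #|[set i' | candidate i' == candidate i]|.

(** The last two tests are the bounds [n ^ (2/3)] on the size and [n ^ (2/3) / 2] on the popularity,
    without roots. The popularity test caps the number of distinct accepted candidates. *)
Definition accepted (i : 'I_n) : bool :=
  [&& independent (candidate i), isolated (candidate i),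
      (n ^ 2 <= #|candidate i| ^ 3)%N & (n ^ 2 <= 8 * popularity i ^ 3)%N].

Definition selection (u : 'I_n) : {set 'I_n} :=
  \bigcup_(i | accepted i && (u \in candidate i)) candidate i.

End Selection.

(** A bound on all the entries in absolute value: adding it turns residues of signed entries into
    naturals that can be compared. *)
Definition offsetE : expr :=
  Times (Plus (monoE rounds_m) (Const 1)) sdE.

Definition thresholdE : expr := Times (Plus (monoE rounds_m) (Const 1)) (monoE scale_m).

(* By truncation of [Minus], the truth value of [e <= f]. *)
Definition leE (e f : expr) : expr := Minus (Const 1) (Minus e f).

Definition notE (e : expr) : expr := Minus (Const 1) e.

(** Array 13 holds the balls, 14 their sizes, 15 the votes, 16 the candidates, 17 their sizes; 18
    the degrees inside a candidate, 19 the co-neighbours in it, 20 the distances between candidates,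
    21 the violations of independence and isolation, 22 the popularity, 23 acceptance, 24 the
    output, repeated in every row. *)
Definition select_prog : hcmd :=
  (hmap 10 (Plus (getm 7 iE jE) offsetE) ;;
   hmap 13 (leE (Plus thresholdE (Times (Const 2) offsetE)) (Times (Const 2) (getm 10 iE jE))) ;;
   hsum 14 (getm 13 iE kE) ;;
   hsum 15 (Times (getm 13 iE kE) (notE (adjE jE kE))) ;;
   hmap 16 (leE (Times (Const 3) (getm 14 iE jE)) (Times (Const 4) (getm 15 iE jE))) ;;
   hsum 17 (getm 16 iE kE) ;;
   hsum 18 (Times (Times (getm 16 iE jE) (getm 16 iE kE)) (adjE jE kE)) ;;
   hsum 19 (Times (getm 16 iE kE) (notE (adjE jE kE))) ;;
   hsum 20 (Plus (Minus (getm 16 iE kE) (getm 16 jE kE)) (Minus (getm 16 jE kE) (getm 16 iE kE))) ;;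
   hsum 21 (Plus (getm 18 iE kE) (Times (notE (getm 16 iE kE))
       (notE (leE (Times (Const 4) (getm 19 iE kE)) (Times (Const 3) (getm 17 iE kE)))))) ;;
   hsum 22 (notE (getm 20 iE kE)) ;;
   hmap 23 (Times (notE (getm 21 iE jE)) (Times
       (leE (Times nE nE) (Times (getm 17 iE jE) (Times (getm 17 iE jE) (getm 17 iE jE))))
       (leE (Times nE nE) (Times (Const 8)
           (Times (getm 22 iE jE) (Times (getm 22 iE jE) (getm 22 iE jE))))))) ;;
   hsum 24 (Times (getm 23 kE jE) (Times (getm 16 kE (Read (Const 1))) (getm 16 kE jE))))%H.

Section SelectCorrect.

Variables (n w : nat) (E : edge_set n) (u : 'I_n).

Local Notation W := (2 ^ w)%N.

Hypothesis fit1 : (n <= W)%N.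

Fixpoint knows (m : memory) (l : seq (nat * ('I_n -> 'I_n -> nat))) : Prop :=
  if l is (a, f) :: l' then
    (forall i j : 'I_n, mat n m a i j = f i j) /\ knows m l'
  else True.

Lemma knows_same ds m m1 l : same_but n ds m m1 ->
  all (fun p => (p.1 < narr)%N && (p.1 \notin ds)) l -> knows m l -> knows m1 l.
Proof.
move=> s; elim: l => //= -[a f] l IH /andP[/andP[ha na] hl] [h1 h2]; split; last exact: IH.
by move=> i j; rewrite (mat_same _ _ s).
Qed.

Definition fresh d l :=
  all (fun p : nat * ('I_n -> 'I_n -> nat) => (p.1 < narr)%N && (p.1 \notin [:: 2; 3; 4; d]%N)) l.

Lemma hmap_knows d e m l f : array_id d -> env w E u m -> fresh d l -> knows m l ->
  (forall m1 (i j : 'I_n), env w E u m1 -> knows m1 l ->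
     eval_expr m1 iE = i -> eval_expr m1 jE = j -> eval_expr m1 e = f i j /\ (f i j < W)%N) ->
  env w E u (hrun (hmap d e) m) /\ knows (hrun (hmap d e) m) ((d, f) :: l).
Proof.
move=> hd h fr k hf; split; first exact: hmap_env.
have fr' : all (fun p : nat * ('I_n -> 'I_n -> nat) => (p.1 < narr)%N && (p.1 \notin [:: 2; 3; d]%N)) l.
  apply: sub_all fr => -[a g] /= /andP[-> /=]; rewrite !inE !negb_or.
  by case/and4P=> -> -> _ ->.
split; last by apply: knows_same (hmap_same e hd h) fr' k.
move=> i j.
(* The bound on [f i j] is available only under a memory whose indices are [i] and [j]; one is built
   here to extract it. *)
have [q hq] : exists m1, env w E u m1 /\ knows m1 l /\ eval_expr m1 iE = i /\ eval_expr m1 jE = j.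
  pose m1 := update (update m (cell n 2 0) i) (cell n 3 0) j.
  have s : same_but n [:: 2; 3; d]%N m m1.
    by do 2 (apply: same_but_update; rewrite ?inE //).
  have I1 : word_inv n w m1.
    have [[z0 zm zW] _ _] := h; split; first by rewrite /m1 !update_low ?addn2.
      move=> y; rewrite /m1 /update; case: ifP => _; first by apply: leq_trans (ltnW (ltn_ord _)) fit1.
      by case: ifP => // _; apply: leq_trans (ltnW (ltn_ord _)) fit1.
    by rewrite /m1 !arr_update.
  exists m1; split; first exact: env_same I1 s h.
  split; first exact: knows_same s fr' k.
  have e0 : m1 0%N = n by case: I1.
  by rewrite !eval_var e0 /m1 !arr_update.
have lt : (f i j < W)%N by case: hq => a [b [c d']]; case: (hf q i j a b c d').
rewrite (hmap_mat (g := f) fit1 hd h) ?modn_small //.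
move=> m1 i1 j1 e1 s vi vj _; case: (hf m1 i1 j1 e1 _ vi vj) => //.
exact: knows_same s fr' k.
Qed.

Lemma hsum_knows d e m l (g : 'I_n -> 'I_n -> 'I_n -> nat) f :
  array_id d -> env w E u m -> fresh d l -> knows m l ->
  (forall m1 (i j k : 'I_n), env w E u m1 -> knows m1 l ->
     eval_expr m1 iE = i -> eval_expr m1 jE = j -> eval_expr m1 kE = k ->
     eval_expr m1 e = g i j k) ->
  (forall i j, (\sum_k g i j k)%N = f i j /\ (f i j < W)%N) ->
  env w E u (hrun (hsum d e) m) /\ knows (hrun (hsum d e) m) ((d, f) :: l).
Proof.
move=> hd h fr k hg hf; split; first exact: hsum_env.
split; last by apply: knows_same (hsum_same e hd h) fr k.
move=> i j; have [hs lt] := hf i j.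
rewrite (hsum_mat (g := g) fit1 hd h) ?hs ?modn_small //.
move=> m1 i1 j1 k1 e1 s vi vj vk; apply: (hg m1) => //.
exact: knows_same s fr k.
Qed.

Variable Y : 'M[int]_n.

Let T := ball Y.
Let Q := candidate E Y.
Local Notation offset := ((mono_val n rounds_m + 1) * (mono_val n trace_m * mono_val n scale_m))%N.

Hypothesis Ybound : forall i j, `|Y i j| <= offset%:Z.
Hypothesis fit_offset : (2 * offset < W)%N.
Hypothesis fit_small : (2 * n * n + 1 < W)%N.

Lemma sum_bool (P : pred 'I_n) : (\sum_k (P k : nat))%N = #|[set k | P k]|.
Proof.
rewrite -sum1_card big_mkcond /= [RHS]big_mkcond; apply: eq_bigr => k _.
by rewrite inE; case: (P k).
Qed.

Lemma card_le_n (A : {set 'I_n}) : (#|A| <= n)%N.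
Proof. by rewrite -[X in (_ <= X)%N](card_ord n) max_card. Qed.

Lemma eval_leE m e f : eval_expr m (leE e f) = (eval_expr m e <= eval_expr m f)%N :> nat.
Proof.
rewrite -[LHS]/(1 - (eval_expr m e - eval_expr m f))%N; move: (eval_expr m e) (eval_expr m f) => x y.
by case: leqP => h; lia.
Qed.

Lemma eval_notE m e (b : bool) : eval_expr m e = b -> eval_expr m (notE e) = ~~ b.
Proof. by move=> h; rewrite -[LHS]/(1 - eval_expr m e)%N h; case: b {h}. Qed.

Lemma eval_not0E m e : eval_expr m (notE e) = (eval_expr m e == 0%N).
Proof. by rewrite -[LHS]/(1 - eval_expr m e)%N; case: (eval_expr m e) => [|[]]. Qed.

Lemma small_lt x : (x <= 2 * n * n + 1)%N -> (x < W)%N.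
Proof. by move=> h; apply: leq_ltn_trans h fit_small. Qed.

Let bad i v := #|[set w | [&& v \in Q i, w \in Q i & is_edge E v w]]|.
Let faults i := (\sum_v (bad i v + ((v \notin Q i) && ~~ (4 * #|coneighbors E (Q i) v| <= 3 * #|Q i|)%N)))%N.

Lemma faultsE i : (faults i == 0)%N = independent E (Q i) && isolated E (Q i).
Proof.
rewrite /faults sum_nat_eq0; apply/forallP/andP => [h|[/forallP h1 /forallP h2] v].
  split; apply/forallP => v; have := h v; rewrite /= addn_eq0 => /andP[h1 h2].
    apply/implyP => hv; apply/forallP => w'; apply/implyP => hw.
    move: h1; rewrite cards_eq0 => /eqP/setP/(_ w'); rewrite finset.in_set0 inE hv hw /= => ->.
    by [].
  apply/implyP; rewrite finset.in_setC => hv; move: h2; rewrite hv /= eqb0 negbK; exact.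
rewrite /= addn_eq0; apply/andP; split.
  rewrite cards_eq0; apply/eqP/setP => w'; rewrite finset.in_set0 inE; apply/negbTE.
  apply/and3P => -[hv hw e]; have := h1 v; rewrite hv => /forallP/(_ w').
  by rewrite hw e.
rewrite eqb0 negb_and negbK; have := h2 v; rewrite finset.in_setC; case: (v \in Q i) => //=.
by move=> ->.
Qed.

Lemma diffE (i j : 'I_n) :
  (\sum_k (((k \in Q i) - (k \in Q j)) + ((k \in Q j) - (k \in Q i))) == 0)%N = (Q j == Q i).
Proof.
rewrite sum_nat_eq0; apply/forallP/eqP => [h|-> k]; last by rewrite /= subnn.
by apply/setP => k; have := h k; case: (k \in Q i); case: (k \in Q j).
Qed.

Lemma select_spec m : env w E u m -> mres w m 7 Y ->
  env w E u (hrun select_prog m) /\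
  forall i j : 'I_n, (mat n (hrun select_prog m) 24 i j != 0)%N = (j \in selection E Y u).
Proof.
move=> h h7.
have TE i j : (j \in T i) = (threshold n <= 2 * Y i j) by rewrite inE.
pose f10 i j : nat := absz (Y i j + offset%:Z).
have f10E i j : (f10 i j)%:Z = Y i j + offset%:Z.
  by rewrite /f10 gez0_abs //; have := Ybound i j; rewrite ler_norml; lia.
pose f13 i j : nat := j \in T i.
pose f14 (i j : 'I_n) : nat := #|T i|.
pose f15 i j : nat := #|coneighbors E (T i) j|.
pose f16 i j : nat := j \in Q i.
pose f17 (i j : 'I_n) : nat := #|Q i|.
pose f18 i j : nat := bad i j.
pose f19 i j : nat := #|coneighbors E (Q i) j|.
pose f20 i j : nat := (\sum_k (((k \in Q i) - (k \in Q j)) + ((k \in Q j) - (k \in Q i))))%N.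
pose f21 (i j : 'I_n) : nat := faults i.
pose f22 (i j : 'I_n) : nat := popularity E Y i.
pose f23 (i j : 'I_n) : nat := accepted E Y i.
have sm1 (A : {set 'I_n}) : (#|A| < W)%N.
  by apply: small_lt; have := card_le_n A; nia.
have sdEe m' : env w E u m' -> eval_expr m' offsetE = offset.
  by move=> e'; rewrite -[LHS]/(((eval_expr m' (monoE rounds_m) + 1) * (eval_expr m' (monoE trace_m) * eval_expr m' (monoE scale_m)))%N) !eval_monoE (env0 e').
have thEe m' : env w E u m' -> eval_expr m' thresholdE = ((mono_val n rounds_m + 1) * mono_val n scale_m)%N.
  by move=> e'; rewrite -[LHS]/(((eval_expr m' (monoE rounds_m) + 1) * eval_expr m' (monoE scale_m))%N) !eval_monoE (env0 e').
rewrite /select_prog.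
rewrite hrun_seq; set m1 := hrun (hmap 10 _) m.
have [e1 k1] : env w E u m1 /\ knows m1 [:: (10%N, f10)].
  split; first exact: hmap_env.
  split=> // i j.
  have g10 (i' j' : 'I_n) : mat n m1 10 i' j' = ((mat n m 7 i' j' + offset) %% W)%N.
    apply: (hmap_mat (g := fun i j => (mat n m 7 i j + offset)%N) fit1 _ h) => // m' i1 j1 e' s' vi vj _.
    by rewrite eval_Plus eval_getm vi vj (env0 e') (mat_same _ _ s') // sdEe.
  apply/eqP; rewrite -eqz_nat; apply/eqP; rewrite f10E; apply: (@res_eq W).
  - by rewrite g10 ltn_pmod // expn_gt0.
  - by have := Ybound i j; have := fit_offset; rewrite ler_norml; lia.
  - by rewrite g10; apply: res_mod; apply: res_add; [exact: h7 | exact: res_nat].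
rewrite hrun_seq; set m2 := hrun (hmap 13 _) m1.
have [e2 k2] : env w E u m2 /\ knows m2 [:: (13%N, f13); (10%N, f10)].
  apply: hmap_knows => // m' i j e' [k10 _] vi vj; split; last by apply: small_lt; rewrite /f13; case: (_ \in _); lia.
  have := thEe m' e'; have := sdEe m' e'; move: thresholdE offsetE => tE oE so st.
  rewrite eval_leE eval_Plus st !eval_Times so eval_Const eval_getm vi vj (env0 e') k10.
  rewrite /f13 TE -(lez_nat (_ + _)%N) PoszD ![Posz (2 * _)]PoszM f10E /threshold PoszM addn1 mulrDr lerD2r.
  by [].
rewrite hrun_seq; set m3 := hrun (hsum 14 _) m2.
have [e3 k3] : env w E u m3 /\ knows m3 [:: (14%N, f14); (13%N, f13)].
  apply: (hsum_knows (g := fun i j k => f13 i k)) => //.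
  - by case: k2.
  - by move=> m' i j k e' [k13 _] vi vj vk; rewrite eval_getm vi vk (env0 e').
  - move=> i j; split; last exact: sm1.
    apply: etrans (sum_bool (fun k => k \in T i)) _; congr #|pred_of_set _|.
    by apply/setP => k; rewrite inE.
rewrite hrun_seq; set m4 := hrun (hsum 15 _) m3.
have [e4 k4] : env w E u m4 /\ knows m4 [:: (15%N, f15); (14%N, f14); (13%N, f13)].
  apply: (hsum_knows (g := fun i j k => ((k \in T i) && ~~ is_edge E j k) : nat)) => //.
  - move=> m' i j k e' [_ [k13 _]] vi vj vk.
    by rewrite eval_Times (eval_notE (env_adj e' vj vk)) eval_getm vi vk (env0 e') k13 mulnb.
  - move=> i j; split; last exact: sm1.
    by rewrite sum_bool.
rewrite hrun_seq; set m5 := hrun (hmap 16 _) m4.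
have [e5 k5] : env w E u m5 /\ knows m5 [:: (16%N, f16)].
  suff [] : env w E u m5 /\ knows m5 [:: (16%N, f16); (15%N, f15); (14%N, f14); (13%N, f13)].
    by move=> ? [? _].
  apply: hmap_knows => // m' i j e' [k15 [k14 _]] vi vj; split; last by apply: small_lt; rewrite /f16; case: (_ \in _); lia.
  by rewrite eval_leE !eval_Times !eval_Const !eval_getm vi vj (env0 e') k15 k14 /f16 inE.
rewrite hrun_seq; set m6 := hrun (hsum 17 _) m5.
have [e6 k6] : env w E u m6 /\ knows m6 [:: (17%N, f17); (16%N, f16)].
  apply: (hsum_knows (g := fun i j k => f16 i k)) => //.
  - by move=> m' i j k e' [k16 _] vi vj vk; rewrite eval_getm vi vk (env0 e').
  - move=> i j; split; last exact: sm1.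
    apply: etrans (sum_bool (fun k => k \in Q i)) _; congr #|pred_of_set _|.
    by apply/setP => k; rewrite inE.
rewrite hrun_seq; set m7 := hrun (hsum 18 _) m6.
have [e7 k7] : env w E u m7 /\ knows m7 [:: (18%N, f18); (17%N, f17); (16%N, f16)].
  apply: (hsum_knows (g := fun i j k => [&& j \in Q i, k \in Q i & is_edge E j k] : nat)) => //.
  - move=> m' i j k e' [_ [k16 _]] vi vj vk.
    by rewrite !eval_Times (env_adj e' vj vk) !eval_getm vi vj vk (env0 e') !k16 !mulnb andbA.
  - by move=> i j; split; [exact: sum_bool | exact: sm1].
rewrite hrun_seq; set m8 := hrun (hsum 19 _) m7.
have [e8 k8] : env w E u m8 /\ knows m8 [:: (19%N, f19); (18%N, f18); (17%N, f17); (16%N, f16)].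
  apply: (hsum_knows (g := fun i j k => ((k \in Q i) && ~~ is_edge E j k) : nat)) => //.
  - move=> m' i j k e' [_ [_ [k16 _]]] vi vj vk.
    by rewrite eval_Times (eval_notE (env_adj e' vj vk)) eval_getm vi vk (env0 e') k16 mulnb.
  - move=> i j; split; last exact: sm1.
    by rewrite sum_bool.
rewrite hrun_seq; set m9 := hrun (hsum 20 _) m8.
have [e9 k9] : env w E u m9 /\ knows m9 [:: (20%N, f20); (19%N, f19); (18%N, f18); (17%N, f17); (16%N, f16)].
  apply: (hsum_knows (g := fun i j k => (((k \in Q i) - (k \in Q j)) + ((k \in Q j) - (k \in Q i)))%N)) => //.
  - move=> m' i j k e' [_ [_ [_ [k16 _]]]] vi vj vk.
    by rewrite eval_Plus !eval_Minus !eval_getm vi vj vk (env0 e') !k16.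
  - move=> i j; split=> //; apply: small_lt; rewrite /f20.
    apply: (@leq_trans (\sum_(k < n) 2)%N); last by rewrite sum_nat_const card_ord; nia.
    by apply: leq_sum => k _; case: (k \in Q i); case: (k \in Q j).
rewrite hrun_seq; set m10 := hrun (hsum 21 _) m9.
have [e10' k10] : env w E u m10 /\ knows m10 [:: (21%N, f21); (20%N, f20); (19%N, f19); (18%N, f18); (17%N, f17); (16%N, f16)].
  apply: (hsum_knows (g := fun i j k => (bad i k + ((k \notin Q i) && ~~ (4 * #|coneighbors E (Q i) k| <= 3 * #|Q i|)%N))%N)) => //.
  - move=> m' i j k e' [_ [k19 [k18 [k17 [k16 _]]]]] vi vj vk.
    rewrite eval_Plus eval_Times (@eval_notE _ (getm 16 iE kE) (k \in Q i)); last first.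
      by rewrite eval_getm vi vk (env0 e') k16.
    rewrite (@eval_notE _ (leE _ _) (4 * #|coneighbors E (Q i) k| <= 3 * #|Q i|)%N); last first.
      by rewrite eval_leE !eval_Times !eval_Const !eval_getm vi vk (env0 e') k19 k17.
    by rewrite eval_getm vi vk (env0 e') k18 mulnb.
  - move=> i j; split=> //; apply: small_lt; rewrite /f21 /faults.
    apply: (@leq_trans (\sum_(k < n) (n + 1))%N).
      by apply: leq_sum => k _; rewrite leq_add ?card_le_n ?leq_b1.
    by rewrite sum_nat_const card_ord; nia.
rewrite hrun_seq; set m11 := hrun (hsum 22 _) m10.
have [e11 k11] : env w E u m11 /\ knows m11 [:: (22%N, f22); (21%N, f21); (20%N, f20); (19%N, f19); (18%N, f18); (17%N, f17); (16%N, f16)].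
  apply: (hsum_knows (g := fun i j k => (Q k == Q i : nat))) => //.
  - move=> m' i j k e' [_ [k20 _]] vi vj vk.
    by rewrite eval_not0E eval_getm vi vk (env0 e') k20 /f20 diffE.
  - by move=> i j; split; [exact: sum_bool | exact: sm1].
rewrite hrun_seq; set m12 := hrun (hmap 23 _) m11.
have [e12 k12] : env w E u m12 /\ knows m12 [:: (23%N, f23); (22%N, f22); (21%N, f21); (20%N, f20); (19%N, f19); (18%N, f18); (17%N, f17); (16%N, f16)].
  apply: hmap_knows => // m' i j e' [k22 [k21 [_ [_ [_ [k17 _]]]]]] vi vj; split; last by apply: small_lt; rewrite /f23; case: (accepted _ _ _); lia.
  rewrite eval_Times eval_not0E eval_Times !eval_leE !eval_Times !eval_getm vi vj (env0 e') eval_Const eval_nE (env0 e').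
  rewrite k22 k21 k17 /f21 faultsE /f23 /accepted /f17 /f22 !mulnb -andbA.
  by rewrite -[X in (_ <= X * (X * X))%N]expn1 -!expnS -[X in (_ <= 8 * (X * (X * X)))%N]expn1 -!expnS mulnn.
have [e13' [k13 _]] : env w E u (hrun (hsum 24 (Times (getm 23 kE jE) (Times (getm 16 kE (Read (Const 1))) (getm 16 kE jE)))) m12) /\
   knows (hrun (hsum 24 (Times (getm 23 kE jE) (Times (getm 16 kE (Read (Const 1))) (getm 16 kE jE)))) m12)
   [:: (24%N, fun i j => #|[set k | [&& accepted E Y k, u \in Q k & j \in Q k]]|); (23%N, f23); (22%N, f22); (21%N, f21); (20%N, f20); (19%N, f19); (18%N, f18); (17%N, f17); (16%N, f16)].
  apply: (hsum_knows (g := fun i j k => [&& accepted E Y k, u \in Q k & j \in Q k] : nat)) => //.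
  - move=> m' i j k e' [k23 [_ [_ [_ [_ [_ [_ [k16 _]]]]]]]] vi vj vk.
    have vu : eval_expr m' (Read (Const 1)) = u by case: (e').
    by rewrite !eval_Times !eval_getm vj vk vu (env0 e') k23 !k16 !mulnb.
  - by move=> i j; split; [exact: sum_bool | exact: sm1].
split=> // i j; rewrite k13 -lt0n card_gt0; apply/set0Pn/bigcupP => [[k]|[k /andP[h1 h2] h3]].
  by rewrite inE => /and3P[h1 h2 h3]; exists k; rewrite ?h1.
by exists k; rewrite inE h1 h2.
Qed.

End SelectCorrect.

(** * Symmetry and size bounds for the integer iteration *)

Lemma is_edge_sym n (E : edge_set n) i j : is_edge E i j = is_edge E j i.
Proof. by rewrite /is_edge finset.setUC. Qed.

Lemma mpowD (R : nzRingType) n (C : 'M[R]_n) q r : mpow C (q + r) = mpow C q *m mpow C r.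
Proof.
elim: r => [|r IH]; first by rewrite addn0 mulmx1.
by rewrite addnS /mpow !iterS -/(mpow C _) -/(mpow C r) IH mulmxA.
Qed.

Lemma mpowSl (R : nzRingType) n (C : 'M[R]_n) q : mpow C q.+1 = C *m mpow C q.
Proof. by rewrite -add1n mpowD /mpow /= mul1mx. Qed.

Lemma mpow_sym (R : comNzRingType) n (C : 'M[R]_n) q : C^T = C -> (mpow C q)^T = mpow C q.
Proof.
move=> h; elim: q => [|q IH]; first exact: trmx1.
by rewrite {1}mpowSl trmx_mul IH h.
Qed.

Lemma grad_mx_sym n (E : edge_set n) t Y : Y^T = Y -> (grad_mx E t Y)^T = grad_mx E t Y.
Proof.
move=> h; apply/matrixP => i j; rewrite !mxE /mask is_edge_sym [j == i]eq_sym.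
by rewrite -{1}h mxE.
Qed.

Lemma fw_iter_sym n (E : edge_set n) q : (fw_iter E q)^T = fw_iter E q.
Proof.
elim: q => [|q IH]; apply/matrixP => i j; rewrite !mxE; first by rewrite eq_sym.
set C := grad_mx _ _ _; have hC : C^T = C by exact: grad_mx_sym.
have -> : fw_iter E q j i = fw_iter E q i j by rewrite -{1}IH mxE.
by have -> : mpow C (mono_val n power_m) j i = mpow C (mono_val n power_m) i j
  by rewrite -{1}(mpow_sym _ hC) mxE.
Qed.

(** Termwise, a product is at most the larger of the two squares, and both squares occur in the
    trace. *)
Lemma gram_le_trace (R : realDomainType) (I J : finType) (f : I -> J -> R) i j :
  `|\sum_l f i l * f j l| <= \sum_k \sum_l f k l * f k l.
Proof.
rewrite exchange_big /=; apply: le_trans (ler_norm_sum _ _ _) _; apply: ler_sum => l _.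
have sq k : f k l * f k l <= \sum_k f k l * f k l.
  by rewrite (bigD1 k) //= lerDl sumr_ge0 // => k' _; rewrite -expr2 sqr_ge0.
have nsq k : `|f k l| * `|f k l| = f k l * f k l by rewrite -normrM ger0_norm // -expr2 sqr_ge0.
rewrite normrM; case: (lerP `|f i l| `|f j l|) => h.
  by apply: le_trans (sq j); rewrite -nsq ler_wpM2r.
by apply: le_trans (sq i); rewrite -nsq ler_wpM2l // ltW.
Qed.

Lemma mono_val_gt0 n (b : mono) : (0 < n)%N -> (0 < b.1)%N -> (0 < mono_val n b)%N.
Proof. by move=> n0 b0; rewrite muln_gt0 b0 expn_gt0 n0. Qed.

Lemma power_halves n : mono_val n power_m = (mono_val n rounds_m + mono_val n rounds_m)%N.
Proof. by rewrite /mono_val /= mul1n mulSn mul1n. Qed.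

Section Bounds.

Variables (n : nat) (E : edge_set n).
Hypothesis n_ge : (10 <= n)%N.

Local Notation scale := (mono_val n scale_m)%:Z.
Local Notation shift := (mono_val n shift_m)%:Z.
Local Notation trb := (mono_val n trace_m)%:Z.

Let n_gt0 : (0 < n)%N. Proof. exact: leq_trans n_ge. Qed.

(** The exponent is chosen even so that the power is a Gram matrix: its trace is then nonnegative
    and dominates every entry. *)
Lemma mpow_power_gram (C : 'M[int]_n) i j : C^T = C ->
  mpow C (mono_val n power_m) i j =
  \sum_l mpow C (mono_val n rounds_m) i l * mpow C (mono_val n rounds_m) j l.
Proof.
move=> h; rewrite power_halves mpowD mxE; apply: eq_bigr => l _.
by rewrite -{2}(mpow_sym _ h) mxE.
Qed.

Lemma trace_power_ge0 (C : 'M[int]_n) : C^T = C -> 0 <= \sum_k mpow C (mono_val n power_m) k k.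
Proof.
move=> h; apply: sumr_ge0 => k _; rewrite mpow_power_gram //.
by apply: sumr_ge0 => l _; rewrite -expr2 sqr_ge0.
Qed.

Lemma pow_trace_gt0 (C : 'M[int]_n) t : C^T = C -> (0 < t)%N -> 0 < pow_trace t C.
Proof.
move=> h t0; apply: ltr_wpDl; first exact: trace_power_ge0.
by apply: exprn_gt0; rewrite -!PoszM ltz_nat !muln_gt0 t0 n_gt0.
Qed.

Lemma mpow_le_trace (C : 'M[int]_n) t i j : C^T = C -> (0 < t)%N ->
  `|mpow C (mono_val n power_m) i j| <= pow_trace t C.
Proof.
move=> h t0; rewrite mpow_power_gram //; apply: le_trans (gram_le_trace _ i j) _.
rewrite /pow_trace -[X in X <= _]addr0; apply: lerD; last first.
  by apply: exprn_ge0; rewrite -!PoszM.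
by apply: ler_sum => k _; rewrite mpow_power_gram.
Qed.

Lemma divz_le (a b s : int) : 0 < s -> 0 <= b -> `|a| <= s -> `|((b * a) %/ s)%Z| <= b.
Proof.
move=> s0 b0; rewrite !ler_norml => /andP[h1 h2]; apply/andP; split.
  by rewrite lez_divRL // mulNr -mulrN ler_wpM2l.
have : (b * a %/ s)%Z * s <= b * s.
  apply: le_trans (_ : b * a <= _); last by rewrite ler_wpM2l.
  by have := divz_eq (b * a) s; have := modz_ge0 (b * a) (lt0r_neq0 s0); lia.
by rewrite ler_pM2r.
Qed.

Lemma fw_iter_bound q i j : `|fw_iter E q i j| <= q.+1%:Z * (trb * scale).
Proof.
have tb0 : 0 <= trb * scale by rewrite -PoszM.
elim: q i j => [|q IH] i j; rewrite /= mxE.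
  rewrite mul1r normrM ger0_norm //; apply: le_trans (_ : 1 * scale <= _).
    by rewrite ler_wpM2r //; case: (i == j).
  by rewrite ler_wpM2r // lez_nat mono_val_gt0.
set C := grad_mx _ _ _; have hC : C^T = C by apply/grad_mx_sym/fw_iter_sym.
apply: le_trans (ler_normD _ _) _.
rewrite -[q.+2]addn1 PoszD mulrDl mul1r lerD //.
apply: divz_le => //; [exact: pow_trace_gt0 | exact: mpow_le_trace].
Qed.

Lemma mpow_bound (C : 'M[int]_n) (V : nat) q i j : (0 < V)%N -> (forall i j, `|C i j| <= V%:Z) ->
  `|mpow C q i j| <= ((n * V) ^ q)%:Z.
Proof.
move=> V0 hC; elim: q i j => [|q IH] i j; first by rewrite mxE; case: (i == j).
rewrite /mpow iterS -/(mpow C q) mxE; apply: le_trans (ler_norm_sum _ _ _) _.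
apply: le_trans (_ : \sum_(k < n) ((n * V) ^ q * V)%:Z <= _).
  by apply: ler_sum => k _; rewrite normrM PoszM ler_pM.
by rewrite sumr_const card_ord -mulr_natl expnS natz -PoszM lez_nat; nia.
Qed.

Lemma grad_mx_bound t (Y : 'M[int]_n) i j : (t <= n ^ 36)%N ->
  (forall i j, `|Y i j| <= t%:Z * (trb * scale)) -> `|grad_mx E t Y i j| <= (n ^ 90)%:Z.
Proof.
move=> ht hY; rewrite mxE.
have h2 : `|Y i j * (mono_val n lam_m)%:Z * (mask E i j)%:Z| <= t%:Z * (trb * scale) * (mono_val n lam_m)%:Z * 2.
  rewrite !normrM ler_pM // ?ler_pM //.
  rewrite /mask; case: (is_edge _ _ _); case: (i == j); rewrite ger0_norm //; lia.
have h1 : `|t%:Z * scale + (i == j)%:Z * (t%:Z * scale * (shift + (mono_val n lam_m)%:Z))| <=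
   (t * mono_val n scale_m + t * mono_val n scale_m * (mono_val n shift_m + mono_val n lam_m))%:Z.
  rewrite ger0_norm; last by rewrite -!(PoszM, PoszD).
  by rewrite -!(PoszM, PoszD) lez_nat; case: (i == j); lia.
apply: le_trans (ler_normB _ _) _; apply: le_trans (lerD h1 h2) _.
rewrite -!(PoszM, PoszD) lez_nat /mono_val /= !mul1n expn1.
apply: (@leq_trans (n ^ 36 * n ^ 16 + n ^ 36 * n ^ 16 * (n ^ 30 + n ^ 9) + n ^ 36 * (3 * n * n ^ 16) * n ^ 9 * 2)%N).
  by rewrite !leq_add // !leq_mul.
have -> : (n ^ 36 * n ^ 16 + n ^ 36 * n ^ 16 * (n ^ 30 + n ^ 9) + n ^ 36 * (3 * n * n ^ 16) * n ^ 9 * 2 =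
  n ^ 52 + (n ^ 82 + n ^ 61) + n ^ 62 * 6)%N by ring.
have le a : (a <= 89)%N -> (n ^ a <= n ^ 89)%N by move=> ha; rewrite leq_pexp2l.
apply: (@leq_trans (n ^ 89 + (n ^ 89 + n ^ 89) + n ^ 89 * 6)%N).
  by apply: leq_add; [apply: leq_add; [|apply: leq_add] | rewrite leq_mul2r]; rewrite le.
by rewrite (expnSr n 89); move: (n ^ 89)%N => x; nia.
Qed.

(** Entries of the shifted gradient are at most [n ^ 90], so those of its power are at most
    [(n ^ 91) ^ N]. The factor [n ^ 20] covers scale, trace bound and normalisation, and
    [n <= 2 ^ n] converts the product into a number of bits. *)
Lemma fw_round_ok q : (q < mono_val n rounds_m)%N ->
  round_ok (mono_val n word_m) E q.+1 (fw_iter E q).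
Proof.
move=> hq; rewrite /round_ok; set C := grad_mx _ _ _; set s := pow_trace _ _.
have hC : C^T = C by apply/grad_mx_sym/fw_iter_sym.
have s0 : 0 < s by exact: pow_trace_gt0.
have tq : (q.+1 <= n ^ 36)%N by move: hq; rewrite /mono_val mul1n.
have bC i j : `|C i j| <= (n ^ 90)%:Z.
  by apply: grad_mx_bound => // i' j'; exact: fw_iter_bound.
have V0 : (0 < n ^ 90)%N by rewrite expn_gt0 n_gt0.
set N := mono_val n power_m; set M := ((n ^ 91) ^ N)%N.
have bP i j : `|mpow C N i j| <= M%:Z.
  by have := mpow_bound N i j V0 bC; rewrite -expnS.
have bs : s <= ((n + 1) * M)%N%:Z.
  rewrite mulnDl PoszD; apply: lerD.
    apply: le_trans (_ : \sum_(k < n) M%:Z <= _).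
      by apply: ler_sum => k _; apply: le_trans (ler_norm _) (bP k k).
    by rewrite sumr_const card_ord -mulr_natl natz -PoszM.
  have -> : (1 * M)%N%:Z = (n ^ 91)%:Z ^+ N by rewrite mul1n /M -[LHS]natz natrX natz.
  rewrite -!PoszM lerXn2r // ?nnegrE // lez_nat.
  rewrite /mono_val !mul1n; apply: (@leq_trans (n ^ 36 * n ^ 16 * n ^ 30)%N).
    by rewrite !leq_mul.
  by rewrite -!expnD leq_pexp2l.
have WM : (n ^ 20 * M < 2 ^ mono_val n word_m)%N.
  rewrite /M -expnM -expnD.
  have h1 : (20 + 91 * N <= 250 * n ^ 36)%N.
    rewrite /N /mono_val /=; have : (0 < n ^ 36)%N by rewrite expn_gt0 n_gt0.
    by move: (n ^ 36)%N => x; lia.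
  have h2 : (n ^ (20 + 91 * N) <= (2 ^ n) ^ (250 * n ^ 36))%N.
    apply: leq_trans (leq_pexp2l n_gt0 h1) _.
    by rewrite leq_exp2r ?muln_gt0 ?expn_gt0 ?n_gt0 // ltnW // ltn_expl.
  apply: leq_ltn_trans h2 _; rewrite -expnM ltn_exp2l // /mono_val /= mulnCA -expnS.
  by rewrite ltn_pmul2r // expn_gt0 n_gt0.
have t3 : (mono_val n trace_m * mono_val n scale_m * ((n + 2) * M) <= n ^ 20 * M)%N.
  rewrite mulnA leq_mul2r; apply/orP; right.
  rewrite /mono_val /= expn1 mul1n -(mulnA 3) -expnS.
  apply: (@leq_trans (n * n ^ 17 * (n * n))%N); last by rewrite -expnS mulnn -expnD leq_pexp2l.
  by rewrite !leq_mul // ?(leq_trans _ n_ge) //; nia.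
split.
  rewrite s0; apply: le_lt_trans bs _; rewrite ltz_nat; apply: leq_ltn_trans WM.
  apply: leq_trans _ t3; rewrite -[X in (X <= _)%N]mul1n leq_mul //.
    by rewrite !muln_gt0 n_gt0.
  by rewrite leq_mul2r leq_add2l orbT.
move=> i j; have hP : `|mpow C N i j| <= s by exact: mpow_le_trace.
have tb0 : 0 <= trb * scale by rewrite -PoszM.
rewrite -mulrDr; apply/andP; split.
  by apply: mulr_ge0 => //; move: hP; rewrite ler_norml; lia.
apply: le_lt_trans (_ : trb * scale * ((n + 2) * M)%N%:Z < _); last first.
  by rewrite -!PoszM ltz_nat; apply: leq_ltn_trans WM.
apply: ler_wpM2l => //; have := bP i j; rewrite ler_norml => /andP[_ h].
by move: h bs; rewrite !mulnDl !PoszD; lia.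
Qed.

End Bounds.

Definition main_prog : hcmd := HSeq fw_prog select_prog.

Definition main_alg : algorithm := program_alg word_m main_prog 24.

Lemma main_alg_poly_time : poly_time main_alg.
Proof.
apply: program_poly_time => // n n0.
have fit c e : (c <= 300)%N -> (e <= 37)%N -> (mono_val n (c, e) <= 2 ^ mono_val n word_m)%N.
  move=> hc he; apply: leq_trans (_ : (mono_val n word_m <= _)%N); last exact/ltnW/ltn_expl.
  by rewrite /mono_val leq_mul // leq_pexp2l.
by rewrite /= !fit.
Qed.

Lemma main_alg_spec n (E : edge_set n) u : (10 <= n)%N ->
  main_alg E u = selection E (fw_iter E (mono_val n rounds_m)) u.
Proof.
move=> n10; have n0 : (0 < n)%N by exact: leq_trans n10.
set w := mono_val n word_m.
have fit c e : (c <= 300)%N -> (e <= 37)%N -> (mono_val n (c, e) <= 2 ^ w)%N.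
  move=> hc he; apply: leq_trans (_ : (mono_val n word_m <= _)%N); last exact/ltnW/ltn_expl.
  by rewrite /mono_val leq_mul // leq_pexp2l.
have fit1 : (n <= 2 ^ w)%N by have := fit 1 1 isT isT; rewrite mono11.
have big : (n ^ 60 < 2 ^ w)%N.
  apply: (@leq_ltn_trans ((2 ^ n) ^ 60)); first by rewrite leq_exp2r // ltnW // ltn_expl.
  rewrite -expnM ltn_exp2l // /w /mono_val /= expnS mulnCA ltn_pmul2l //.
  have : (0 < n ^ 36)%N by rewrite expn_gt0 n0.
  by move: (n ^ 36)%N => x; lia.
have h0 := program_start E u (isT : 0 < word_m.1)%N (isT : 0 < word_m.2)%N.
have e0 : env w E u (prologue_state (initial_memory E u) w) by case: h0.
have off : (2 * ((mono_val n rounds_m + 1) * (mono_val n trace_m * mono_val n scale_m)) < 2 ^ w)%N.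
  apply: leq_ltn_trans big; rewrite /mono_val /= !mul1n expn1 -(mulnA 3) -expnS.
  have h36 : (0 < n ^ 36)%N by rewrite expn_gt0 n0.
  apply: (@leq_trans (n * (n * n ^ 36 * (n * n ^ 17)))%N).
    apply: leq_mul; first by apply: leq_trans n10.
    apply: leq_mul; last by rewrite leq_mul2r (leq_trans _ n10) ?orbT.
    by move: (n ^ 36)%N h36 => x h36; nia.
  by rewrite -!expnS -expnD -expnS leq_pexp2l.
have hsd : (mono_val n trace_m * mono_val n scale_m <= 2 ^ w)%N.
  by apply: leq_trans (ltnW off); rewrite mulnA leq_pmull // muln_gt0 addn1.
have [h7 e7] := fw_spec fit1 (fit 2 36 isT isT)%N (fit 1 36 isT isT)%N e0 hsd
  (fun q hq => fw_round_ok E n10 hq).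
have hY i j : `|fw_iter E (mono_val n rounds_m) i j| <=
    ((mono_val n rounds_m + 1) * (mono_val n trace_m * mono_val n scale_m))%N%:Z.
  by have := fw_iter_bound E n10 (mono_val n rounds_m) i j; rewrite -addn1 -!PoszM.
have small : (2 * n * n + 1 < 2 ^ w)%N.
  apply: leq_ltn_trans big; apply: (@leq_trans (n ^ 3)); last by rewrite leq_pexp2l.
  by rewrite !expnS expn0; nia.
have [_ h24] := select_spec fit1 hY off small e7 h7.
apply/setP => v; rewrite inE /program_output.
have := h24 (Ordinal n0) v; rewrite /mat mul0n add0n => <-.
by rewrite /main_prog hrun_seq.
Qed.

(** * The power method *)

Lemma cauchy_schwarz (R : realFieldType) (I : finType) (f g : I -> R) :
  (\sum_i f i * g i) ^+ 2 <= (\sum_i f i ^+ 2) * (\sum_i g i ^+ 2).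
Proof.
set a := \sum_i f i ^+ 2; set b := \sum_i f i * g i; set c := \sum_i g i ^+ 2.
have a0 : 0 <= a by apply: sumr_ge0 => i _; exact: sqr_ge0.
have H x y : 0 <= x ^+ 2 * a + 2 * x * y * b + y ^+ 2 * c.
  apply: le_trans (_ : 0 <= \sum_i (x * f i + y * g i) ^+ 2) _.
    by apply: sumr_ge0 => i _; exact: sqr_ge0.
  rewrite /a /b /c !mulr_sumr -!big_split /=; apply: ler_sum => i _.
  by rewrite le_eqVlt; apply/orP; left; apply/eqP; ring.
have [a00|an0] := eqVneq a 0.
  have f0 i : f i = 0.
    have := psumr_eq0P (fun i _ => sqr_ge0 (f i)) a00 (i := i) isT => /eqP.
    by rewrite sqrf_eq0 => /eqP.
  by rewrite a00 mul0r /b big1 ?expr0n // => i _; rewrite f0 mul0r.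
have ap : 0 < a by rewrite lt_def an0.
(* The nonnegative quadratic form is evaluated at its minimising direction. *)
have := H (- b) a.
have -> : (- b) ^+ 2 * a + 2 * (- b) * a * b + a ^+ 2 * c = a * (a * c - b ^+ 2) by ring.
by rewrite pmulr_rge0 // subr_ge0.
Qed.

Lemma sum_const_ord (R : pzSemiRingType) n (x : R) : \sum_(i < n) x = n%:R * x.
Proof. by rewrite sumr_const card_ord mulr_natl. Qed.

(** * Log-convex sequences, in place of the spectral theorem *)

Section LogConvex.

Variables (R : realFieldType) (u : nat -> R).
Hypothesis u_ge0 : forall i, 0 <= u i.
Hypothesis u_convex : forall i, u i.+1 ^+ 2 <= u i * u i.+2.

(** Log-convexity says that ratios of consecutive terms increase; positivity of the first two terms
    propagates and makes the ratios meaningful. *)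
Lemma logconvex_ratio i : 0 < u 0%N -> 0 < u 1%N ->
  [/\ 0 < u i, 0 < u i.+1 & u 1%N / u 0%N <= u i.+1 / u i].
Proof.
move=> h0 h1; elim: i => [|i [p0 p1 IH]]; first by split.
have p2 : 0 < u i.+2.
  rewrite -(pmulr_rgt0 _ p0); apply: lt_le_trans (u_convex i).
  by rewrite exprn_gt0.
split=> //; apply: le_trans IH _.
by rewrite ler_pdivrMr // mulrAC ler_pdivlMr // mulrC -expr2 [leRHS]mulrC.
Qed.

Lemma logconvex_ratio_le i j : 0 < u 0%N -> 0 < u 1%N -> (i <= j)%N ->
  u i.+1 / u i <= u j.+1 / u j.
Proof.
move=> h0 h1; elim: j => [|j IH]; first by rewrite leqn0 => /eqP->.
rewrite leq_eqVlt => /predU1P[->//|]; rewrite ltnS => /IH h; apply: le_trans h _.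
have [p0 p1 _] := logconvex_ratio j h0 h1.
have [_ p2 _] := logconvex_ratio j.+1 h0 h1.
by rewrite ler_pdivrMr // mulrAC ler_pdivlMr // mulrC -expr2 [leRHS]mulrC.
Qed.

Lemma logconvex_pow_le m : 0 < u 0%N -> 0 < u 1%N -> (u 1%N / u 0%N) ^+ m * u 0%N <= u m.
Proof.
move=> h0 h1; elim: m => [|m IH]; first by rewrite expr0 mul1r.
have [p0 p1 h] := logconvex_ratio m h0 h1.
have r0 : 0 <= u 1%N / u 0%N by rewrite divr_ge0.
rewrite exprS -mulrA; apply: le_trans (ler_wpM2l r0 IH) _.
by rewrite -ler_pdivlMr.
Qed.

Lemma logconvex_le_pow m j : 0 < u 0%N -> 0 < u 1%N -> (j <= m)%N ->
  u j <= (u m.+1 / u m) ^+ j * u 0%N.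
Proof.
move=> h0 h1; elim: j => [|j IH] hj; first by rewrite expr0 mul1r.
have [p0 p1 _] := logconvex_ratio j h0 h1.
have [q0 q1 _] := logconvex_ratio m h0 h1.
have r0 : 0 <= u m.+1 / u m by rewrite divr_ge0.
rewrite exprS -mulrA; apply: le_trans (ler_wpM2l r0 (IH (ltnW hj))).
by rewrite -ler_pdivrMr //; apply: logconvex_ratio_le => //; apply: ltnW.
Qed.

End LogConvex.

Section PowerMethod.

Variables (R : realFieldType) (n : nat).
Implicit Types (A C M : 'M[R]_n) (s : 'I_n -> R).

Definition quad A s : R := \sum_i \sum_j A i j * s i * s j.

Definition inner A M : R := \sum_i \sum_j A i j * M i j.

Definition vecmul A s : 'I_n -> R := fun i => \sum_j A i j * s j.

Definition normsq s : R := \sum_i s i ^+ 2.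

Lemma normsq_ge0 s : 0 <= normsq s.
Proof. by apply: sumr_ge0 => i _; exact: sqr_ge0. Qed.

Lemma inner_mul_trace C q r : C^T = C ->
  inner (mpow C q) (mpow C r) = \tr (mpow C (q + r)).
Proof.
move=> h; rewrite mpowD /inner /mxtrace; apply: eq_bigr => i _; rewrite mxE.
by apply: eq_bigr => j _; rewrite -{2}(mpow_sym r h) mxE.
Qed.

Lemma inner_cs A M : inner A M ^+ 2 <= inner A A * inner M M.
Proof.
rewrite /inner !pair_big /=.
have := cauchy_schwarz (fun p : 'I_n * 'I_n => A p.1 p.2) (fun p : 'I_n * 'I_n => M p.1 p.2).
by rewrite !(eq_bigr (fun p : 'I_n * 'I_n => _ p.1 p.2 * _ p.1 p.2) (fun p _ => expr2 _)).
Qed.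

Lemma trace_even_ge0 C q : C^T = C -> 0 <= \tr (mpow C (q + q)).
Proof.
move=> h; rewrite -inner_mul_trace //; apply: sumr_ge0 => i _; apply: sumr_ge0 => j _.
by rewrite -expr2 sqr_ge0.
Qed.

Lemma trace_logconvex C q : C^T = C ->
  \tr (mpow C (q.+1 + q.+1)) ^+ 2 <= \tr (mpow C (q + q)) * \tr (mpow C (q.+2 + q.+2)).
Proof.
move=> h; have -> : (q.+1 + q.+1 = q + q.+2)%N by rewrite addSnnS.
by rewrite -!inner_mul_trace // inner_cs.
Qed.

Lemma vecmul_mpowS C s q i : vecmul (mpow C q.+1) s i = vecmul C (vecmul (mpow C q) s) i.
Proof.
rewrite /vecmul mpowSl.
under eq_bigr => j _ do rewrite mxE mulr_suml.
rewrite exchange_big /=; apply: eq_bigr => k _; rewrite mulr_sumr.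
by apply: eq_bigr => j _; rewrite mulrA.
Qed.

Lemma vecmul_adj C s t : C^T = C ->
  \sum_i vecmul C s i * t i = \sum_i s i * vecmul C t i.
Proof.
move=> h; rewrite /vecmul; under eq_bigr => i _ do rewrite mulr_suml.
rewrite exchange_big /=; apply: eq_bigr => j _; rewrite mulr_sumr; apply: eq_bigr => i _.
by rewrite -{1}h mxE; ring.
Qed.

(** Symmetry moves one factor [C] across the inner product, and Cauchy-Schwarz does the rest. *)
Lemma vec_logconvex C s q : C^T = C ->
  normsq (vecmul (mpow C q.+1) s) ^+ 2 <=
  normsq (vecmul (mpow C q) s) * normsq (vecmul (mpow C q.+2) s).
Proof.
move=> h.
have -> : normsq (vecmul (mpow C q.+1) s) =
    \sum_i vecmul (mpow C q) s i * vecmul (mpow C q.+2) s i.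
  rewrite /normsq; under eq_bigr => i _ do rewrite expr2 {1}vecmul_mpowS.
  rewrite [LHS]vecmul_adj //; apply: eq_bigr => i _.
  by rewrite [in RHS]vecmul_mpowS.
exact: cauchy_schwarz.
Qed.

Lemma vecmul_le M s : normsq (vecmul M s) <= inner M M * normsq s.
Proof.
rewrite /normsq /inner mulr_suml; apply: ler_sum => i _.
apply: le_trans (cauchy_schwarz _ _) _; by rewrite ler_wpM2r ?normsq_ge0.
Qed.

Variables (A : 'M[R]_n) (a c : R) (m : nat).
Hypotheses (A_sym : A^T = A) (A_le : forall i j, `|A i j| <= a).
Hypotheses (c_gt0 : 0 < c) (m_gt0 : (0 < m)%N).
Hypothesis c_big : n%:R ^+ 3 * a ^+ 2 + n%:R <= c.

Let C := c%:M + A.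
Let b q := \tr (mpow C (q + q)).
Hypothesis b_gt0 : forall q, 0 < b q.

Let C_sym : C^T = C. Proof. by rewrite /C linearD /= tr_scalar_mx A_sym. Qed.

Let P := (b m)^-1 *: mpow C (m + m).

Lemma power_trace1 : \tr P = 1.
Proof. by rewrite /P linearZ /= mulVf // lt0r_neq0. Qed.

Lemma power_entry i j : `|P i j| <= 1.
Proof.
rewrite mxE normrM [`|(b m)^-1|]ger0_norm ?invr_ge0 ?(ltW (b_gt0 m)) // mulrC ler_pdivrMr // mul1r.
have sq i' j' : mpow C (m + m) i' j' = \sum_l mpow C m i' l * mpow C m j' l.
  by rewrite mpowD mxE; apply: eq_bigr => l _; rewrite -{2}(mpow_sym m C_sym) mxE.
rewrite sq; apply: le_trans (gram_le_trace _ i j) _.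
by rewrite /b /mxtrace; apply: ler_sum => k _; rewrite sq.
Qed.

Let n_gt0 : (0 < n)%N.
Proof.
rewrite lt0n; apply/eqP => n0; have := b_gt0 0%N; rewrite /b /mxtrace big1 ?ltxx // => i.
by case: (i) => k hk; exfalso; move: hk; rewrite n0.
Qed.

Let a_ge0 : 0 <= a.
Proof. by apply: le_trans (normr_ge0 _) (A_le (Ordinal n_gt0) (Ordinal n_gt0)). Qed.

(** The trace of the power [2m + 2] pairs [C ^ 2] with the power [2m]; the square of [c + A] is
    expanded against [P], which has trace 1. *)
Lemma ratio_expand : b m.+1 / b m = c ^+ 2 + 2 * c * inner A P + inner (A *m A) P.
Proof.
have -> : b m.+1 = inner (mpow C 2) (mpow C (m + m)).
  by rewrite inner_mul_trace // /b addSn addnS -addn2 addnC.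
have -> : mpow C 2 = c ^+ 2 *: 1%:M + (2 * c) *: A + A *m A.
  rewrite /mpow /= mul1mx /C mulmxDl !mulmxDr -scalar_mxM mul_scalar_mx mul_mx_scalar -expr2.
  by rewrite -scalemx1 addrA; congr (_ + _); rewrite -addrA -scalerDl mulr_natl.
rewrite /inner.
have E M1 : \sum_i \sum_j M1 i j * P i j = (\sum_i \sum_j M1 i j * mpow C (m + m) i j) / b m.
  rewrite mulr_suml; apply: eq_bigr => i _; rewrite mulr_suml; apply: eq_bigr => j _.
  by rewrite !mxE; ring.
have E1 : \sum_i P i i = (\sum_i \sum_j (1%:M : 'M[R]_n) i j * mpow C (m + m) i j) / b m.
  rewrite mulr_suml; apply: eq_bigr => i _; rewrite (bigD1 i) //= big1 ?addr0.
    by rewrite !mxE eqxx mul1r mulrC.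
  by move=> j ne; rewrite mxE eq_sym (negPf ne) mul0r.
rewrite !E; set Z := \sum_i _ in E1.
have hZ : Z / b m = 1 by rewrite -E1; exact: power_trace1.
have -> x y : c ^+ 2 + x + y = c ^+ 2 * (Z / b m) + x + y by rewrite hZ mulr1.
rewrite !mulrA -!mulrDl; congr (_ / _).
rewrite /Z !mulr_sumr -!big_split /=.
apply: eq_bigr => i _; rewrite !mulr_sumr -!big_split /=; apply: eq_bigr => j _.
by move: (mpow _ _) (A *m A) (1%:M : 'M[R]_n) => M AA I1; rewrite !mxE; ring.
Qed.

Lemma inner_sq_le : inner (A *m A) P <= n%:R ^+ 3 * a ^+ 2.
Proof.
apply: le_trans (_ : \sum_(i < n) \sum_(j < n) n%:R * a ^+ 2 <= _); last first.
  by rewrite !sum_const_ord le_eqVlt; apply/orP; left; apply/eqP; ring.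
apply: ler_sum => i _; apply: ler_sum => j _.
apply: le_trans (ler_norm _) _; rewrite normrM.
apply: le_trans (_ : `|(A *m A) i j| * 1 <= _); first by rewrite ler_wpM2l // power_entry.
rewrite mulr1 mxE; apply: le_trans (ler_norm_sum _ _ _) _.
apply: le_trans (_ : \sum_(k < n) a ^+ 2 <= _); last by rewrite sum_const_ord.
by apply: ler_sum => k _; rewrite normrM expr2 ler_pM.
Qed.

Lemma inner_le : inner A P <= n%:R ^+ 2 * a.
Proof.
apply: le_trans (_ : \sum_(i < n) \sum_(j < n) a <= _); last first.
  by rewrite !sum_const_ord le_eqVlt; apply/orP; left; apply/eqP; ring.
apply: ler_sum => i _; apply: ler_sum => j _.
apply: le_trans (ler_norm _) _; rewrite normrM -[leRHS]mulr1.
by rewrite ler_pM ?power_entry.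
Qed.

(** With [q i] the squared norm of [C ^ i s] and [b i] the trace of [C ^ (2i)], log-convexity gives
    [(q 1) ^ m <= q m <= b m <= n * r ^ m] for [r = b (m+1) / b m], hence [q 1 <= r * (1 + n / m)].
    Since [q 1] is at least [c ^ 2 + 2 c (quad A s)] and [r] is [c ^ 2 + 2 c (inner A P)] up to a
    bounded term, division by [2 c] gives the claim. *)
Lemma power_method s : normsq s = 1 ->
  quad A s <= inner A P + n%:R ^+ 3 * a ^+ 2 / (2 * c) + 3 * c * n%:R / m%:R.
Proof.
move=> s1; set r := b m.+1 / b m; set q := fun i => normsq (vecmul (mpow C i) s).
have n1 : 1 <= n%:R :> R by rewrite ler1n.
have mp : 0 < m%:R :> R by rewrite ltr0n.
have r0 : 0 < r by rewrite divr_gt0.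
(* A crude bound, used only in the error term [r * n / m]. *)
have hr : r <= 3 * c ^+ 2.
  rewrite /r ratio_expand; have h1 := inner_sq_le; have h2 := inner_le.
  have h3 : n%:R ^+ 2 * a <= n%:R ^+ 3 * a ^+ 2 + 1 / 4 * n%:R.
    have : 0 <= n%:R * (n%:R * a - 1 / 2) ^+ 2 by rewrite mulr_ge0 ?ler0n // sqr_ge0.
    by move: (n%:R : R) => x; lra.
  have h4 : 2 * c * inner A P <= 2 * c * (c - 3 / 4 * n%:R).
    have h4' : inner A P <= c - 3 / 4 * n%:R by move: c_big h2 h3; lra.
    by rewrite ler_wpM2l // mulr_ge0 // ltW.
  have h5 : c * 1 <= c * n%:R by rewrite ler_wpM2l // ltW.
  by move: c_big c_gt0; lra.
have q0 : q 0%N = 1.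
  rewrite -s1 /q /normsq; apply: eq_bigr => i _; rewrite /vecmul; congr (_ ^+ 2).
  rewrite (bigD1 i) //= big1 ?addr0 => [|j ne]; first by rewrite mxE eqxx mul1r.
  by rewrite mxE eq_sym (negPf ne) mul0r.
have q1 : c ^+ 2 + 2 * c * quad A s <= q 1%N.
  have E i : vecmul (mpow C 1) s i = c * s i + vecmul A s i.
    rewrite /mpow /= mul1mx /vecmul /C; under eq_bigr => j _ do rewrite mxE mulrDl.
    rewrite big_split /=; congr (_ + _); rewrite (bigD1 i) //= big1 ?addr0 => [|j ne].
      by rewrite mxE eqxx mulr1n.
    by rewrite mxE eq_sym (negPf ne) mul0r.
  rewrite /q /normsq; under eq_bigr => i _ do rewrite E.
  have -> : quad A s = \sum_i s i * vecmul A s i.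
    apply: eq_bigr => i _; rewrite mulr_sumr; apply: eq_bigr => j _; ring.
  have -> x : c ^+ 2 + x = c ^+ 2 * normsq s + x by rewrite s1 mulr1.
  rewrite /normsq !mulr_sumr -big_split /=; apply: ler_sum => i _.
  by have := sqr_ge0 (vecmul A s i); lra.
have key : q 1%N <= r * (1 + n%:R / m%:R).
  have [q10|/eqP q1n] := eqVneq (q 1%N) 0.
    by rewrite q10 mulr_ge0 ?ltW // addr_gt0 // divr_gt0 // ltr0n.
  have qp : 0 < q 1%N by rewrite lt_def normsq_ge0 andbT; apply/eqP.
  have b_conv i : b i.+1 ^+ 2 <= b i * b i.+2 by exact: trace_logconvex.
  have q_conv i : q i.+1 ^+ 2 <= q i * q i.+2 by exact: vec_logconvex.
  have q00 : 0 < q 0%N by rewrite q0.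
  have h1 := logconvex_pow_le (u := q) (fun i => normsq_ge0 _) q_conv m q00 qp.
  have h2 := logconvex_le_pow (fun i => ltW (b_gt0 i)) b_conv (b_gt0 0) (b_gt0 1) (leqnn m).
  rewrite q0 divr1 mulr1 in h1.
  have h3 : q m <= b m.
    apply: le_trans (vecmul_le _ _) _; rewrite s1 mulr1 inner_mul_trace //.
  have b0 : b 0%N = n%:R by rewrite /b addn0 mxtrace1.
  rewrite -/r b0 in h2.
  have h4 : (q 1%N / r) ^+ m <= n%:R.
    rewrite expr_div_n ler_pdivrMr ?exprn_gt0 // mulrC.
    by apply: le_trans h1 _; apply: le_trans h3 h2.
  rewrite mulrC -ler_pdivrMr //; set x := q 1%N / r in h4 *.
  rewrite -lerBlDl leNgt; apply/negP => hx.
  have x1 : 0 < x - 1 by apply: lt_trans hx; rewrite divr_gt0 // ltr0n.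
  (* Bernoulli's inequality turns the [m]-th root of [n] into [1 + n / m]. *)
  have bern k : 1 + k%:R * (x - 1) <= x ^+ k.
    elim: k => [|k IH]; first by rewrite mul0r addr0 expr0.
    rewrite exprS -natr1; have := IH; have k0 : 0 <= k%:R :> R by rewrite ler0n.
    have hx1 : 0 < x by lra.
    move=> IH'; apply: le_trans (ler_wpM2l (ltW hx1) IH').
    have : 0 <= k%:R * (x - 1) ^+ 2 by rewrite mulr_ge0 // sqr_ge0.
    by move: (k%:R) => k' hk; nra.
  have := le_trans (bern m) h4; rewrite ltr_pdivrMr // mulrC in hx.
  by lra.
have h5 : quad A s <= (r * (1 + n%:R / m%:R) - c ^+ 2) / (2 * c).
  rewrite ler_pdivlMr ?mulr_gt0 //; lra.
apply: le_trans h5 _; rewrite ler_pdivrMr ?mulr_gt0 //.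
have e1 : n%:R ^+ 3 * a ^+ 2 / (2 * c) * (2 * c) = n%:R ^+ 3 * a ^+ 2.
  by rewrite divfK // lt0r_neq0 // mulr_gt0.
rewrite 2!mulrDl e1.
have e2 : r * (n%:R / m%:R) <= 3 * c ^+ 2 * (n%:R / m%:R).
  by rewrite ler_wpM2r // divr_ge0 // ler0n.
have e3 : 3 * c * n%:R / m%:R * (2 * c) = 6 * c ^+ 2 * (n%:R / m%:R) by ring.
rewrite e3; have := inner_sq_le; have e4 : r = c ^+ 2 + 2 * c * inner A P + inner (A *m A) P by exact: ratio_expand.
have e5 : 0 <= c ^+ 2 * (n%:R / m%:R) by rewrite mulr_ge0 ?sqr_ge0 // divr_ge0 // ler0n.
by move: e2; rewrite {1 2}e4; move: e5; set y := n%:R / m%:R; rewrite mulrDr mulr1; lra.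
Qed.

End PowerMethod.

(** * The power method with a dummy coordinate *)

Section PowerDummy.

Variables (R : rcfType) (n : nat) (A : 'M[R]_n) (a c : R) (m : nat).
Hypotheses (A_sym : A^T = A) (A_le : forall i j, `|A i j| <= a) (a_ge0 : 0 <= a).
Hypotheses (c_gt0 : 0 < c) (m_gt0 : (0 < m)%N).
Hypothesis c_big : (n + 1)%:R ^+ 3 * a ^+ 2 + (n + 1)%:R <= c.

Let C := c%:M + A.

Definition norm_power : 'M[R]_n :=
  (\tr (mpow C (m + m)) + c ^+ (m + m))^-1 *: mpow C (m + m).

Definition power_error : R :=
  (n + 1)%:R ^+ 3 * a ^+ 2 / (2 * c) + 3 * c * (n + 1)%:R / m%:R.

Let P := norm_power.

Let A1 : 'M[R]_(n + 1) := block_mx A 0 0 0.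
Let C1 := c%:M + A1.

Lemma mpow_block q : mpow C1 q = block_mx (mpow C q) 0 0 (c ^+ q)%:M.
Proof.
elim: q => [|q IH]; first by rewrite expr0 -scalar_mx_block.
rewrite /mpow !iterS -!/(mpow _ _) IH /C1 /A1 (scalar_mx_block n 1 c) add_block_mx !addr0.
rewrite mulmx_block !mulmx0 !mul0mx !addr0 !add0r.
by rewrite -scalar_mxM exprSr.
Qed.

Let A1_sym : A1^T = A1.
Proof. by rewrite /A1 tr_block_mx A_sym !trmx0. Qed.

Let C_sym : C^T = C. Proof. by rewrite /C linearD /= tr_scalar_mx A_sym. Qed.

Let A1_le i j : `|A1 i j| <= a.
Proof.
by rewrite /A1 !mxE; case: fintype.splitP => k _; rewrite !mxE; case: fintype.splitP => l _; rewrite ?mxE ?normr0.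
Qed.

Lemma trace_block q : \tr (mpow C1 q) = \tr (mpow C q) + c ^+ q.
Proof. by rewrite mpow_block mxtrace_block mxtrace_scalar mulr1n. Qed.

Let b_gt0 q : 0 < \tr (mpow C1 (q + q)).
Proof. by rewrite trace_block ltr_wpDl ?trace_even_ge0 // exprn_gt0. Qed.

Let den_gt0 : 0 < \tr (mpow C (m + m)) + c ^+ (m + m).
Proof. by rewrite -trace_block. Qed.

Lemma norm_power_trace : 0 <= \tr P <= 1.
Proof.
have -> : \tr P = \tr (mpow C (m + m)) / (\tr (mpow C (m + m)) + c ^+ (m + m)).
  by rewrite /P /norm_power mxtraceZ mulrC.
apply/andP; split; first by rewrite divr_ge0 ?trace_even_ge0 // ltW.
by rewrite ler_pdivrMr // mul1r lerDl ltW // exprn_gt0.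
Qed.

Lemma norm_power_gram : exists v : 'I_n -> 'I_n -> R, forall i j, P i j = \sum_l v l i * v l j.
Proof.
pose r := Num.sqrt (\tr (mpow C (m + m)) + c ^+ (m + m))^-1.
exists (fun l i => r * mpow C m i l) => i j.
have e : mpow C (m + m) i j = \sum_l mpow C m i l * mpow C m j l.
  rewrite mpowD mxE; apply: eq_bigr => l _.
  by have -> : mpow C m l j = mpow C m j l by rewrite -{1}(mpow_sym m C_sym) mxE.
rewrite mxE e mulr_sumr; apply: eq_bigr => l _.
have <- : r ^+ 2 = (\tr (mpow C (m + m)) + c ^+ (m + m))^-1.
  by rewrite sqr_sqrtr // invr_ge0 ltW.
ring.
Qed.

Lemma inner_block : inner A1 ((\tr (mpow C1 (m + m)))^-1 *: mpow C1 (m + m)) = inner A P.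
Proof.
rewrite /P /norm_power -trace_block; set t := (\tr _)^-1.
rewrite mpow_block /inner big_split_ord /= [X in _ + X]big1 ?addr0; last first.
  move=> i _; rewrite big_split_ord /= !big1 ?addr0 // => j _; rewrite /A1.
    by rewrite block_mxEdr mxE mul0r.
  by rewrite block_mxEdl mxE mul0r.
apply: eq_bigr => i _; rewrite big_split_ord /= [X in _ + X]big1 ?addr0; last first.
  by move=> j _; rewrite /A1 block_mxEur mxE mul0r.
apply: eq_bigr => j _; rewrite /A1 block_mxEul; congr (_ * _).
by rewrite [LHS]mxE block_mxEul [RHS]mxE.
Qed.

Lemma power_unit1 (s : 'I_(n + 1) -> R) : normsq s = 1 -> quad A1 s <= inner A P + power_error.
Proof.
move=> s1; have c_big' : (n + 1)%:R ^+ 3 * a ^+ 2 + (n + 1)%:R <= c by [].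
have := power_method A1_sym A1_le c_gt0 m_gt0 c_big' b_gt0 s1.
by rewrite inner_block addrA.
Qed.

(** The unit vector of the dummy coordinate has quadratic form 0. Thus [P] competes with all Gram
    matrices of trace at most 1, also when [A] has no positive direction. *)
Lemma power_inner_ge0 : 0 <= inner A P + power_error.
Proof.
pose s (i : 'I_(n + 1)) : R := if fintype.split i is inr _ then 1 else 0.
have s1 : normsq s = 1.
  rewrite /normsq big_split_ord /= big1 ?add0r.
    by rewrite big_ord1 /s (unsplitK (inr ord0)) expr1n.
  by move=> i _; rewrite /s (unsplitK (inl i)) expr0n.
have := power_unit1 s1.
suff -> : quad A1 s = 0 by [].
rewrite /quad big1 // => i _; rewrite big1 // => j _.
rewrite /s; case: (fintype.splitP i) => [i' _|i' ei]; first by rewrite mulr0 mul0r.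
have -> : i = rshift n i' by apply/val_inj.
case: (fintype.splitP j) => [j' _|j' ej]; first by rewrite mulr0.
have -> : j = rshift n j' by apply/val_inj.
by rewrite block_mxEdr mxE !mul0r.
Qed.

Lemma power_quad_le (v : 'I_n -> R) : quad A v <= normsq v * (inner A P + power_error).
Proof.
have [v0|vn0] := eqVneq (normsq v) 0.
  rewrite v0 mul0r /quad big1 // => i _; rewrite big1 // => j _.
  have := psumr_eq0P (fun i _ => sqr_ge0 (v i)) v0 (i := j) isT => /eqP.
  by rewrite sqrf_eq0 => /eqP ->; rewrite mulr0.
have vp : 0 < normsq v by rewrite lt_def vn0 normsq_ge0.
pose r := Num.sqrt (normsq v)^-1.
have r2 : r ^+ 2 = (normsq v)^-1 by rewrite sqr_sqrtr // invr_ge0 ltW.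
pose s (i : 'I_(n + 1)) : R := if fintype.split i is inl j then r * v j else 0.
have sl i : s (lshift 1 i) = r * v i by rewrite /s (unsplitK (inl i)).
have sr i : s (rshift n i) = 0 by rewrite /s (unsplitK (inr i)).
have s1 : normsq s = 1.
  rewrite /normsq big_split_ord /= [X in _ + X]big1 ?addr0; last by move=> i _; rewrite sr expr0n.
  under eq_bigr => i _ do rewrite sl exprMn r2.
  by rewrite -mulr_sumr mulVf.
have := power_unit1 s1.
have -> : quad A1 s = (normsq v)^-1 * quad A v.
  rewrite /quad big_split_ord /= [X in _ + X]big1 ?addr0; last first.
    by move=> i _; rewrite big1 // => j _; rewrite sr mulr0 mul0r.
  rewrite mulr_sumr; apply: eq_bigr => i _.
  rewrite big_split_ord /= [X in _ + X]big1 ?addr0; last by move=> j _; rewrite sr mulr0.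
  rewrite mulr_sumr; apply: eq_bigr => j _.
  by rewrite block_mxEul !sl -r2; ring.
by rewrite mulrC ler_pdivrMr // mulrC.
Qed.

End PowerDummy.

(** * Frank-Wolfe iteration *)

Lemma mpowZ (R : comNzRingType) n (k : R) (C : 'M[R]_n) q : mpow (k *: C) q = k ^+ q *: mpow C q.
Proof.
elim: q => [|q IH]; first by rewrite expr0 scale1r.
by rewrite /mpow !iterS -!/(mpow _ _) IH -scalemxAl -scalemxAr scalerA exprSr.
Qed.

Lemma map_mpow (R : nzRingType) n (C : 'M[int]_n) q :
  map_mx (intr : int -> R) (mpow C q) = mpow (map_mx intr C) q.
Proof.
elim: q => [|q IH]; first by rewrite map_mx1.
by rewrite /mpow !iterS -!/(mpow _ _) map_mxM IH.
Qed.

(** Positive semidefiniteness as an explicit factorisation; the index type is left free so that a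
    sum of Gram matrices is a concatenation of vectors. *)
Definition gram (R : ringType) n (X : 'M[R]_n) : Prop :=
  exists (L : finType) (v : L -> 'I_n -> R), forall i j, X i j = \sum_l v l i * v l j.

Section Gram.

Variables (R : rcfType) (n : nat).
Implicit Types X Y A : 'M[R]_n.

Lemma gram_sym X : gram X -> forall i j, X i j = X j i.
Proof. by case=> L [v h] i j; rewrite !h; apply: eq_bigr => l _; rewrite mulrC. Qed.

Lemma gram_entry_le X i j : gram X -> `|X i j| <= \tr X.
Proof.
case=> L [v h]; rewrite h.
apply: le_trans (gram_le_trace (fun i l => v l i) i j) _.
by rewrite /mxtrace le_eqVlt; apply/orP; left; apply/eqP/eq_bigr => k _; rewrite h.
Qed.

Lemma gram_add X Y : gram X -> gram Y -> gram (X + Y).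
Proof.
case=> L [v hv] [M [w hw]]; exists (L + M)%type, (fun l => match l with inl x => v x | inr y => w y end).
by move=> i j; rewrite mxE hv hw big_sumType.
Qed.

Lemma gram_scale k X : 0 <= k -> gram X -> gram (k *: X).
Proof.
move=> k0 [L [v hv]]; exists L, (fun l i => Num.sqrt k * v l i) => i j.
rewrite mxE hv mulr_sumr; apply: eq_bigr => l _.
by rewrite mulrACA -expr2 sqr_sqrtr.
Qed.

Lemma gram1 : gram (1%:M : 'M[R]_n).
Proof.
exists 'I_n, (fun l i => (l == i)%:R) => i j.
rewrite mxE (bigD1 i) //= big1 ?addr0 => [|l ne]; first by rewrite eqxx mul1r.
by rewrite (negPf ne) mul0r.
Qed.

Lemma gram_inner_le A X (lam : R) : gram X -> 0 <= lam ->
  (forall v : 'I_n -> R, quad A v <= normsq v * lam) -> inner A X <= \tr X * lam.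
Proof.
case=> L [v hv] l0 h.
have -> : inner A X = \sum_l quad A (v l).
  rewrite /inner /quad [RHS]exchange_big /=; apply: eq_bigr => i _.
  rewrite [RHS]exchange_big /=; apply: eq_bigr => j _; rewrite hv mulr_sumr.
  by apply: eq_bigr => l _; rewrite mulrA.
have -> : \tr X = \sum_l normsq (v l).
  rewrite /mxtrace /normsq [RHS]exchange_big /=; apply: eq_bigr => i _; rewrite hv.
  by apply: eq_bigr => l _; rewrite expr2.
by rewrite mulr_suml; apply: ler_sum.
Qed.

End Gram.

Section Objective.

Variables (R : rcfType) (n : nat) (E : edge_set n).
Implicit Types X Z D : 'M[R]_n.

Definition penalty : R := n%:R ^+ 9.

(** Penalising the equality constraints leaves only a trace bound, and a linear form over Gram
    matrices of bounded trace is maximised through a top eigenvector; this is what a Frank-Wolfe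
    step can afford. *)
Definition objective X : R :=
  \sum_i \sum_j (X i j - penalty / 2 * (mask E i j)%:R * (X i j - (i == j)%:R) ^+ 2).

Definition gradient X : 'M[R]_n :=
  \matrix_(i, j) (1 - penalty * (mask E i j)%:R * (X i j - (i == j)%:R)).

Lemma penalty_ge0 : 0 <= penalty. Proof. by rewrite exprn_ge0 // ler0n. Qed.

Lemma objective_add X D : objective (X + D) = objective X + inner (gradient X) D -
  penalty / 2 * \sum_i \sum_j (mask E i j)%:R * D i j ^+ 2.
Proof.
rewrite /objective /inner mulr_sumr -big_split -sumrB /=; apply: eq_bigr => i _.
rewrite mulr_sumr -big_split -sumrB /=; apply: eq_bigr => j _; rewrite !mxE.
by field.
Qed.

Lemma objective_concave X Z : objective Z <= objective X + inner (gradient X) (Z - X).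
Proof.
have {1}-> : Z = X + (Z - X) by rewrite addrC subrK.
rewrite objective_add lerBlDr lerDl mulr_ge0 ?divr_ge0 ?penalty_ge0 //.
by apply: sumr_ge0 => i _; apply: sumr_ge0 => j _; rewrite mulr_ge0 ?ler0n // sqr_ge0.
Qed.

Lemma inner_scaler (A X : 'M[R]_n) k : inner A (k *: X) = k * inner A X.
Proof.
rewrite /inner mulr_sumr; apply: eq_bigr => i _; rewrite mulr_sumr; apply: eq_bigr => j _.
by rewrite mxE mulrCA.
Qed.

Lemma inner_addr (A X Z : 'M[R]_n) : inner A (X + Z) = inner A X + inner A Z.
Proof.
rewrite /inner -big_split; apply: eq_bigr => i _; rewrite -big_split; apply: eq_bigr => j _.
by rewrite mxE mulrDr.
Qed.

Lemma inner_perturb (A A' X : 'M[R]_n) (eta M : R) :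
  (forall i j, `|A i j - A' i j| <= eta) -> (forall i j, `|X i j| <= M) ->
  inner A X <= inner A' X + n%:R ^+ 2 * (eta * M).
Proof.
move=> hA hX; rewrite -lerBlDl /inner -sumrB.
have -> : n%:R ^+ 2 * (eta * M) = \sum_(i < n) \sum_(j < n) (eta * M).
  by rewrite !sum_const_ord; ring.
apply: ler_sum => i _; rewrite -sumrB; apply: ler_sum => j _.
by rewrite -mulrBl; apply: le_trans (ler_norm _) _; rewrite normrM ler_pM.
Qed.

Hypothesis E_graph : is_graph E.

Lemma no_loop i : is_edge E i i = false.
Proof.
apply/negP => h; move/forallP: E_graph => /(_ [set i; i]); rewrite /is_edge in h.
by rewrite h /= finset.setUid cards1.
Qed.

Lemma mask_le1 i j : (mask E i j <= 1)%N.
Proof.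
by rewrite /mask; case: eqP => [->|_]; rewrite ?no_loop ?addn0 ?leq_b1.
Qed.

Lemma mask_le1R i j : (mask E i j)%:R <= 1 :> R.
Proof. by rewrite (ler_nat _ _ 1%N) mask_le1. Qed.

Lemma maskii i : mask E i i = 1%N. Proof. by rewrite /mask no_loop eqxx. Qed.

Lemma mask_sq_le D (M : R) : (forall i j, `|D i j| <= M) ->
  \sum_i \sum_j (mask E i j)%:R * D i j ^+ 2 <= n%:R ^+ 2 * M ^+ 2.
Proof.
move=> hD; have -> : n%:R ^+ 2 * M ^+ 2 = \sum_(i < n) \sum_(j < n) M ^+ 2.
  by rewrite !sum_const_ord; ring.
apply: ler_sum => i _; apply: ler_sum => j _.
apply: le_trans (_ : 1 * D i j ^+ 2 <= _).
  by rewrite ler_wpM2r ?sqr_ge0 // mask_le1R.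
by rewrite mul1r -real_normK ?num_real // lerXn2r ?nnegrE // (le_trans _ (hD i j)).
Qed.

Lemma objective_le_sum X : objective X <= \sum_i \sum_j X i j.
Proof.
apply: ler_sum => i _; apply: ler_sum => j _; rewrite lerBlDr lerDl.
by rewrite mulr_ge0 ?sqr_ge0 // mulr_ge0 ?ler0n // divr_ge0 ?penalty_ge0.
Qed.

Lemma objective1 : objective 1%:M = n%:R.
Proof.
rewrite /objective -[RHS]mulr1 -sum_const_ord; apply: eq_bigr => i _.
rewrite (bigD1 i) //= big1 ?addr0 => [|j ne].
  by rewrite !mxE eqxx subrr expr0n /= mulr0 subr0.
by rewrite !mxE eq_sym (negPf ne) subrr expr0n /= mulr0 subr0.
Qed.

(* One Frank-Wolfe step towards [B *: P], where [P] nearly maximises the linear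
   form given by a perturbation [A] of the gradient. *)
Lemma fw_gap X P A Z (B delta eta gam : R) :
  0 <= B -> 0 <= gam <= 1 -> 0 <= inner A P + delta ->
  (forall v, quad A v <= normsq v * (inner A P + delta)) ->
  (forall i j, `|gradient X i j - A i j| <= eta) ->
  gram X -> gram Z -> gram P -> \tr X <= B -> \tr Z <= B -> \tr P <= 1 ->
  objective Z - objective (X + gam *: (B *: P - X)) <=
    (1 - gam) * (objective Z - objective X)
    + gam * (B * delta + n%:R ^+ 2 * (eta * (2 * B)))
    + gam ^+ 2 * (penalty / 2 * (n%:R ^+ 2 * (2 * B) ^+ 2)).
Proof.
move=> B0 /andP[g0 g1] l0 hq heta gX gZ gP tX tZ tP.
have eX i j : `|X i j| <= B by apply: le_trans tX; apply: gram_entry_le.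
have eZ i j : `|Z i j| <= B by apply: le_trans tZ; apply: gram_entry_le.
have eP i j : `|(B *: P) i j| <= B.
  rewrite mxE normrM ger0_norm // ler_piMr //.
  by apply: le_trans tP; apply: gram_entry_le.
have d2 (Y : 'M[R]_n) : (forall i j, `|Y i j| <= B) -> forall i j, `|(B *: P - Y) i j| <= 2 * B.
  move=> hY i j; rewrite mxE [(- Y) i j]mxE; apply: le_trans (ler_normB _ _) _.
  by rewrite mulr2n mulrDl !mul1r lerD.
have hZ : inner A Z <= inner A (B *: P) + B * delta.
  apply: le_trans (gram_inner_le gZ l0 hq) _; rewrite inner_scaler -mulrDr.
  by rewrite ler_wpM2r.
have key : inner (gradient X) (Z - B *: P) <= B * delta + n%:R ^+ 2 * (eta * (2 * B)).
  apply: le_trans (_ : inner A (Z - B *: P) + n%:R ^+ 2 * (eta * (2 * B)) <= _).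
    apply: inner_perturb => // i j.
    by have := d2 _ eZ i j; rewrite -normrN; rewrite !mxE opprB.
  rewrite lerD2r inner_addr -scaleN1r inner_scaler mulN1r.
  by rewrite lerBlDr [leRHS]addrC.
have conc := objective_concave X Z.
rewrite objective_add inner_scaler.
have sq : \sum_i \sum_j (mask E i j)%:R * (gam *: (B *: P - X)) i j ^+ 2 <=
    gam ^+ 2 * (n%:R ^+ 2 * (2 * B) ^+ 2).
  have -> : gam ^+ 2 * (n%:R ^+ 2 * (2 * B) ^+ 2) = n%:R ^+ 2 * (gam * (2 * B)) ^+ 2 by ring.
  apply: mask_sq_le => i j; rewrite mxE normrM ger0_norm // ler_wpM2l //; exact: d2.
have e1 : inner (gradient X) (B *: P - X) = inner (gradient X) (Z - X) - inner (gradient X) (Z - B *: P).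
  rewrite !inner_addr -!scaleN1r !inner_scaler; ring.
have p0 := penalty_ge0.
have sq2 := ler_wpM2l (divr_ge0 p0 (ler0n R 2)) sq.
have k2 := ler_wpM2l g0 key; have c2 := ler_wpM2l g0 conc.
rewrite e1; move: sq2 k2 c2.
move: (\sum_i _) (inner _ (Z - X)) (inner _ (Z - B *: P)) (objective X) (objective Z).
move=> s x y fx fz; lra.
Qed.

End Objective.

Lemma divz_bounds (R : realFieldType) (x s : int) : 0 < s ->
  x%:~R / s%:~R - 1 <= (((x %/ s)%Z)%:~R : R) <= x%:~R / s%:~R.
Proof.
move=> s0; have sp : 0 < s%:~R :> R by rewrite ltr0z.
have e := divz_eq x s; have r0 := modz_ge0 x (lt0r_neq0 s0).
have r1 : (x %% s)%Z < s by rewrite ltz_pmod.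
have eR : x%:~R = ((x %/ s)%Z)%:~R * s%:~R + ((x %% s)%Z)%:~R :> R.
  by rewrite {1}e intrD intrM.
have r0R : 0 <= ((x %% s)%Z)%:~R :> R by rewrite ler0z.
have r1R : ((x %% s)%Z)%:~R <= s%:~R :> R by rewrite ler_int ltW.
rewrite lerBlDr ler_pdivlMr // ler_pdivrMr // mulrDl mul1r eR; apply/andP; split; lra.
Qed.

Section Iteration.

Variables (R : rcfType) (n : nat) (E : edge_set n).
Hypotheses (n_ge : (10 <= n)%N) (E_graph : is_graph E).

Local Notation nu := (n%:R : R).

Definition rshift : R := nu ^+ 30.
Definition rscale : R := nu ^+ 16.
Definition rtrace : R := 3 * nu.

Definition rounded (q : nat) : 'M[R]_n :=
  \matrix_(i, j) ((fw_iter E q i j)%:~R / (q.+1%:R * rscale)).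

Definition direction (q : nat) : 'M[R]_n :=
  norm_power (gradient E (rounded q)) rshift (n ^ 36).

(** Follows the directions of the integer iteration but without the floors, so it remains a Gram
    matrix, which the rounded iterate need not be. *)
Fixpoint exact_sum (q : nat) : 'M[R]_n :=
  if q is q'.+1 then exact_sum q' + rtrace *: direction q' else 1%:M.

Definition exact_iter (q : nat) : 'M[R]_n := q.+1%:R^-1 *: exact_sum q.

Let nu_ge : 10 <= nu. Proof. by rewrite (ler_nat _ 10). Qed.
Let nu_gt0 : 0 < nu. Proof. by apply: lt_le_trans nu_ge. Qed.
Let nu_ge1 : 1 <= nu. Proof. by apply: le_trans nu_ge; rewrite ler1n. Qed.
Let scale_gt0 : 0 < rscale. Proof. by rewrite exprn_gt0. Qed.
Let trace_ge0 : 0 <= rtrace. Proof. by rewrite mulr_ge0 // ltW. Qed.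

Lemma mono_valR b : (mono_val n b)%:R = b.1%:R * nu ^+ b.2.
Proof. by rewrite /mono_val natrM natrX. Qed.

Lemma lam_mR : (mono_val n lam_m)%:R = penalty R n.
Proof. by rewrite mono_valR mul1r. Qed.

Lemma scale_mR : (mono_val n scale_m)%:R = rscale.
Proof. by rewrite mono_valR mul1r. Qed.

Lemma shift_mR : (mono_val n shift_m)%:R = rshift.
Proof. by rewrite mono_valR mul1r. Qed.

Lemma trace_mR : (mono_val n trace_m)%:R = rtrace.
Proof. by rewrite mono_valR expr1. Qed.

Lemma grad_mxR q : map_mx (intr : int -> R) (grad_mx E q.+1 (fw_iter E q)) =
  (q.+1%:R * rscale) *: (rshift%:M + gradient E (rounded q)).
Proof.
apply/matrixP => i j; rewrite !mxE intrB intrD !intrM intrD -!pmulrn lam_mR scale_mR shift_mR.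
have q0 : q.+1%:R != 0 :> R by rewrite pnatr_eq0.
have s0 := lt0r_neq0 scale_gt0.
have -> : rshift *+ (i == j) = (i == j)%:R * rshift by rewrite mulr_natl.
case: (altP (i =P j)) => [<-|ne] /=; rewrite ?maskii //;
  move: (q.+1%:R : R) rscale q0 s0 ((fw_iter _ _ _ _)%:~R : R) (penalty R n) rshift => x y x0 y0 z p h.
  by field; rewrite x0 y0.
by move: ((mask E i j)%:R : R) => w; field; rewrite x0 y0.
Qed.

Let grad_sym q : (grad_mx E q.+1 (fw_iter E q))^T = grad_mx E q.+1 (fw_iter E q).
Proof. exact/grad_mx_sym/fw_iter_sym. Qed.

Lemma gradient_sym q : (gradient E (rounded q))^T = gradient E (rounded q).
Proof.
apply/matrixP => i j; rewrite !mxE /mask is_edge_sym [j == i]eq_sym.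
by rewrite -{1}fw_iter_sym mxE.
Qed.

(** Numerator and denominator are homogeneous of the same degree in the common factor
    [q.+1 * rscale], which cancels. *)
Lemma directionE q i j :
  (mpow (grad_mx E q.+1 (fw_iter E q)) (mono_val n power_m) i j)%:~R
    / (pow_trace q.+1 (grad_mx E q.+1 (fw_iter E q)))%:~R = direction q i j.
Proof.
set C := grad_mx _ _ _; set N := mono_val n power_m.
have NE : N = (n ^ 36 + n ^ 36)%N by rewrite /N power_halves /mono_val mul1n.
set A := gradient E (rounded q); set k := q.+1%:R * rscale.
have k0 : k != 0 by rewrite mulf_neq0 ?pnatr_eq0 // lt0r_neq0.
have MR i' j' : (mpow C N i' j')%:~R = k ^+ N * mpow (rshift%:M + A) N i' j'.
  have := map_mpow R C N; rewrite grad_mxR -/k mpowZ => /matrixP/(_ i' j').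
  by rewrite [LHS]mxE [RHS]mxE.
have TR : (\sum_l mpow C N l l)%:~R = k ^+ N * \tr (mpow (rshift%:M + A) N).
  by rewrite rmorph_sum /= mulr_sumr; apply: eq_bigr => l _; rewrite MR.
have XR (x : int) : (x ^+ N)%:~R = x%:~R ^+ N :> R by exact: rmorphXn.
rewrite MR /pow_trace intrD TR XR !intrM -!pmulrn scale_mR shift_mR -/N -/k [(k * _) ^+ N]exprMn -mulrDr.
rewrite mxE -NE -/A -mulf_div divff ?mul1r; last by rewrite expf_neq0.
by rewrite mulrC.
Qed.

Lemma fw_stepR q i j :
  (fw_iter E q i j)%:~R + rtrace * rscale * direction q i j - 1 <=
  (fw_iter E q.+1 i j)%:~R <=
  (fw_iter E q i j)%:~R + rtrace * rscale * direction q i j.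
Proof.
rewrite [fw_iter E q.+1 i j]mxE rmorphD /=.
set C := grad_mx _ _ _; set s := pow_trace _ _.
have s0 : 0 < s by apply: (pow_trace_gt0 n_ge) => //; exact: grad_sym.
have := divz_bounds R ((mono_val n trace_m)%:Z * (mono_val n scale_m)%:Z * mpow C (mono_val n power_m) i j) s0.
rewrite 2!intrM -!pmulrn trace_mR scale_mR -mulrA directionE.
by rewrite -addrA !lerD2l.
Qed.

(** Each floor loses at most one unit, so errors grow linearly in [q]; dividing by [q + 1] in the
    average keeps them below one unit. *)
Lemma rounding_error q i j :
  `|(fw_iter E q i j)%:~R / rscale - exact_sum q i j| <= q%:R / rscale.
Proof.
elim: q => [|q IH].
  rewrite !mxE intrM -!pmulrn scale_mR mulfK ?lt0r_neq0 //.
  by case: (i == j); rewrite subrr normr0 mul0r.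
have -> : exact_sum q.+1 i j = exact_sum q i j + rtrace * direction q i j by rewrite mxE [X in _ + X]mxE.
have /andP[h1 h2] := fw_stepR q i j.
rewrite ler_norml in IH; have /andP[i1 i2] := IH.
have g1 : (fw_iter E q i j)%:~R / rscale + rtrace * direction q i j - 1 / rscale <= (fw_iter E q.+1 i j)%:~R / rscale.
  rewrite ler_pdivlMr // !mulrBl mulrDl !divfK ?lt0r_neq0 //; move: h1; rewrite mulrAC; lra.
have g2 : (fw_iter E q.+1 i j)%:~R / rscale <= (fw_iter E q i j)%:~R / rscale + rtrace * direction q i j.
  rewrite ler_pdivrMr // mulrDl !divfK ?lt0r_neq0 //; move: h2; rewrite mulrAC; lra.
have iv : 0 < 1 / rscale by rewrite divr_gt0.
have e : q.+1%:R / rscale = q%:R / rscale + 1 / rscale by rewrite -natr1 mulrDl.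
by rewrite ler_norml e; apply/andP; split; lra.
Qed.

Lemma rounded_error q i j : `|rounded q i j - exact_iter q i j| <= rscale^-1.
Proof.
have q0 : 0 < q.+1%:R :> R by rewrite ltr0n.
have -> : rounded q i j - exact_iter q i j = q.+1%:R^-1 * ((fw_iter E q i j)%:~R / rscale - exact_sum q i j).
  by rewrite !mxE; field; rewrite !lt0r_neq0.
rewrite normrM [`|q.+1%:R^-1|]ger0_norm ?invr_ge0 ?ler0n // [leLHS]mulrC ler_pdivrMr //.
apply: le_trans (rounding_error q i j) _; by rewrite [leRHS]mulrC ler_wpM2r ?invr_ge0 ?(ltW scale_gt0) // ler_nat.
Qed.

Lemma rounded_bound q i j : `|rounded q i j| <= 3 * nu.
Proof.
have q0 : 0 < q.+1%:R :> R by rewrite ltr0n.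
rewrite mxE normrM normfV [`|_ * rscale|]ger0_norm; last by rewrite mulr_ge0 ?ler0n // ltW.
rewrite ler_pdivrMr ?mulr_gt0 //.
have := fw_iter_bound E n_ge q i j; rewrite -(ler_int R) intr_norm !intrM -!pmulrn trace_mR scale_mR.
move=> h; apply: le_trans h _; rewrite /rtrace le_eqVlt; apply/orP; left; apply/eqP; ring.
Qed.

Lemma gradient_bound q i j : `|gradient E (rounded q) i j| <= nu ^+ 11.
Proof.
rewrite mxE; apply: le_trans (ler_normB _ _) _; rewrite normr1 !normrM.
have p0 : 0 <= penalty R n by exact: penalty_ge0.
apply: le_trans (_ : 1 + nu ^+ 9 * 1 * (3 * nu + 1) <= _).
  rewrite lerD2l ler_pM ?mulr_ge0 //.
    by rewrite ger0_norm // ler_wpM2l // ger0_norm ?ler0n // mask_le1R.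
  apply: le_trans (ler_normB _ _) _; rewrite lerD ?rounded_bound //.
  by case: (i == j); rewrite ?normr1 ?normr0.
have -> : nu ^+ 11 = nu ^+ 9 * nu ^+ 2 by rewrite -exprD.
have h9 : 1 <= nu ^+ 9 by rewrite exprn_ege1.
apply: le_trans (_ : nu ^+ 9 * (3 * nu + 2) <= _).
  by move: (nu ^+ 9) h9 => x h9; nra.
rewrite ler_wpM2l ?exprn_ge0 ?(ltW nu_gt0) //.
by move: nu_ge; move: (n%:R : R) => x hx; nra.
Qed.

Let c_big : (n + 1)%:R ^+ 3 * (nu ^+ 11) ^+ 2 + (n + 1)%:R <= rshift.
Proof.
have h1 : (n + 1)%:R <= 2 * nu by have nu10 := nu_ge; rewrite natrD; lra.
have h0 : 0 <= (n + 1)%:R :> R by rewrite ler0n.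
apply: le_trans (_ : (2 * nu) ^+ 3 * nu ^+ 22 + (2 * nu) * nu ^+ 24 <= _).
  apply: lerD; first by rewrite -exprM ler_wpM2r ?exprn_ge0 ?(ltW nu_gt0) // lerXn2r ?nnegrE // mulr_ge0 // ltW.
  by rewrite -[leLHS]mulr1 ler_pM // exprn_ege1.
have -> : (2 * nu) ^+ 3 * nu ^+ 22 + (2 * nu) * nu ^+ 24 = 10 * nu ^+ 25 by ring.
rewrite /rshift.
have -> : nu ^+ 30 = nu ^+ 5 * nu ^+ 25 by rewrite -exprD.
rewrite ler_wpM2r ?exprn_ge0 ?(ltW nu_gt0) //.
by rewrite -[leLHS]mulr1 exprS ler_pM // exprn_ege1.
Qed.

Let c_gt0 : 0 < rshift. Proof. by rewrite exprn_gt0. Qed.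
Let m_gt0 : (0 < n ^ 36)%N. Proof. by rewrite expn_gt0 (leq_trans _ n_ge). Qed.
Let a_ge0 : 0 <= nu ^+ 11. Proof. by rewrite exprn_ge0 // ltW. Qed.

Lemma direction_gram q : gram (direction q).
Proof.
have [v hv] := norm_power_gram (n ^ 36) (gradient_sym q) c_gt0.
by exists 'I_n, v.
Qed.

Lemma direction_trace q : \tr (direction q) <= 1.
Proof. by have /andP[] := norm_power_trace (n ^ 36) (gradient_sym q) c_gt0. Qed.

Lemma exact_sum_gram q : gram (exact_sum q).
Proof.
elim: q => [|q IH]; first exact: gram1.
by apply: gram_add => //; apply: gram_scale => //; exact: direction_gram.
Qed.

Lemma exact_sum_trace q : \tr (exact_sum q) <= q.+1%:R * rtrace.
Proof.
elim: q => [|q IH]; first by have nu10 := nu_ge; rewrite mxtrace1 /rtrace; lra.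
rewrite mxtraceD mxtraceZ -[q.+2%:R]natr1 mulrDl mul1r lerD // ler_piMr //.
exact: direction_trace.
Qed.

Lemma exact_iter_gram q : gram (exact_iter q).
Proof. by apply: gram_scale; [rewrite invr_ge0 ler0n | exact: exact_sum_gram]. Qed.

Lemma exact_iter_trace q : \tr (exact_iter q) <= rtrace.
Proof.
rewrite mxtraceZ mulrC ler_pdivrMr ?ltr0n // mulrC; exact: exact_sum_trace.
Qed.

Definition fw_error : R := power_error n (nu ^+ 11) rshift (n ^ 36).

Lemma gradient_rounded q i j :
  `|gradient E (exact_iter q) i j - gradient E (rounded q) i j| <= penalty R n / rscale.
Proof.
rewrite [gradient E (exact_iter q) i j]mxE [gradient E (rounded q) i j]mxE.
have -> : 1 - penalty R n * (mask E i j)%:R * (exact_iter q i j - (i == j)%:R) -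
   (1 - penalty R n * (mask E i j)%:R * (rounded q i j - (i == j)%:R)) =
   penalty R n * ((mask E i j)%:R * (rounded q i j - exact_iter q i j)) by ring.
have p0 : 0 <= penalty R n by exact: penalty_ge0.
rewrite normrM ger0_norm // ler_wpM2l // normrM.
apply: le_trans (_ : 1 * rscale^-1 <= _); last by rewrite mul1r.
by rewrite ler_pM ?rounded_error // ger0_norm ?ler0n // mask_le1R.
Qed.

Lemma exact_iterS q : exact_iter q.+1 =
  exact_iter q + q.+2%:R^-1 *: (rtrace *: direction q - exact_iter q).
Proof.
have ne1 : q.+1%:R != 0 :> R by rewrite pnatr_eq0.
have ne2 : q.+1%:R + 1 != 0 :> R by rewrite natr1 pnatr_eq0.
apply/matrixP => i j; rewrite /exact_iter /= -[q.+2%:R]natr1.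
move: (q.+1%:R : R) ne1 ne2 (exact_sum q) (direction q) => x ne1 ne2 M P.
by rewrite !mxE; field; rewrite ne1 ne2.
Qed.

Definition gap_linear : R := rtrace * fw_error + nu ^+ 2 * (penalty R n / rscale * (2 * rtrace)).
Definition gap_quadratic : R := penalty R n / 2 * (nu ^+ 2 * (2 * rtrace) ^+ 2).

(** Multiplied by [q + 2], the one-step bound telescopes and leaves curvature terms
    [gap_quadratic / (q + 2)]. Their harmonic sum is bounded without logarithms: a term counts at
    most 1 in the first [L] rounds and at most [1 / L] later. *)
Lemma fw_gap_iter Z q (L : R) : gram Z -> \tr Z <= rtrace -> 1 <= L ->
  q.+1%:R * (objective E Z - objective E (exact_iter q)) <=
  objective E Z - objective E 1%:M + q%:R * gap_linear + gap_quadratic * (L + q%:R / L).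
Proof.
move=> gZ tZ L1; have L0 : 0 < L by apply: lt_le_trans L1.
have K0 : 0 <= gap_quadratic.
  by rewrite mulr_ge0 ?divr_ge0 ?penalty_ge0 // mulr_ge0 ?sqr_ge0.
have hL q' : 1 / q'.+1%:R <= 1 / L \/ q'.+1%:R <= L.
  case: (lerP q'.+1%:R L) => h; [by right | left].
  by rewrite ler_pM2l // lef_pV2 ?posrE ?ltr0n // ltW.
suff H : forall q, q.+1%:R * (objective E Z - objective E (exact_iter q)) <=
    objective E Z - objective E 1%:M + q%:R * gap_linear + gap_quadratic * (q%:R / L + Num.min q%:R L).
  apply: le_trans (H q) _; rewrite lerD2l ler_wpM2l // addrC lerD2r ge_min lexx orbT //.
elim=> [|q' IH].
  rewrite mul1r /exact_iter invr1 scale1r !mul0r addr0 add0r lerDl mulr_ge0 // le_min lexx ltW //.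
have B0 : 0 <= rtrace by exact: trace_ge0.
have q0 : 0 < q'.+2%:R :> R by rewrite ltr0n.
have g01 : 0 <= (q'.+2%:R^-1 : R) <= 1.
  by rewrite invr_ge0 ltW //= invf_le1 // ler1n.
have l0 : 0 <= inner (gradient E (rounded q')) (direction q') + fw_error.
  exact: power_inner_ge0 (gradient_sym q') (gradient_bound q') a_ge0 c_gt0 m_gt0 c_big.
have hq v : quad (gradient E (rounded q')) v <= normsq v * (inner (gradient E (rounded q')) (direction q') + fw_error).
  exact: power_quad_le (gradient_sym q') (gradient_bound q') a_ge0 c_gt0 m_gt0 c_big v.
have := fw_gap E_graph B0 g01 l0 hq (gradient_rounded q') (exact_iter_gram q') gZ (direction_gram q')
  (exact_iter_trace q') tZ (direction_trace q').
rewrite -exact_iterS -/gap_linear -/gap_quadratic => h.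
apply: le_trans (ler_wpM2l (ltW q0) h) _.
have -> : q'.+2%:R * ((1 - q'.+2%:R^-1) * (objective E Z - objective E (exact_iter q')) +
    q'.+2%:R^-1 * gap_linear + q'.+2%:R^-1 ^+ 2 * gap_quadratic) =
    q'.+1%:R * (objective E Z - objective E (exact_iter q')) + gap_linear + gap_quadratic * (1 / q'.+2%:R).
  rewrite -[q'.+2%:R]natr1; have : q'.+1%:R + 1 != 0 :> R by rewrite natr1 pnatr_eq0.
  by move=> ne; field.
have step : 1 / q'.+2%:R + (q'%:R / L + Num.min q'%:R L) <= q'.+1%:R / L + Num.min q'.+1%:R L.
  have e : q'.+1%:R / L = q'%:R / L + 1 / L by rewrite -natr1 mulrDl.
  have iv : 0 < 1 / L by rewrite divr_gt0.
  case: (hL q'.+1) => h'.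
    have : Num.min q'%:R L <= Num.min q'.+1%:R L by rewrite le_min !ge_min lexx orbT ler_nat leqnSn.
    by rewrite e addrA [1 / _ + _]addrC => hm; apply: lerD => //; rewrite lerD2l.
  have l1 : 1 / q'.+2%:R <= 1 :> R by rewrite ler_pdivrMr // mul1r ler1n.
  have h2 : q'.+1%:R <= L by apply: le_trans h'; rewrite ler_nat.
  have h3 : q'%:R <= L by apply: le_trans h2; rewrite ler_nat.
  have e2 : q'.+1%:R = q'%:R + 1 :> R by rewrite natr1.
  rewrite !min_l // e; move: l1 iv e2.
  move: (1 / q'.+2%:R : R) (1 / L) (q'%:R / L) (q'.+1%:R : R) (q'%:R : R) => x1 x2 x3 x4 x5; lra.
have H := ler_wpM2l K0 step; rewrite mulrDr in H.
have e3 : q'.+1%:R * gap_linear = q'%:R * gap_linear + gap_linear by rewrite -natr1 mulrDl mul1r.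
rewrite e3; move: IH H.
move: (q'.+1%:R * _) (gap_quadratic * (1 / _)) (gap_quadratic * (_ + _)) (gap_quadratic * (_ + _))
  (q'%:R * gap_linear) => x1 x2 x3 x4 x5; lra.
Qed.

End Iteration.

(** * Properties of the approximate optimum *)

Section Optimality.

Variables (R : rcfType) (n : nat) (E : edge_set n).
Hypotheses (n_ge : (10 <= n)%N) (E_graph : is_graph E).

Local Notation nu := (n%:R : R).

Let nu_ge : 10 <= nu. Proof. by rewrite (ler_nat _ 10). Qed.
Let nu_gt0 : 0 < nu. Proof. by apply: lt_le_trans nu_ge. Qed.
Let nu_ge1 : 1 <= nu. Proof. by apply: le_trans nu_ge; rewrite ler1n. Qed.

Let final : 'M[R]_n := exact_iter R E (n ^ 36).

Let nuX_ge a : 1 <= nu ^+ a. Proof. exact: exprn_ege1. Qed.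
Let nuX_gt0 a : 0 < nu ^+ a. Proof. exact: exprn_gt0. Qed.

Lemma fw_error_le : fw_error R n <= 10 / nu ^+ 5.
Proof.
have nu10 := nu_ge.
have h1 : (n + 1)%:R <= 2 * nu by rewrite natrD; lra.
have -> : 10 / nu ^+ 5 = (2 * nu) ^+ 3 * (nu ^+ 11) ^+ 2 / (2 * nu ^+ 30) + 3 * nu ^+ 30 * (2 * nu) / nu ^+ 36.
  by field; rewrite lt0r_neq0.
rewrite /fw_error /power_error /rshift natrX; apply: lerD.
  rewrite ler_wpM2r ?invr_ge0 ?mulr_ge0 ?ler0n ?(ltW (nuX_gt0 _)) //.
  by rewrite ler_wpM2r ?sqr_ge0 // lerXn2r ?nnegrE ?ler0n // mulr_ge0 ?(ltW nu_gt0) ?ler0n.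
rewrite ler_wpM2r ?invr_ge0 ?(ltW (nuX_gt0 _)) //.
by rewrite ler_wpM2l // mulr_ge0 ?ler0n // ltW.
Qed.

Lemma gap_linear_le : gap_linear R n <= 1 / 2.
Proof.
have nu10 := nu_ge; have h4 : 10 * 10 <= nu ^+ 4.
  rewrite -[nu ^+ 4]/(nu ^+ (2 + 2)) exprD; have h2 : 10 <= nu ^+ 2.
    by rewrite expr2 -[leLHS]mulr1 ler_pM.
  by rewrite ler_pM.
apply: le_trans (_ : 36 / nu ^+ 4 <= _); last by rewrite ler_pdivrMr //; lra.
rewrite /gap_linear /penalty /rscale /rtrace.
have -> : 36 / nu ^+ 4 = 3 * nu * (10 / nu ^+ 5) + nu ^+ 2 * (nu ^+ 9 / nu ^+ 16 * (2 * (3 * nu))).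
  by field; rewrite lt0r_neq0.
rewrite lerD2r ler_wpM2l ?fw_error_le // mulr_ge0 // ltW.
Qed.

Lemma final_opt (Z : 'M[R]_n) : gram Z -> \tr Z <= 3 * nu ->
  objective E Z <= objective E final + 1.
Proof.
move=> gZ tZ; have nu10 := nu_ge.
(* [L = n ^ 18] balances [L] against [n ^ 36 / L]. *)
have := fw_gap_iter n_ge E_graph (n ^ 36) gZ tZ (nuX_ge 18).
have hZ : objective E Z <= 3 * nu ^+ 3.
  apply: le_trans (objective_le_sum _ _) _.
  apply: le_trans (_ : \sum_(i < n) \sum_(j < n) 3 * nu <= _).
    apply: ler_sum => i _; apply: ler_sum => j _; apply: le_trans (ler_norm _) _.
    by apply: le_trans tZ; exact: gram_entry_le.
  by rewrite !sum_const_ord le_eqVlt; apply/orP; left; apply/eqP; ring.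
rewrite objective1 //.
have K : gap_quadratic R n * (nu ^+ 18 + (n ^ 36)%:R / nu ^+ 18) = 36 * nu ^+ 31.
  by rewrite /gap_quadratic /penalty /rtrace natrX; field; rewrite lt0r_neq0.
rewrite K => h.
have q0 : 0 < (n ^ 36).+1%:R :> R by rewrite ltr0n.
rewrite -lerBlDl -(ler_pM2l q0); apply: le_trans h _; rewrite mulr1.
have h1 : (n ^ 36)%:R * gap_linear R n <= (n ^ 36)%:R * (1 / 2).
  by rewrite ler_wpM2l ?ler0n // gap_linear_le.
have h2 : 100 * nu ^+ 31 <= nu ^+ 36.
  have -> : nu ^+ 36 = nu ^+ 2 * nu ^+ 3 * nu ^+ 31 by rewrite -!exprD.
  rewrite ler_wpM2r ?(ltW (nuX_gt0 _)) //.
  have := nuX_ge 3; have : 100 <= nu ^+ 2 by rewrite expr2; nra.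
  by move: (nu ^+ 2) (nu ^+ 3) => x y; nra.
have h3 : nu ^+ 3 <= nu ^+ 31 by apply: ler_weXn2l.
rewrite -[(n ^ 36).+1%:R]natr1; move: h1 h2 h3 hZ nu10 (nuX_ge 36); rewrite natrX.
move: (nu ^+ 36) (nu ^+ 31) (nu ^+ 3) nu (_ * gap_linear R n) (objective E Z) => a b c d e f; lra.
Qed.

Lemma final_gram : gram final. Proof. exact: exact_iter_gram. Qed.

Lemma final_trace : \tr final <= 3 * nu. Proof. exact: exact_iter_trace. Qed.

(** The identity matrix has no penalty, so near-optimality bounds the penalty of [final] by the sum
    of its entries plus 1, which is of order [n ^ 3]; dividing by [n ^ 9] leaves [n ^ (-6)]. *)
Lemma mask_deviation i j : (mask E i j)%:R * (final i j - (i == j)%:R) ^+ 2 <= 8 / nu ^+ 6.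
Proof.
have nu10 := nu_ge.
have := final_opt (gram1 R n); rewrite mxtrace1 objective1 //.
have -> : nu <= 3 * nu by lra.
move=> /(_ isT) h.
have e : objective E final = \sum_i \sum_j final i j - penalty R n / 2 *
    \sum_i \sum_j (mask E i j)%:R * (final i j - (i == j)%:R) ^+ 2.
  rewrite /objective mulr_sumr -sumrB; apply: eq_bigr => i' _.
  by rewrite mulr_sumr -sumrB; apply: eq_bigr => j' _; rewrite mulrA.
have s : \sum_i \sum_j final i j <= 3 * nu ^+ 3.
  apply: le_trans (_ : \sum_(i < n) \sum_(j < n) 3 * nu <= _).
    apply: ler_sum => i' _; apply: ler_sum => j' _; apply: le_trans (ler_norm _) _.
    by apply: le_trans final_trace; exact: gram_entry_le final_gram.
  by rewrite !sum_const_ord le_eqVlt; apply/orP; left; apply/eqP; ring.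
have t0 i' j' : 0 <= (mask E i' j')%:R * (final i' j' - (i' == j')%:R) ^+ 2.
  by rewrite mulr_ge0 ?ler0n // sqr_ge0.
have t1 : (mask E i j)%:R * (final i j - (i == j)%:R) ^+ 2 <=
    \sum_i \sum_j (mask E i j)%:R * (final i j - (i == j)%:R) ^+ 2.
  rewrite (bigD1 i) //= (bigD1 j) //= -addrA lerDl addr_ge0 //.
    exact: sumr_ge0.
  by apply: sumr_ge0 => i' _; exact: sumr_ge0.
rewrite ler_pdivlMr //; move: h t1; rewrite e.
have h3 : nu <= nu ^+ 3 by rewrite -[leLHS]expr1; apply: ler_weXn2l.
set x := (mask E i j)%:R * _; set y := \sum_i \sum_j (mask E i j)%:R * _ => h t1.
have h6 : penalty R n / 2 * x <= 4 * nu ^+ 3.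
  have : penalty R n / 2 * x <= penalty R n / 2 * y.
    by rewrite ler_wpM2l // divr_ge0 ?penalty_ge0.
  by move: h s h3 nu10; move: (penalty R n / 2 * y) (penalty R n / 2 * x) (\sum_i _) (nu ^+ 3) nu => a b c d f; lra.
rewrite -(ler_pM2r (nuX_gt0 3)) -mulrA -exprD; move: h6; rewrite /penalty [X in (X <= _) -> _]mulrAC.
by rewrite [_ * x]mulrC; move: (x * _) => z; lra.
Qed.

Lemma final_diag i : final i i <= 1 + 3 / nu ^+ 3.
Proof.
have := mask_deviation i i; rewrite maskii // mul1r eqxx => h.
have p : 0 < 3 / nu ^+ 3 by rewrite divr_gt0.
rewrite -lerBlDl leNgt; apply/negP => lt.
have : (3 / nu ^+ 3) ^+ 2 <= (final i i - 1) ^+ 2 by rewrite lerXn2r ?nnegrE ?(ltW p) ?(ltW lt) ?(ltW (lt_trans p lt)).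
move=> h'; have := le_trans h' h; rewrite expr_div_n -exprM ler_pM2r ?invr_gt0 //; lra.
Qed.

Lemma final_edge i j : is_edge E i j -> `|final i j| <= 3 / nu ^+ 3.
Proof.
move=> e; have ne : (i == j) = false by apply/eqP => ij; rewrite ij no_loop in e.
have := mask_deviation i j; rewrite /mask e ne addn0 mul1r subr0 => h.
have p : 0 < 3 / nu ^+ 3 by rewrite divr_gt0.
rewrite leNgt; apply/negP => lt.
have : (3 / nu ^+ 3) ^+ 2 <= `|final i j| ^+ 2 by rewrite lerXn2r ?nnegrE ?(ltW p) ?(ltW lt).
rewrite real_normK ?num_real //.
move=> h'; have := le_trans h' h; rewrite expr_div_n -exprM ler_pM2r ?invr_gt0 //; lra.
Qed.

(* Compare with the solution that collapses [S] to a single unit vector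
   orthogonal to everything else. *)
Lemma final_cluster (S : {set 'I_n}) : (forall i j, i \in S -> j \in S -> ~~ is_edge E i j) ->
  #|S|%:R ^+ 2 - 1 <= \sum_(i in S) \sum_(j in S) final i j + 2 * \sum_(i in S) \sum_(j in ~: S) final i j.
Proof.
move=> indep; have nu10 := nu_ge.
have fs := gram_sym final_gram.
pose Z : 'M[R]_n := \matrix_(i, j) ((i \in S) && (j \in S))%:R + \matrix_(i, j) (((i \notin S) && (j \notin S))%:R * final i j).
have gZ : gram Z.
  apply: gram_add.
    exists unit, (fun _ i => (i \in S)%:R) => i j.
    by rewrite big_const card_unit /= addr0 mxE; case: (i \in S); case: (j \in S); rewrite /= ?mulr1 ?mulr0.
  have [L [v hv]] := final_gram; exists L, (fun l i => (i \notin S)%:R * v l i) => i j.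
  rewrite mxE hv mulr_sumr; apply: eq_bigr => l _.
  by case: (i \in S); case: (j \in S); rewrite /= ?mul0r ?mulr0 ?mul1r.
have ZE i j : Z i j = ((i \in S) && (j \in S))%:R + ((i \notin S) && (j \notin S))%:R * final i j.
  by rewrite !mxE.
have tZ : \tr Z <= 3 * nu.
  apply: le_trans (_ : \sum_(i < n) 3 <= _); last by rewrite sum_const_ord mulrC.
  apply: ler_sum => i _; rewrite ZE; have := final_diag i; rewrite !andbb.
  have : 3 / nu ^+ 3 <= 1.
    rewrite ler_pdivrMr // mul1r; apply: le_trans (_ : nu <= _); first by lra.
    by rewrite -[leLHS]expr1; apply: ler_weXn2l.
  by case: (i \in S); rewrite /= ?mul0r ?mul1r; lra.
have := final_opt gZ tZ => h.
have D : \sum_i \sum_j (Z i j - final i j) <= 1.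
  apply: le_trans (_ : objective E Z - objective E final <= _); last by rewrite lerBlDl.
  rewrite /objective -sumrB; apply: ler_sum => i _; rewrite -sumrB; apply: ler_sum => j _.
  (* Entrywise the penalty of [Z] is no larger: it vanishes as soon as an index lies in [S], which
     has no inner edges, and is unchanged elsewhere. *)
  suff : penalty R n / 2 * (mask E i j)%:R * (Z i j - (i == j)%:R) ^+ 2 <=
      penalty R n / 2 * (mask E i j)%:R * (final i j - (i == j)%:R) ^+ 2.
    set x := _ * (Z i j - _) ^+ 2; set y := _ * (final i j - _) ^+ 2; lra.
  rewrite -[leLHS]mulrA -[leRHS]mulrA ler_wpM2l ?divr_ge0 ?penalty_ge0 //.
  have m0 : 0 <= (mask E i j)%:R * (final i j - (i == j)%:R) ^+ 2 by rewrite mulr_ge0 ?ler0n ?sqr_ge0.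
  have [Si|Si] := boolP (i \in S); have [Sj|Sj] := boolP (j \in S); rewrite ZE Si Sj ?(negPf Si) ?(negPf Sj) /= ?mul0r ?mul1r ?addr0 ?add0r //.
  - case: (altP (i =P j)) => [ij|ne]; first by rewrite subrr expr0n /= mulr0 mulr_ge0 ?ler0n ?sqr_ge0.
    by rewrite /mask (negPf (indep i j Si Sj)) (negPf ne) mul0r mul0r.
  - have ne : i == j = false by apply/eqP => ij; rewrite ij (negPf Sj) in Si.
    by rewrite ne /= oppr0 expr0n /= mulr0 mulr_ge0 ?ler0n ?sqr_ge0.
  - have ne : i == j = false by apply/eqP => ij; rewrite -ij (negPf Si) in Sj.
    by rewrite ne /= oppr0 expr0n /= mulr0 mulr_ge0 ?ler0n ?sqr_ge0.
have split2 (f : 'I_n -> 'I_n -> R) : \sum_i \sum_j f i j =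
    \sum_(i in S) \sum_(j in S) f i j + \sum_(i in S) \sum_(j in ~: S) f i j +
    (\sum_(i in ~: S) \sum_(j in S) f i j + \sum_(i in ~: S) \sum_(j in ~: S) f i j).
  have sp (g : 'I_n -> R) : \sum_i g i = \sum_(i in S) g i + \sum_(i in ~: S) g i.
    rewrite (bigID (mem S)) /=; congr (_ + _); apply: eq_bigl => i; by rewrite finset.in_setC.
  rewrite sp -!big_split /=; congr (_ + _); apply: eq_bigr => i _; exact: sp.
move: D; rewrite split2.
have -> : \sum_(i in ~: S) \sum_(j in ~: S) (Z i j - final i j) = 0.
  rewrite big1 // => i; rewrite finset.in_setC => Si; rewrite big1 // => j; rewrite finset.in_setC => Sj.
  by rewrite ZE Si Sj (negPf Si) mul1r add0r subrr.
have -> : \sum_(i in S) \sum_(j in S) (Z i j - final i j) = #|S|%:R ^+ 2 - \sum_(i in S) \sum_(j in S) final i j.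
  transitivity (\sum_(i in S) (#|S|%:R - \sum_(j in S) final i j)).
    apply: eq_bigr => i Si; rewrite sumrB; congr (_ - _).
    transitivity (\sum_(j in S) (1 : R)); last by rewrite sumr_const.
    by apply: eq_bigr => j Sj; rewrite ZE Si Sj /= mul0r addr0.
  by rewrite sumrB sumr_const expr2 mulr_natr.
have -> : \sum_(i in S) \sum_(j in ~: S) (Z i j - final i j) = - \sum_(i in S) \sum_(j in ~: S) final i j.
  rewrite -sumrN; apply: eq_bigr => i Si; rewrite -sumrN; apply: eq_bigr => j; rewrite finset.in_setC => Sj.
  by rewrite ZE Si (negPf Sj) /= mul0r addr0 sub0r.
have -> : \sum_(i in ~: S) \sum_(j in S) (Z i j - final i j) = - \sum_(i in S) \sum_(j in ~: S) final i j.
  rewrite exchange_big -sumrN; apply: eq_bigr => i Si; rewrite -sumrN; apply: eq_bigr => j; rewrite finset.in_setC => Sj.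
  by rewrite ZE Si (negPf Sj) /= mul0r addr0 sub0r fs.
lra.
Qed.

Lemma final_rounding i j :
  `|(fw_iter E (n ^ 36) i j)%:~R / ((n ^ 36).+1%:R * nu ^+ 16) - final i j| <= (nu ^+ 16)^-1.
Proof. by have := rounded_error R n_ge E_graph (n ^ 36) i j; rewrite mxE. Qed.

End Optimality.

(** * Grothendieck's inequality *)

Section Rademacher.

Variables (R : realFieldType) (L : Type).

(** Sign vectors as nested pairs along a list, so that moments of random signs follow by induction
    on the list. *)
Fixpoint cube (s : seq L) : finType :=
  if s is _ :: s' then (bool * cube s')%type else unit.

Definition sgnb (b : bool) : R := if b then 1 else - 1.

Fixpoint rademacher (s : seq L) (x : L -> R) : cube s -> R :=
  match s with
  | [::] => fun _ => 0
  | l :: s' => fun w => rademacher x w.2 + sgnb w.1 * x l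
  end.

Lemma sum_bool_pair (T : finType) (f : bool * T -> R) :
  \sum_w f w = \sum_w (f (true, w) + f (false, w)).
Proof.
transitivity (\sum_w f (w.1, w.2)); first by apply: eq_bigr => -[].
by rewrite -(pair_bigA _ (fun b w => f (b, w))) /= big_bool -big_split.
Qed.

Lemma card_cube s : #|cube s| = (2 ^ size s)%N.
Proof. by elim: s => [|l s IH]; rewrite /= ?card_unit // card_prod card_bool IH expnS. Qed.

Lemma rademacher2 s (x y : L -> R) :
  \sum_w rademacher (s := s) x w * rademacher (s := s) y w =
  2 ^+ size s * \sum_(l <- s) x l * y l.
Proof.
elim: s => [|l s IH]; first by rewrite big_nil mulr0 big1 // => w _; rewrite mul0r.
rewrite sum_bool_pair /= big_cons exprS -mulrA mulrDr -[in RHS]IH.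
rewrite -(mulr_natl 1) ?mulr1.
have -> : 2 ^+ size s = \sum_(w : cube s) (1 : R).
  by rewrite sumr_const card_cube natrX.
rewrite mulr_suml -big_split /= mulr_sumr; apply: eq_bigr => w _; ring.
Qed.

(** Odd powers of the new sign cancel, and the remaining cross term needs only the second moment. *)
Lemma rademacher4 s (x : L -> R) :
  \sum_w rademacher (s := s) x w ^+ 4 <= 3 * 2 ^+ size s * (\sum_(l <- s) x l ^+ 2) ^+ 2.
Proof.
elim: s => [|l s IH].
  by rewrite big_nil expr0n mulr0 big1 // => w _; rewrite expr0n.
rewrite sum_bool_pair /= big_cons exprS; set q := \sum_(l <- s) _.
have e2 : \sum_w rademacher (s := s) x w ^+ 2 = 2 ^+ size s * q.
  rewrite /q; under [in RHS]eq_bigr do rewrite expr2; rewrite -rademacher2.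
  by apply: eq_bigr => w _; rewrite expr2.
have c1 : \sum_(w : cube s) (1 : R) = 2 ^+ size s by rewrite sumr_const card_cube natrX.
have -> : \sum_w ((rademacher (s := s) x w + 1 * x l) ^+ 4 + (rademacher x w + - 1 * x l) ^+ 4) =
   2 * (\sum_w rademacher (s := s) x w ^+ 4) + 12 * x l ^+ 2 * (2 ^+ size s * q) + 2 * x l ^+ 4 * 2 ^+ size s.
  rewrite -e2 -c1 !mulr_sumr -!big_split /=; apply: eq_bigr => w _; ring.
have p0 : 0 <= 2 ^+ size s * x l ^+ 4 by apply: mulr_ge0; [exact: exprn_ge0 | exact: exprn_even_ge0].
have -> : 3 * (2 * 2 ^+ size s) * (x l ^+ 2 + q) ^+ 2 = 2 * (3 * 2 ^+ size s * q ^+ 2) +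
  12 * x l ^+ 2 * (2 ^+ size s * q) + 6 * (2 ^+ size s * x l ^+ 4) by ring.
move: IH p0; rewrite -/q.
have -> : 2 * x l ^+ 4 * 2 ^+ size s = 2 * (2 ^+ size s * x l ^+ 4) by ring.
move: (\sum_w _) (3 * _ * _) (_ * x l ^+ 4) (12 * _ * _) => a b c d; lra.
Qed.

Definition clip (a : R) : R := Num.max (- 2) (Num.min 2 a).

Lemma clipP a : [\/ 2 <= a /\ clip a = 2, a <= - 2 /\ clip a = - 2 |
  [/\ - 2 <= a, a <= 2 & clip a = a]].
Proof.
rewrite /clip; have [h1|h1] := lerP 2 a.
  by constructor 1; split=> //; rewrite max_r //; lra.
have [h2|h2] := lerP (- 2) a; first by constructor 3; split=> //; exact: ltW.
by constructor 2; split=> //; exact: ltW.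
Qed.

Lemma clip_bound a : `|clip a| <= 2.
Proof.
rewrite ler_norml; case: (clipP a) => [[h ->]|[h ->]|[h1 h2 ->]]; apply/andP; split; lra.
Qed.

Lemma clip_le a : clip a ^+ 2 <= a ^+ 2.
Proof. by case: (clipP a) => [[h ->]|[h ->]|[h1 h2 ->]] //; nra. Qed.

(** Beyond the truncation the excess satisfies [|a| - 2 <= a ^ 2 / 8], which is
    [(|a| - 4) ^ 2 >= 0]. *)
Lemma clip_tail a : (a - clip a) ^+ 2 <= a ^+ 4 / 64.
Proof.
have sq x y : 0 <= x -> x <= y -> x ^+ 2 <= y ^+ 2 by move=> h1 h2; rewrite lerXn2r ?nnegrE // (le_trans h1).
have -> : a ^+ 4 / 64 = (a ^+ 2 / 8) ^+ 2 by field.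
case: (clipP a) => [[h ->]|[h ->]|[h1 h2 ->]].
- by apply: sq; first lra; have := sqr_ge0 (a - 4); rewrite !expr2; lra.
- by rewrite -sqrrN; apply: sq; first lra; have := sqr_ge0 (a + 4); rewrite !expr2; lra.
- by rewrite subrr expr0n /= sqr_ge0.
Qed.

End Rademacher.

Section Grothendieck.

Variables (R : realType) (I J : finType) (M : I -> J -> R) (beta : R).

Hypothesis sign_bound : forall (s : I -> bool) (t : J -> bool),
  \sum_i \sum_j M i j * sgnb R (s i) * sgnb R (t j) <= beta.

Lemma sgnb_abs (x : R) : sgnb R (0 <= x) * x = `|x|.
Proof. by rewrite /sgnb; case: ger0P => _; rewrite ?mul1r ?mulN1r. Qed.

(** A form linear in each argument grows when [a] is replaced by [c] times the signs of the row
    sums, and then [b] by [c] times the signs of the column sums. *)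
Lemma box_bound (c : R) (a : I -> R) (b : J -> R) : 0 <= c ->
  (forall i, `|a i| <= c) -> (forall j, `|b j| <= c) ->
  \sum_i \sum_j M i j * a i * b j <= c ^+ 2 * beta.
Proof.
move=> c0 ha hb.
pose s i := 0 <= \sum_j M i j * b j.
have hs i : sgnb R (s i) * (\sum_j M i j * b j) = `|\sum_j M i j * b j| by exact: sgnb_abs.
pose t j := 0 <= \sum_i M i j * sgnb R (s i).
have ht j : sgnb R (t j) * (\sum_i M i j * sgnb R (s i)) = `|\sum_i M i j * sgnb R (s i)| by exact: sgnb_abs.
have step x y : `|x| <= c -> x * y <= c * `|y|.
  by move=> h; apply: le_trans (ler_norm _) _; rewrite normrM ler_wpM2r.
apply: le_trans (_ : c * \sum_j b j * (\sum_i M i j * sgnb R (s i)) <= _).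
  apply: le_trans (_ : \sum_i c * (sgnb R (s i) * (\sum_j M i j * b j)) <= _).
    apply: ler_sum => i _; rewrite hs; apply: le_trans (step _ _ (ha i)).
    by rewrite mulr_sumr le_eqVlt; apply/orP; left; apply/eqP/eq_bigr => j _; ring.
  rewrite -mulr_sumr ler_wpM2l //.
  under eq_bigr => i _ do rewrite mulr_sumr.
  rewrite exchange_big /= le_eqVlt; apply/orP; left; apply/eqP/eq_bigr => j _.
  by rewrite mulr_sumr; apply: eq_bigr => i _; ring.
rewrite expr2 -mulrA ler_wpM2l //.
apply: le_trans (_ : \sum_j c * (sgnb R (t j) * (\sum_i M i j * sgnb R (s i))) <= _).
  by apply: ler_sum => j _; rewrite ht; exact: step.
rewrite -mulr_sumr ler_wpM2l //; apply: le_trans (sign_bound s t).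
under eq_bigr => j _ do rewrite mulr_sumr.
rewrite exchange_big /= le_eqVlt; apply/orP; left; apply/eqP/eq_bigr => i _.
by apply: eq_bigr => j _; ring.
Qed.

Definition form (L : finType) (x : L -> I -> R) (y : L -> J -> R) : R :=
  \sum_i \sum_j M i j * \sum_l x l i * y l j.

Definition in_ball (K : finType) (L : finType) (x : L -> K -> R) : Prop :=
  forall k, \sum_l x l k ^+ 2 <= 1.

(** The dimension is left free because projection replaces vectors indexed by [L] by vectors indexed
    by [cube]; the same supremum must bound both. *)
Definition form_values : set R :=
  [set v | exists (L : finType) (x : L -> I -> R) (y : L -> J -> R),
     [/\ in_ball x, in_ball y & v = form x y]]%classic.

Lemma form_values_sup : has_sup form_values.
Proof.
split.
  exists 0, unit, (fun _ _ => 0), (fun _ _ => 0); split.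
  - by move=> k; rewrite big1 ?ler01 // => l _; rewrite expr0n.
  - by move=> k; rewrite big1 ?ler01 // => l _; rewrite expr0n.
  - rewrite /form big1 // => i _; rewrite big1 // => j _; by rewrite big1 ?mulr0 // => l _; rewrite mul0r.
exists (\sum_i \sum_j `|M i j|) => v [L [x [y [hx hy ->]]]].
apply: ler_sum => i _; apply: ler_sum => j _.
apply: le_trans (ler_norm _) _; rewrite normrM -[leRHS]mulr1 ler_wpM2l //.
have := cauchy_schwarz (fun l => x l i) (fun l => y l j).
have : (\sum_l x l i ^+ 2) * (\sum_l y l j ^+ 2) <= 1.
  rewrite -[leRHS]mulr1 ler_pM ?hx ?hy // sumr_ge0 // => l _; exact: sqr_ge0.
move=> h1 h2; have := le_trans h2 h1; rewrite -real_normK ?num_real // -[X in _ <= X](expr1n _ 2).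
by rewrite ler_pXn2r ?nnegrE.
Qed.

Lemma form_scale (L : finType) (r : R) (x : L -> I -> R) (y : L -> J -> R) :
  form (fun l i => r * x l i) y = r * form x y.
Proof.
rewrite /form mulr_sumr; apply: eq_bigr => i _; rewrite mulr_sumr; apply: eq_bigr => j _.
rewrite [RHS]mulrCA; congr (_ * _); rewrite mulr_sumr.
by apply: eq_bigr => l _; rewrite mulrA.
Qed.

Lemma form_scaler (L : finType) (r : R) (x : L -> I -> R) (y : L -> J -> R) :
  form x (fun l i => r * y l i) = r * form x y.
Proof.
rewrite /form mulr_sumr; apply: eq_bigr => i _; rewrite mulr_sumr; apply: eq_bigr => j _.
rewrite [RHS]mulrCA; congr (_ * _); rewrite mulr_sumr.
apply: eq_bigr => l _; ring.
Qed.

Lemma form_addl (L : finType) (x x' : L -> I -> R) (y : L -> J -> R) :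
  form (fun l i => x l i + x' l i) y = form x y + form x' y.
Proof.
rewrite /form -big_split; apply: eq_bigr => i _; rewrite -big_split; apply: eq_bigr => j _ /=.
by rewrite -mulrDr -big_split; congr (_ * _); apply: eq_bigr => l _; rewrite mulrDl.
Qed.

Lemma form_addr (L : finType) (x : L -> I -> R) (y y' : L -> J -> R) :
  form x (fun l j => y l j + y' l j) = form x y + form x y'.
Proof.
rewrite /form -big_split; apply: eq_bigr => i _; rewrite -big_split; apply: eq_bigr => j _ /=.
by rewrite -mulrDr -big_split; congr (_ * _); apply: eq_bigr => l _; rewrite mulrDr.
Qed.

(* Replace each vector by its random projection on a Rademacher vector: the
   part truncated at [2] is handled by [box_bound], and the two remainders are
   forms in vectors of small norm, hence absorbed by the supremum. *)
Lemma form_le_self (L : finType) (x : L -> I -> R) (y : L -> J -> R) :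
  in_ball x -> in_ball y -> form x y <= 4 * beta + 11 / 25 * sup form_values.
Proof.
move=> hx hy; set G := sup form_values.
pose s := index_enum L; pose T := cube s; pose N : R := 2 ^+ size s.
have N0 : 0 < N by rewrite exprn_gt0.
pose r := Num.sqrt N^-1; have r2 : r ^+ 2 = N^-1 by rewrite sqr_sqrtr // invr_ge0 ltW.
have rr : r * r = N^-1 by rewrite -expr2.
pose px (w : T) i := rademacher (s := s) (x ^~ i) w.
pose py (w : T) j := rademacher (s := s) (y ^~ j) w.
pose cx w i := clip (px w i); pose cy w j := clip (py w j).
have normp (K : finType) (z : L -> K -> R) : in_ball z -> forall k,
    \sum_(w : T) (r * rademacher (s := s) (z ^~ k) w) ^+ 2 <= 1.
  move=> hz k; under eq_bigr => w _ do rewrite exprMn r2 expr2.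
  rewrite -mulr_sumr rademacher2 mulrA mulVf ?lt0r_neq0 // mul1r.
  by under eq_bigr do rewrite -expr2; exact: hz.
(* By the fourth moment the truncated part has squared norm at most [3 / 64], and [11 / 50] exceeds
   the root of that. *)
have normt (K : finType) (z : L -> K -> R) : in_ball z -> forall k,
    \sum_(w : T) (r * (rademacher (s := s) (z ^~ k) w - clip (rademacher (s := s) (z ^~ k) w)) * (50 / 11)) ^+ 2 <= 1.
  move=> hz k; apply: le_trans (_ : \sum_(w : T) N^-1 * (50 / 11) ^+ 2 / 64 * rademacher (s := s) (z ^~ k) w ^+ 4 <= _).
    apply: ler_sum => w _; rewrite !exprMn r2.
    have := clip_tail (rademacher (s := s) (z ^~ k) w) => h.
    have q0 : 0 <= N^-1 * (50 / 11) ^+ 2 :> R by rewrite mulr_ge0 ?invr_ge0 ?sqr_ge0 // ltW.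
    have := ler_wpM2l q0 h; rewrite -exprVn; set u := (_ - _) ^+ 2; set v := _ ^+ 4; set q := N^-1; lra.
  rewrite -mulr_sumr; have h4 := rademacher4 s (z ^~ k).
  have q0 : 0 <= N^-1 * (50 / 11) ^+ 2 / 64 :> R.
    by rewrite mulr_ge0 ?invr_ge0 ?ler0n // mulr_ge0 ?invr_ge0 ?sqr_ge0 // ltW.
  apply: le_trans (ler_wpM2l q0 h4) _.
  have z1 := hz k; have z0 : 0 <= \sum_l z l k ^+ 2 by apply: sumr_ge0 => l _; exact: sqr_ge0.
  have z2 : (\sum_(l <- s) z l k ^+ 2) ^+ 2 <= 1 by rewrite -(expr1n _ 2) lerXn2r ?nnegrE.
  rewrite -/N.
  have -> : N^-1 * (50 / 11) ^+ 2 / 64 * (3 * N * (\sum_(l <- s) z l k ^+ 2) ^+ 2) =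
     7500 / 7744 * (\sum_(l <- s) z l k ^+ 2) ^+ 2 by field; rewrite lt0r_neq0.
  by move: z2; set u := (\sum_(l <- s) _) ^+ 2; lra.
have e0 : form x y = form (fun w i => r * px w i) (fun w j => r * py w j).
  rewrite form_scale form_scaler mulrA rr /form mulr_sumr; apply: eq_bigr => i _.
  rewrite mulr_sumr; apply: eq_bigr => j _; rewrite mulrCA; congr (_ * _).
  by rewrite /px /py rademacher2 mulrA mulVf ?lt0r_neq0 // mul1r.
have upper (L' : finType) x' y' : @in_ball I L' x' -> @in_ball J L' y' -> form x' y' <= G.
  by move=> h1 h2; apply: sup_upper_bound; [exact: form_values_sup | exists L', x', y'].
have t2 : form (fun w i => r * (px w i - cx w i)) (fun w j => r * py w j) <= 11 / 50 * G.
  have -> : form (fun w i => r * (px w i - cx w i)) (fun w j => r * py w j) =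
      11 / 50 * form (fun w i => 50 / 11 * (r * (px w i - cx w i))) (fun w j => r * py w j).
    by rewrite (form_scale (50 / 11)) mulrA (_ : 11 / 50 * (50 / 11) = 1) ?mul1r //; field.
  rewrite ler_wpM2l ?divr_ge0 //; apply: upper; last exact: normp.
  move=> i; apply: le_trans (normt I x hx i); apply: ler_sum => w _.
  by rewrite mulrC.
have t3 : form (fun w i => r * cx w i) (fun w j => r * (py w j - cy w j)) <= 11 / 50 * G.
  have -> : form (fun w i => r * cx w i) (fun w j => r * (py w j - cy w j)) =
      11 / 50 * form (fun w i => r * cx w i) (fun w j => 50 / 11 * (r * (py w j - cy w j))).
    by rewrite (form_scaler (50 / 11)) mulrA (_ : 11 / 50 * (50 / 11) = 1) ?mul1r //; field.
  rewrite ler_wpM2l ?divr_ge0 //; apply: upper.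
    move=> i; apply: le_trans (normp I x hx i); apply: ler_sum => w _.
    by rewrite !exprMn ler_wpM2l ?sqr_ge0 // clip_le.
  move=> j; apply: le_trans (normt J y hy j); apply: ler_sum => w _.
  by rewrite mulrC.
have t1 : form (fun w i => r * cx w i) (fun w j => r * cy w j) <= 4 * beta.
  have -> : form (fun w i => r * cx w i) (fun w j => r * cy w j) =
     N^-1 * \sum_(w : T) \sum_i \sum_j M i j * cx w i * cy w j.
    rewrite form_scale form_scaler mulrA rr; congr (_ * _).
    rewrite /form; under eq_bigr => i _ do under eq_bigr => j _ do rewrite mulr_sumr.
    under eq_bigr => i _ do rewrite exchange_big /=.
    rewrite exchange_big /=; apply: eq_bigr => w _; apply: eq_bigr => i _; apply: eq_bigr => j _.
    by rewrite mulrA.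
  rewrite mulrC ler_pdivrMr //.
  have -> : 4 * beta * N = \sum_(w : T) 4 * beta.
    by rewrite sumr_const card_cube -[RHS]mulr_natr natrX.
  apply: ler_sum => w _; have -> : 4 * beta = 2 ^+ 2 * beta by ring.
  by apply: box_bound => // [i|j]; exact: clip_bound.
rewrite e0.
have -> : form (fun w i => r * px w i) (fun w j => r * py w j) =
  form (fun w i => r * cx w i) (fun w j => r * cy w j) +
  form (fun w i => r * cx w i) (fun w j => r * (py w j - cy w j)) +
  form (fun w i => r * (px w i - cx w i)) (fun w j => r * py w j).
  rewrite -form_addr.
  transitivity (form (fun w i => r * cx w i) (fun w j => r * py w j) +
      form (fun w i => r * (px w i - cx w i)) (fun w j => r * py w j)).
    rewrite -form_addl /form; apply: eq_bigr => i _; apply: eq_bigr => j _.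
    by congr (_ * _); apply: eq_bigr => w _; ring.
  congr (_ + _); rewrite /form; apply: eq_bigr => i _; apply: eq_bigr => j _.
  by congr (_ * _); apply: eq_bigr => w _; ring.
lra.
Qed.

(** The supremum is finite, so [G <= 4 beta + 11/25 G] can be solved: [G <= 50/7 beta], rounded up
    to 8. *)
Lemma grothendieck (L : finType) (x : L -> I -> R) (y : L -> J -> R) :
  in_ball x -> in_ball y -> form x y <= 8 * beta.
Proof.
move=> hx hy; set G := sup form_values.
(* Flipping all signs on one side negates the form, so [beta] bounds two opposite numbers. *)
have beta0 : 0 <= 2 * beta.
  have h1 := sign_bound (fun _ => true) (fun _ => true).
  have h2 := sign_bound (fun _ => false) (fun _ => true).
  have : \sum_i \sum_j M i j * sgnb R true * sgnb R true + \sum_i \sum_j M i j * sgnb R false * sgnb R true = 0.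
    rewrite -big_split big1 // => i _; rewrite -big_split big1 // => j _ /=; ring.
  lra.
have hG : G <= 4 * beta + 11 / 25 * G.
  apply: ge_sup; first by have [] := form_values_sup.
  by move=> v [L' [x' [y' [h1 h2 ->]]]]; exact: form_le_self.
have := form_le_self hx hy; rewrite -/G; lra.
Qed.

End Grothendieck.

(** * Recovery from a pseudorandom bipartite graph *)

Lemma gram_quad (R : rcfType) n (X : 'M[R]_n) (a b c : R) i j k : gram X ->
  0 <= a ^+ 2 * X i i + b ^+ 2 * X j j + c ^+ 2 * X k k +
    2 * a * b * X i j + 2 * a * c * X i k + 2 * b * c * X j k.
Proof.
case=> L [v hv]; apply: le_trans (_ : 0 <= \sum_l (a * v l i + b * v l j + c * v l k) ^+ 2) _.
  by apply: sumr_ge0 => l _; exact: sqr_ge0.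
rewrite !hv !mulr_sumr -!big_split /= le_eqVlt; apply/orP; left; apply/eqP.
by apply: eq_bigr => l _; ring.
Qed.

Section Deterministic.

Variables (R : realType) (n : nat) (E F : edge_set n) (S : {set 'I_n}) (L : nat).

Local Notation nu := (n%:R : R).
Local Notation k := (#|S|).
Local Notation kR := (#|S|%:R : R).

(** A random sign of mean zero that equals 1 on the non-edges, where [X] may be large; on edges [X]
    is negligible and the sign hardly matters. *)
Definition cross_sign (i j : 'I_n) : R := if is_edge F i j then - 1 else 1.

Definition small_cut_norm : Prop := forall s t : 'I_n -> bool,
  \sum_(i in S) \sum_(j in ~: S) cross_sign i j * sgnb R (s i) * sgnb R (t j)
    <= 4 * nu * Num.sqrt kR.

Definition small_nondegrees : Prop := forall v, v \in ~: S ->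
  (5 * #|[set w in S | ~~ is_edge F v w]| <= 3 * k)%N.

Definition no_hole : Prop := forall A B : {set 'I_n}, A \subset S -> B \subset ~: S ->
  #|A| = L -> #|B| = L -> exists2 i, i \in A & exists2 j, j \in B & is_edge F i j.

Hypotheses (n_ge : (1000 <= n)%N) (E_graph : is_graph E).
Hypotheses (FE : F \subset E) (S_indep : forall i j, i \in S -> j \in S -> ~~ is_edge E i j).
Hypothesis k_big : 10 ^+ 9 * (nu * Num.sqrt kR) <= kR ^+ 2.
Hypotheses (cut : small_cut_norm) (nondeg : small_nondegrees).

Let n_ge10 : (10 <= n)%N. Proof. exact: leq_trans n_ge. Qed.
Let nu_ge : 1000 <= nu. Proof. by rewrite (ler_nat _ 1000). Qed.

Let X : 'M[R]_n := exact_iter R E (n ^ 36).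

Hypothesis k_gt0 : (0 < k)%N.

Let sqk_ge1 : 1 <= Num.sqrt kR.
Proof. by have := @ler_wsqrtr R 1 kR; rewrite sqrtr1 ler1n; apply. Qed.

Let k_sq : 10 ^+ 12 <= kR ^+ 2.
Proof.
apply: le_trans k_big; have := sqk_ge1; have := nu_ge; move: nu (Num.sqrt kR) => x y; nra.
Qed.

Let k_ge : 1000 <= kR.
Proof.
rewrite leNgt; apply/negP => h; have := k_sq; have : 0 <= kR by rewrite ler0n.
by move: (kR) h => x; nra.
Qed.

Let eta : R := 3 / nu ^+ 3.

Let eta_bounds : 0 <= eta <= 1 / 10 ^+ 6.
Proof.
rewrite /eta divr_ge0 ?exprn_ge0 ?ler0n //=.
have h := nu_ge; have h3 : 10 ^+ 9 <= nu ^+ 3.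
  have -> : 10 ^+ 9 = (10 ^+ 3) ^+ 3 :> R by rewrite -exprM.
  rewrite lerXn2r ?nnegrE ?exprn_ge0 ?ler0n //; apply: le_trans h; lra.
rewrite ler_pdivrMr; last by apply: lt_le_trans h3; rewrite exprn_gt0.
by lra.
Qed.

(** On edges [X] is at most [eta], so it may be replaced by its product with [cross_sign], to which
    Grothendieck's inequality applies. Vectors outside [T] are set to 0, so one cut-norm bound
    serves every [T]; [64] is [2 * 8 * 4]. *)
Lemma cluster_row_sum (T : {set 'I_n}) : T \subset ~: S ->
  \sum_(i in S) \sum_(j in T) X i j <= 64 * (nu * Num.sqrt kR) + 1.
Proof.
move=> TS; have /andP[e0 e1] := eta_bounds.
have [K [v hv]] := final_gram R E n_ge10; rewrite -/X in hv.
pose M i j : R := if (i \in S) && (j \in ~: S) then cross_sign i j else 0.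
have sb s t : \sum_i \sum_j M i j * sgnb R (s i) * sgnb R (t j) <= 4 * nu * Num.sqrt kR.
  apply: le_trans (cut s t); rewrite [leRHS]big_mkcond /= le_eqVlt; apply/orP; left; apply/eqP.
  apply: eq_bigr => i _; case: ifP => Si.
    rewrite [RHS]big_mkcond /=; apply: eq_bigr => j _; rewrite /M Si /=.
    by case: ifP => // _; rewrite !mul0r.
  by rewrite big1 // => j _; rewrite /M Si /= !mul0r.
(* The vectors may be slightly longer than 1; this factor brings them into the unit ball at the
   price of a factor 2. *)
pose r : R := Num.sqrt (1 / 2).
have r2 : r ^+ 2 = 1 / 2 by rewrite sqr_sqrtr // divr_ge0.
have vb i : \sum_l (r * v l i) ^+ 2 <= 1.
  under eq_bigr do rewrite exprMn r2 expr2; rewrite -mulr_sumr -hv.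
  have := final_diag R n_ge10 E_graph i; rewrite -/X -/eta; lra.
have yb : in_ball (fun l j => if j \in T then r * v l j else 0).
  move=> j; have [Tj|Tj] := boolP (j \in T); first exact: vb.
  by rewrite big1 ?ler01 // => l _; rewrite expr0n.
have h := grothendieck sb (vb : in_ball (fun l i => r * v l i)) yb.
have e : form M (fun l i => r * v l i) (fun l j => if j \in T then r * v l j else 0) =
    1 / 2 * \sum_(i in S) \sum_(j in T) cross_sign i j * X i j.
  rewrite /form mulr_sumr [RHS]big_mkcond /=; apply: eq_bigr => i _; case: ifP => Si; last first.
    by rewrite big1 // => j _; rewrite /M Si /= mul0r.
  rewrite mulr_sumr [RHS]big_mkcond /=; apply: eq_bigr => j _; case: ifP => Tj; last first.
    by rewrite big1 ?mulr0 // => l _; rewrite mulr0.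
  rewrite /M Si (fintype.subsetP TS _ Tj) /= hv mulrCA; congr (_ * _); rewrite mulr_sumr.
  by apply: eq_bigr => l _; rewrite -r2; ring.
have d : \sum_(i in S) \sum_(j in T) X i j <=
    \sum_(i in S) \sum_(j in T) cross_sign i j * X i j + \sum_(i < n) \sum_(j < n) 2 * eta.
  have -> : \sum_(i < n) \sum_(j < n) 2 * eta = \sum_(i in S) \sum_(j in T) 2 * eta +
      (\sum_(i in S) \sum_(j in ~: T) 2 * eta + \sum_(i in ~: S) \sum_(j < n) 2 * eta).
    rewrite addrA -big_split /= [LHS](bigID (mem S)) /=; congr (_ + _); last first.
      by apply: eq_bigl => i; rewrite finset.in_setC.
    apply: eq_bigr => i _; rewrite [LHS](bigID (mem T)) /=; congr (_ + _).
    by apply: eq_bigl => j; rewrite finset.in_setC.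
  have p1 : 0 <= \sum_(i in S) \sum_(j in ~: T) 2 * eta.
    by apply: sumr_ge0 => i _; apply: sumr_ge0 => j _; rewrite mulr_ge0.
  have p2 : 0 <= \sum_(i in ~: S) \sum_(j < n) 2 * eta.
    by apply: sumr_ge0 => i _; apply: sumr_ge0 => j _; rewrite mulr_ge0.
  rewrite addrA; apply: le_trans (_ : \sum_(i in S) \sum_(j in T) cross_sign i j * X i j + \sum_(i in S) \sum_(j in T) 2 * eta <= _); last by rewrite -addrA lerD2l lerDl addr_ge0.
  rewrite -big_split /=; apply: ler_sum => i Si; rewrite -big_split /=; apply: ler_sum => j Tj.
  rewrite /cross_sign; case: ifP => Fij; last by rewrite mul1r lerDl mulr_ge0.
  have Eij : is_edge E i j by apply: (fintype.subsetP FE).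
  have := final_edge R n_ge10 E_graph Eij; rewrite -/X -/eta ler_norml => /andP[_]; lra.
have n2 : \sum_(i < n) \sum_(j < n) 2 * eta <= 1.
  rewrite !sum_const_ord /eta.
  have -> : nu * (nu * (2 * (3 / nu ^+ 3))) = 6 / nu.
    by field; rewrite pnatr_eq0 -lt0n (leq_trans _ n_ge).
  by have h' := nu_ge; rewrite ler_pdivrMr; lra.
move: h; rewrite e; lra.
Qed.

Let Xle i j : X i j <= 1 + eta.
Proof.
have di := final_diag R n_ge10 E_graph i; have dj := final_diag R n_ge10 E_graph j.
have := gram_quad 1 (- 1) 0 i j i (final_gram R E n_ge10).
rewrite -/X -/eta in di dj *; lra.
Qed.

Definition row_sum (u : 'I_n) : R := \sum_(j in S) X u j.

Definition typical (u : 'I_n) : bool := (1 + eta) * kR - row_sum u <= kR / 1000.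

(** Markov's inequality: by [final_cluster] and [cluster_row_sum], the nonnegative row deficits add
    up to at most [k ^ 2 / 10 ^ 5]. *)
Lemma few_atypical : (100 * #|[set u in S | ~~ typical u]| <= k)%N.
Proof.
have /andP[e0 e1] := eta_bounds.
have tot := final_cluster R n_ge10 E_graph S_indep; rewrite -/X in tot.
have cr := cluster_row_sum (subxx (~: S)).
set s := nu * Num.sqrt kR in cr.
have rows : \sum_(u in S) ((1 + eta) * kR - row_sum u) <= kR ^+ 2 / 10 ^+ 5.
  rewrite sumrB sumr_const -[(_ * _) *+ k]mulr_natr -mulrA -expr2.
  have h12 := k_sq; have kb := k_big.
  have h : eta * kR ^+ 2 <= 1 / 10 ^+ 6 * kR ^+ 2 by rewrite ler_wpM2r // sqr_ge0.
  move: tot cr h h12 kb; rewrite /row_sum -/s; set q := kR ^+ 2.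
  set a := \sum_(i in S) _; set b := \sum_(i in S) _; lra.
have nn u : 0 <= (1 + eta) * kR - row_sum u.
  rewrite subr_ge0 mulrC mulr_natl -sumr_const; apply: ler_sum => j _; exact: Xle.
have cnt : #|[set u in S | ~~ typical u]|%:R * (kR / 1000) <= \sum_(u in S) ((1 + eta) * kR - row_sum u).
  rewrite mulr_natl -sumr_const [leRHS](bigID typical) /= -[leLHS]add0r; apply: lerD.
    by apply: sumr_ge0 => u _.
  rewrite [leLHS](eq_bigl (fun u => (u \in S) && ~~ typical u)); last by move=> u; rewrite inE.
  by apply: ler_sum => u /andP[_]; rewrite /typical -ltNge => /ltW.
have := le_trans cnt rows; have kp : 0 < kR by rewrite ltr0n.
have -> : kR ^+ 2 / 10 ^+ 5 = (kR / 100) * (kR / 1000) by field.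
have kp' : 0 < kR / 1000 by lra.
rewrite ler_pM2r // => h.
by rewrite -(ler_nat R) natrM; lra.
Qed.

Let rounding_small : (nu ^+ 16)^-1 <= 1 / 1000.
Proof.
have h := nu_ge; have p : 0 < nu ^+ 16 by rewrite exprn_gt0 // ltr0n (leq_trans _ n_ge).
have h16 : nu <= nu ^+ 16 by rewrite -[leLHS]expr1; apply: ler_weXn2l => //; lra.
by rewrite -div1r ler_pdivrMr //; lra.
Qed.

Let ballE u j : (j \in ball (fw_iter E (mono_val n rounds_m)) u) =
  (1 / 2 <= (fw_iter E (n ^ 36) u j)%:~R / ((n ^ 36).+1%:R * nu ^+ 16)).
Proof.
have -> : mono_val n rounds_m = (n ^ 36)%N by rewrite /mono_val mul1n.
rewrite inE /threshold -(ler_int R) !intrM -!pmulrn.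
have -> : (mono_val n rounds_m).+1 = (n ^ 36).+1 by rewrite /mono_val mul1n.
have -> : (mono_val n scale_m)%:R = nu ^+ 16 by rewrite /mono_val mul1n natrX.
have p : 0 < (n ^ 36).+1%:R * nu ^+ 16 :> R.
  by rewrite mulr_gt0 ?ltr0n // exprn_gt0 // ltr0n (leq_trans _ n_ge).
rewrite ler_pdivlMr //; move: (_ * _ : R) (_%:~R : R) => a b.
by apply/idP/idP => h; lra.
Qed.

Lemma ball_mem u j : j \in ball (fw_iter E (mono_val n rounds_m)) u -> 499 / 1000 <= X u j.
Proof.
rewrite ballE; have := final_rounding R n_ge10 E_graph u j; have := rounding_small.
rewrite -/X; move: (_%:~R / _) (X u j) (_ ^-1) => a b c h1 + h2.
by rewrite ler_norml => /andP[_ h3]; lra.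
Qed.

Lemma ball_notin u j : j \notin ball (fw_iter E (mono_val n rounds_m)) u -> X u j <= 501 / 1000.
Proof.
rewrite ballE -ltNge; have := final_rounding R n_ge10 E_graph u j; have := rounding_small.
rewrite -/X; move: (_%:~R / _) (X u j) (_ ^-1) => a b c h1 + h2.
by rewrite ler_norml => /andP[h3 _]; lra.
Qed.

(** Each vertex of [S] outside the ball contributes nearly one half to the row deficit of [u]. *)
Lemma ball_missing u : u \in S -> typical u ->
  (100 * #|S :\: ball (fw_iter E (mono_val n rounds_m)) u| <= k)%N.
Proof.
move=> Su; rewrite /typical => h; set B := ball _ _; have /andP[e0 e1] := eta_bounds.
have : #|S :\: B|%:R * (49 / 100) <= (1 + eta) * kR - row_sum u.
  have -> : (1 + eta) * kR - row_sum u = \sum_(j in S) (1 + eta - X u j).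
    by rewrite sumrB sumr_const mulr_natr.
  rewrite mulr_natl -sumr_const [leRHS](bigID (mem B)) /= -[leLHS]add0r; apply: lerD.
    by apply: sumr_ge0 => j _; rewrite subr_ge0 Xle.
  rewrite [leLHS](eq_bigl (fun j => (j \in S) && (j \notin B))); last by move=> j; rewrite inE andbC.
  by apply: ler_sum => j /andP[_] /ball_notin h'; lra.
move=> h1; rewrite -(ler_nat R) natrM; have := k_ge; move: (le_trans h1 h).
by move: (#|_ :\: _|%:R : R) => x; lra.
Qed.

(** An outside vertex [j] in the ball correlates with [u], hence with most of [S], whose vectors are
    close to that of [u]. So its column sum over [S] is at least [4/10 k], and the total over such
    columns is bounded by [cluster_row_sum]. *)
Lemma ball_extra u : u \in S -> typical u ->
  (100 * #|ball (fw_iter E (mono_val n rounds_m)) u :\: S| <= k)%N.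
Proof.
move=> Su; rewrite /typical => h; set B := ball _ _; have /andP[e0 e1] := eta_bounds.
have dd i := final_diag R n_ge10 E_graph i; rewrite -/X -/eta in dd.
have TS : B :\: S \subset ~: S by apply/fintype.subsetP => j; rewrite !inE => /andP[].
have := cluster_row_sum TS; rewrite exchange_big /=.
set s := nu * Num.sqrt kR => up.
have low j : j \in B :\: S -> 4 / 10 * kR <= \sum_(i in S) X i j.
  rewrite inE => /andP[_ /ball_mem Xj].
  have sq i : X u j - 20 * (1 + eta - X u i) - (1 + eta) / 40 <= X i j.
    have := gram_quad 1 (- 1) (1 / 20) i u j (final_gram R E n_ge10); rewrite -/X.
    have := dd i; have := dd u; have := dd j.
    have -> : X i u = X u i by exact: gram_sym (final_gram R E n_ge10) i u.
    by lra.
  apply: le_trans (_ : \sum_(i in S) (X u j - 20 * (1 + eta - X u i) - (1 + eta) / 40) <= _); last first.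
    by apply: ler_sum => i _; exact: sq.
  have C (x : R) : \sum_(i in S) x = x * kR by rewrite sumr_const mulr_natr.
  rewrite !sumrB -mulr_sumr sumrB !C -/(row_sum u).
  have := Xj; have := k_ge => kg xj; have : 499 / 1000 * kR <= X u j * kR by rewrite ler_wpM2r // ler0n.
  have : eta * kR <= 1 / 10 ^+ 6 * kR by rewrite ler_wpM2r // ler0n.
  by lra.
have : #|B :\: S|%:R * (4 / 10 * kR) <= 64 * s + 1.
  by apply: le_trans up; rewrite mulr_natl -sumr_const; apply: ler_sum.
have := k_big; have := k_sq; rewrite -/s => q1 q2 q3.
have kp : 0 < kR by rewrite ltr0n.
have : #|B :\: S|%:R * (4 / 10 * kR) <= (1 / 10 ^+ 3 * kR) * (4 / 10 * kR).
  by apply: le_trans q3 _; rewrite (_ : 1 / 10 ^+ 3 * kR * _ = 4 / 10 ^+ 4 * kR ^+ 2); [lra | field].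
rewrite ler_pM2r ?mulr_gt0 ?divr_gt0 // => h5.
by rewrite -(ler_nat R) natrM; move: h5; move: (#|_ :\: _|%:R : R) => x; lra.
Qed.

End Deterministic.

Lemma subset_card_le_exists (T : finType) (A : {set T}) m : (m <= #|A|)%N ->
  exists B : {set T}, B \subset A /\ #|B| = m.
Proof.
move=> mA; exists [set x in take m (enum A)]; split.
  by apply/fintype.subsetP => x; rewrite inE => /mem_take; rewrite mem_enum.
rewrite cardsE (card_uniqP (take_uniq _ (enum_uniq _))) size_takel // -cardE //.
Qed.

(** * Combinatorics of the selection *)

Section Selection.

Variables (n : nat) (E F : edge_set n) (S : {set 'I_n}) (L : nat).
Variable Y : 'M[int]_n.
Local Notation k := (#|S|).

Hypotheses (FE : F \subset E) (S_indep : forall i j, i \in S -> j \in S -> ~~ is_edge E i j).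
Hypotheses (nondeg : small_nondegrees F S) (hole : no_hole F S L).
Hypotheses (k_gt0 : (0 < k)%N) (n_gt0 : (0 < n)%N) (k_cube : (n ^ 2 <= k ^ 3)%N).
Hypothesis L_small : ((4 * L) ^ 3 <= n ^ 2)%N.
Variable typical : pred 'I_n.
Hypothesis few_atypical : (100 * #|[set u in S | ~~ typical u]| <= k)%N.
Hypothesis ball_missing : forall u, u \in S -> typical u -> (100 * #|S :\: ball Y u| <= k)%N.
Hypothesis ball_extra : forall u, u \in S -> typical u -> (100 * #|ball Y u :\: S| <= k)%N.

Let edge_le v w : ~~ is_edge E v w -> ~~ is_edge F v w.
Proof. by apply: contraNN; exact: (fintype.subsetP FE). Qed.

(** Ball and [S] differ by at most [k / 100] each way. An outside vertex has at most
    [(3/5 + 1/100) k] votes, below three quarters of the ball; a vertex of [S] has at least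
    [99/100 k], above it. *)
Lemma candidate_typical u : u \in S -> typical u -> candidate E Y u = S.
Proof.
move=> Su tu; have m := ball_missing Su tu; have x := ball_extra Su tu.
have s1 := cardsID (ball Y u) S; have s2 := cardsID S (ball Y u).
rewrite finset.setIC in s2; apply/setP => v; rewrite inE; apply/idP/idP => [|Sv].
  apply: contraTT => Sv; have := nondeg (v := v); rewrite inE Sv => /(_ isT) d.
  have sub : coneighbors E (ball Y u) v \subset [set w in S | ~~ is_edge F v w] :|: (ball Y u :\: S).
    apply/fintype.subsetP => w; rewrite !inE => /andP[-> /edge_le ->].
    by rewrite !andbT orbN.
  have := leq_trans (subset_leq_card sub) (leq_card_setU _ _); lia.
have sub : S :&: ball Y u \subset coneighbors E (ball Y u) v.
  by apply/fintype.subsetP => w; rewrite !inE => /andP[Sw ->]; exact: S_indep.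
have := subset_leq_card sub; lia.
Qed.

(** More than half of [S] yields the candidate [S], whence the factor [8 = 2 ^ 3] in the popularity
    test. *)
Lemma accepted_typical u : u \in S -> typical u -> accepted E Y u.
Proof.
move=> Su tu; rewrite /accepted /popularity candidate_typical // k_cube /=.
apply/and3P; split.
- by apply/forall_inP => v Sv; apply/forall_inP => w Sw; exact: S_indep.
- apply/forall_inP => v Sv; have := nondeg Sv; have : coneighbors E S v \subset [set w in S | ~~ is_edge F v w].
    by apply/fintype.subsetP => w; rewrite !inE => /andP[-> /edge_le].
  by move/subset_leq_card; lia.
- apply: leq_trans k_cube _; rewrite (_ : 8 = 2 ^ 3)%N // -expnMn leq_exp2r //.
  have sub : S \subset [set u in S | ~~ typical u] :|: [set i | candidate E Y i == S].
    apply/fintype.subsetP => i Si; rewrite !inE Si /=.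
    by case ti: (typical i) => //=; rewrite candidate_typical // eqxx.
  have := leq_trans (subset_leq_card sub) (leq_card_setU _ _); have := few_atypical.
  by set a := #|_|; move=> h1 h2; apply: leq_trans (_ : 2 * (k - a) <= _)%N; [lia | rewrite leq_mul2l leq_subLR].
Qed.

Lemma typical_exists : exists2 u, u \in S & typical u.
Proof.
have [/existsP[u /andP[]]|/existsPn h] := boolP [exists u, (u \in S) && typical u]; first by exists u.
have : S \subset [set u in S | ~~ typical u].
  by apply/fintype.subsetP => i Si; have := h i; rewrite !inE Si.
by move/subset_leq_card; have := few_atypical; have := k_gt0; lia.
Qed.

(** Suppose an accepted [Q] meets [S] in at least [L] vertices. Being independent and without holes,
    it has fewer than [L] vertices outside [S]. If [Q] contains [S], an extra vertex would be
    non-adjacent to all of [S]. Otherwise a vertex of [S] missing from [Q] is non-adjacent to the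
    whole of [Q :&: S], so isolation makes this at most three quarters of [Q]; then [#|Q| < 4 * L],
    too small to be accepted. *)
Lemma accepted_wrong i : accepted E Y i -> candidate E Y i != S ->
  (#|candidate E Y i :&: S| < L)%N.
Proof.
case/and4P => + + + _; move: (candidate E Y i) => Q /forall_inP ind /forall_inP iso big QS.
rewrite ltnNge; apply/negP => AL.
have P_lt : (#|Q :\: S| < L)%N.
  rewrite ltnNge; apply/negP => PL.
  have [A [sA cA]] := subset_card_le_exists AL. have [P [sP cP]] := subset_card_le_exists PL.
  have [||a Aa [p Pp]] := @hole A P _ _ cA cP.
  - exact: fintype.subset_trans sA (finset.subsetIr _ _).
  - by apply: fintype.subset_trans sP _; apply/fintype.subsetP => x; rewrite !inE => /andP[].
  have := fintype.subsetP sA _ Aa; have := fintype.subsetP sP _ Pp.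
  rewrite !inE => /andP[_ Qp] /andP[Qa _].
  by move=> ap; have /forall_inP/(_ p Qp)/edge_le := ind a Qa; rewrite ap.
have [SQ|/subsetPn[s Ss Qs]] := boolP (S \subset Q).
  have [p] : exists p, p \in Q :\: S.
    apply/set0Pn; apply: contraNneq QS => /eqP; rewrite finset.setD_eq0 => QS.
    by rewrite finset.eqEsubset QS.
  rewrite inE => /andP[Sp Qp].
  have := @nondeg p; rewrite inE Sp => /(_ isT).
  rewrite (_ : [set w in S | _] = S); first by have := k_gt0; lia.
  apply/setP => w; rewrite inE; case Sw: (w \in S) => //=.
  by apply: edge_le; have /forall_inP := ind p Qp; apply; exact: (fintype.subsetP SQ).
have := iso s; rewrite inE Qs => /(_ isT).
have : Q :&: S \subset coneighbors E Q s.
  by apply/fintype.subsetP => w; rewrite !inE => /andP[-> Sw]; exact: S_indep.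
move/subset_leq_card; have := cardsID S Q => e h1 h2.
have h3 : (#|Q| < 4 * L)%N by lia.
have : (#|Q| ^ 3 < (4 * L) ^ 3)%N by rewrite ltn_exp2r.
by rewrite ltnNge (leq_trans L_small big).
Qed.

(** As [S] itself is accepted, the output can only be too large, so a bad [u] lies in some wrong
    accepted set. Popularity classes of distinct sets are disjoint, so there are at most [n / p0]
    wrong sets, each meeting [S] in fewer than [L] vertices. Cubes avoid fractional powers. *)
Lemma few_bad : (#|[set u in S | selection E Y u != S]| ^ 3 <= 8 * n * L ^ 3)%N.
Proof.
pose wrong := [set candidate E Y i | i in [set i | accepted E Y i && (candidate E Y i != S)]].
have [u0 Su0 tu0] := typical_exists.
have sub : [set u in S | selection E Y u != S] \subset \bigcup_(Q in wrong) (Q :&: S).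
  apply/fintype.subsetP => u; rewrite inE => /andP[Su bad].
  have : ~~ (selection E Y u \subset S).
    apply: contraNN bad => h; rewrite finset.eqEsubset h /=.
    by rewrite -{1}(candidate_typical Su0 tu0); apply: finset.bigcup_sup; rewrite accepted_typical // candidate_typical.
  case/subsetPn => v /finset.bigcupP[i /andP[ai ui] vi] Sv; apply/finset.bigcupP.
  exists (candidate E Y i); last by rewrite inE ui.
  apply: imset_f; rewrite inE ai; apply: contraNneq Sv => <-; exact: vi.
have c1 : (#|[set u in S | selection E Y u != S]| <= #|wrong| * L)%N.
  apply: leq_trans (subset_leq_card sub) _; apply: leq_trans (_ : \sum_(Q in wrong) #|Q :&: S| <= _)%N.
    elim/big_rec2: _ => [|Q m A _ h]; first by rewrite cards0.
    by apply: leq_trans (leq_card_setU _ _) _; rewrite leq_add2l.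
  rewrite -sum_nat_const; apply: leq_sum => Q /imsetP[i]; rewrite inE => /andP[ai wi] ->.
  exact/ltnW/accepted_wrong.
(* [p0] is the least popularity that passes the test, an integer stand-in for [n ^ (2/3) / 2]. *)
have [p0 hp0 minp] : exists2 p, (n ^ 2 <= 8 * p ^ 3)%N & forall q, (n ^ 2 <= 8 * q ^ 3)%N -> (p <= q)%N.
  have ex : exists p, (n ^ 2 <= 8 * p ^ 3)%N by exists k; apply: leq_trans k_cube _; rewrite leq_pmull.
  by exists (ex_minn ex); case: ex_minnP.
have c2 : (#|wrong| * p0 <= n)%N.
  rewrite -sum_nat_const; apply: leq_trans (_ : \sum_(Q in wrong) #|[set i | candidate E Y i == Q]| <= _)%N.
    by apply: leq_sum => Q /imsetP[i]; rewrite inE => /andP[/and4P[_ _ _ h] _] ->; exact: minp.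
  under eq_bigr do rewrite -sum1_card big_mkcond /=.
  rewrite exchange_big /= -[leqRHS]card_ord -sum1_card; apply: leq_sum => i _.
  rewrite -big_mkcondr /= sum1_card; apply: leq_trans (_ : #|[set candidate E Y i]| <= _)%N.
    by apply: subset_leq_card; apply/fintype.subsetP => Q; rewrite !inE => /andP[_]; rewrite inE eq_sym.
  by rewrite cards1.
have c3 : (#|wrong| ^ 3 <= 8 * n)%N.
  rewrite -(@leq_pmul2r (n ^ 2)) ?expn_gt0 ?n_gt0 //.
  apply: leq_trans (_ : #|wrong| ^ 3 * (8 * p0 ^ 3) <= _)%N; first by rewrite leq_mul2l hp0 orbT.
  by rewrite mulnCA -expnMn -mulnA -expnS leq_mul2l leq_exp2r.
apply: leq_trans (_ : (#|wrong| * L) ^ 3 <= _)%N; first by rewrite leq_exp2r.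
by rewrite expnMn leq_mul2r c3 orbT.
Qed.

End Selection.

(** * The random bipartite graph *)

Lemma sum_subset_prod (R : comNzRingType) (T : finType) (A : {set T}) (f g : T -> R) :
  \sum_(B : {set T} | B \subset A) \prod_(e in A) (if e \in B then f e else g e) =
    \prod_(e in A) (f e + g e).
Proof.
rewrite [RHS]big_mkcond /=.
have -> : \prod_e (if e \in A then f e + g e else 1) =
    \prod_e ((if e \in A then f e else 0) + (if e \in A then g e else 1)).
  by apply: eq_bigr => e _; case: ifP => // _; rewrite add0r.
rewrite bigA_distr big_mkcond /=; apply: eq_bigr => B _; case: ifPn => [BA|/subsetPn[e eB eA]].
  rewrite big_mkcond /=; apply: eq_bigr => e _; case: (boolP (e \in B)) => [/(fintype.subsetP BA) ->|] //.
by rewrite (bigD1 e) //= eB (negPf eA) mul0r.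
Qed.

(** Only [1 + x <= expR x] is used: it gives [cosh x <= 1 / (1 - x ^ 2)], and
    [(1 + 2 x ^ 2) (1 - x ^ 2) >= 1] for small [x]. *)
Lemma cosh_le_expR (R : realType) (x : R) : `|x| <= 1 / 2 ->
  (expR x + expR (- x)) / 2 <= expR (2 * x ^+ 2).
Proof.
rewrite ler_norml => /andP[h1 h2].
have a := expR_ge1Dx x; have b := expR_ge1Dx (- x).
have ab : expR x * expR (- x) = 1 by rewrite -expRD subrr expR0.
have c := expR_ge1Dx (2 * x ^+ 2).
have x2 : x ^+ 2 <= 1 / 4 by rewrite expr2; nra.
have x0 := sqr_ge0 x.
have p : expR x * (1 - x) <= 1 by rewrite -[leRHS]ab ler_wpM2l ?expR_ge0.
have q : expR (- x) * (1 + x) <= 1 by rewrite -[leRHS]ab mulrC ler_wpM2r ?expR_ge0.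
have s : (expR x + expR (- x)) / 2 * (1 - x ^+ 2) <= 1.
  have -> : (expR x + expR (- x)) / 2 * (1 - x ^+ 2) =
      (expR x * (1 - x) * (1 + x) + expR (- x) * (1 + x) * (1 - x)) / 2 by field.
  have p' : expR x * (1 - x) * (1 + x) <= 1 * (1 + x) by rewrite ler_wpM2r //; lra.
  have q' : expR (- x) * (1 + x) * (1 - x) <= 1 * (1 - x) by rewrite ler_wpM2r //; lra.
  by lra.
have t : 1 <= expR (2 * x ^+ 2) * (1 - x ^+ 2).
  apply: le_trans (_ : (1 + 2 * x ^+ 2) * (1 - x ^+ 2) <= _); last by rewrite ler_wpM2r //; lra.
  by move: (x ^+ 2) x0 x2 => y; nra.
by rewrite -(@ler_pM2r _ (1 - x ^+ 2)); [exact: le_trans s t | lra].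
Qed.

Section Probability.

Variables (R : realType) (n : nat) (S : {set 'I_n}).

Local Notation k := (#|S|).
Local Notation kR := (#|S|%:R : R).

Definition chance (P : pred (edge_set n)) : R :=
  \sum_(F : edge_set n | (F \subset cross_pairs S) && P F) random_edges_prob R S F.

Local Notation D := (finset.setX S (~: S)).
Local Notation f := (fun p : 'I_n * 'I_n => [set p.1; p.2]).

Lemma cross_pairsE : cross_pairs S = [set f p | p in D].
Proof.
apply/setP => e; apply/imset2P/imsetP => [[x y Sx Sy ->]|[[x y]]].
  by exists (x, y) => //; rewrite finset.in_setX Sx.
by rewrite finset.in_setX => /andP[Sx Sy] ->; exists x y.
Qed.

(** An unordered cross pair remembers its order because exactly one endpoint lies in [S]. *)
Lemma cross_pair_inj : {in D &, injective f}.
Proof.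
move=> [x y] [x' y']; rewrite !inE /= => /andP[Sx Sy] /andP[Sx' Sy'] e.
have : x \in [set x'; y'] by rewrite -e !inE eqxx.
have : y \in [set x'; y'] by rewrite -e !inE eqxx orbT.
rewrite !inE => /orP[/eqP yx|/eqP -> /orP[/eqP -> //|/eqP xy]].
  by rewrite yx Sx' in Sy.
by rewrite -xy Sx in Sy'.
Qed.

Lemma random_edges_prob_ge0 F : 0 <= random_edges_prob R S F.
Proof. by apply: prodr_ge0 => e _; case: ifP => _; rewrite ?invr_ge0 // subr_ge0 invf_le1 ?ler1n. Qed.

Lemma sum_cross (G : 'I_n -> 'I_n -> R) :
  \sum_(i in S) \sum_(j in ~: S) G i j = \sum_(p in D) G p.1 p.2.
Proof. by rewrite pair_big /=; apply: eq_bigl => -[i j]; rewrite finset.in_setX. Qed.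

(** Both the weight of a graph and the exponential factor over the cross pairs, so the sum over
    subsets is an expanded product. *)
Lemma cross_mgf (a : 'I_n -> 'I_n -> R) :
  \sum_(F : edge_set n | F \subset cross_pairs S) random_edges_prob R S F *
      expR (\sum_(i in S) \sum_(j in ~: S) a i j * cross_sign R F i j) =
    \prod_(p in D) ((expR (a p.1 p.2) + expR (- a p.1 p.2)) / 2).
Proof.
pose W e := \sum_(p in D | f p == e) a p.1 p.2.
have WE p : p \in D -> W (f p) = a p.1 p.2.
  move=> Dp; rewrite /W (big_pred1 p) // => q /=; apply/andP/eqP => [[Dq /eqP]|-> //].
  exact: cross_pair_inj.
have -> : \prod_(p in D) ((expR (a p.1 p.2) + expR (- a p.1 p.2)) / 2) =
    \prod_(e in cross_pairs S) (expR (- W e) / 2 + expR (W e) / 2).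
  rewrite cross_pairsE big_imset /=; last exact: cross_pair_inj.
  by apply: eq_bigr => p Dp; rewrite WE // mulrDl addrC.
rewrite -sum_subset_prod; apply: eq_bigr => F _.
rewrite sum_cross expR_sum /random_edges_prob.
have -> : \prod_(p in D) expR (a p.1 p.2 * cross_sign R F p.1 p.2) =
    \prod_(e in cross_pairs S) expR (if e \in F then - W e else W e).
  rewrite cross_pairsE big_imset /=; last exact: cross_pair_inj.
  apply: eq_bigr => p Dp; rewrite WE // /cross_sign /is_edge.
  by case: ifP => _; rewrite ?mulr1 // mulrN1.
rewrite -big_split /=; apply: eq_bigr => e _; case: ifP => _; first by rewrite mulrC.
by rewrite mulrC; congr (_ * _); lra.
Qed.

Lemma random_edges_total : \sum_(F : edge_set n | F \subset cross_pairs S) random_edges_prob R S F = 1.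
Proof.
rewrite /random_edges_prob sum_subset_prod big1 // => e _; lra.
Qed.

Lemma chernoff (a : 'I_n -> 'I_n -> R) (t lambda : R) : 0 <= lambda ->
  (forall i j, `|lambda * a i j| <= 1 / 2) ->
  chance (fun F => t <= \sum_(i in S) \sum_(j in ~: S) a i j * cross_sign R F i j) <=
    expR (2 * lambda ^+ 2 * (\sum_(i in S) \sum_(j in ~: S) a i j ^+ 2) - lambda * t).
Proof.
move=> l0 la; have := cross_mgf (fun i j => lambda * a i j) => mgf.
have {mgf} mgf : \sum_(F : edge_set n | F \subset cross_pairs S) random_edges_prob R S F *
      expR (\sum_(i in S) \sum_(j in ~: S) lambda * a i j * cross_sign R F i j) <=
    expR (2 * lambda ^+ 2 * (\sum_(i in S) \sum_(j in ~: S) a i j ^+ 2)).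
  rewrite mgf sum_cross mulr_sumr expR_sum; apply: ler_prod => p _; apply/andP; split.
    by rewrite divr_ge0 ?addr_ge0 ?expR_ge0.
  by apply: le_trans (cosh_le_expR (la _ _)) _; rewrite exprMn mulrA.
rewrite expRD -ler_pdivrMr ?expR_gt0 // -expRN opprK; apply: le_trans mgf.
rewrite /chance big_mkcondr mulr_suml; apply: ler_sum => F _.
case: ifP => [h|_]; last by rewrite mul0r mulr_ge0 ?expR_ge0 ?random_edges_prob_ge0.
rewrite ler_wpM2l ?random_edges_prob_ge0 // ler_expR.
under eq_bigr do under eq_bigr do rewrite -mulrA.
under eq_bigr do rewrite -mulr_sumr.
by rewrite -mulr_sumr ler_wpM2l.
Qed.

Lemma chance_union (I : finType) (J : pred I) (P : pred (edge_set n)) (Q : I -> pred (edge_set n)) (b : R) :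
  (forall F, P F -> exists2 x, J x & Q x F) -> (forall x, J x -> chance (Q x) <= b) ->
  chance P <= #|J|%:R * b.
Proof.
move=> h hb; rewrite mulr_natl -sumr_const; apply: le_trans (_ : \sum_(x in J) chance (Q x) <= _); last exact: ler_sum.
rewrite /chance.
under [leRHS]eq_bigr do rewrite big_mkcondr /=.
rewrite exchange_big big_mkcondr /=; apply: ler_sum => F FS.
have nn x : 0 <= (if Q x F then random_edges_prob R S F else 0) by case: ifP => // _; exact: random_edges_prob_ge0.
case: ifP => [/h[x Jx Qx]|_]; last by apply: sumr_ge0.
by rewrite (bigD1 x) //= Qx lerDl; apply: sumr_ge0.
Qed.

End Probability.

Section RandomGraph.

Variables (R : realType) (n : nat) (S : {set 'I_n}).

Local Notation k := (#|S|).
Local Notation kR := (#|S|%:R : R).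
Local Notation nu := (n%:R : R).

(** Union bound over sign vectors. Signs on [S] and on its complement are merged into one function
    on all vertices, so there are only [2 ^ n] events, each of chance at most [expR (- 2 n)] by the
    choice [lambda = 1 / sqrt k]. *)
Lemma chance_cut : 4 <= kR -> chance R S (fun F => `[< ~ small_cut_norm R F S >]) <= expR (- nu).
Proof.
move=> k4; have k0 : 0 < kR by apply: lt_le_trans k4.
set q := Num.sqrt kR; have q2 : q ^+ 2 = kR by rewrite sqr_sqrtr // ler0n.
have qge : 2 <= q.
  have := ler_wsqrtr k4; rewrite (_ : 4 = 2 ^+ 2); last by rewrite -natrX.
  by rewrite sqrtr_sqr ger0_norm.
have q0 : 0 < q by lra.
have sg1 (b : bool) : sgnb R b ^+ 2 = 1 by rewrite /sgnb; case: b; rewrite ?sqrrN expr1n.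
have sgn (b : bool) : `|sgnb R b| = 1 by rewrite /sgnb; case: b; rewrite ?normrN normr1.
pose a (s : {ffun 'I_n -> bool}) i j := sgnb R (s i) * sgnb R (s j).
apply: le_trans (chance_union (J := predT) (b := expR (- (2 * nu)))
    (Q := fun s F => 4 * nu * q <= \sum_(i in S) \sum_(j in ~: S) a s i j * cross_sign R F i j) _ _) _.
- move=> F /asboolP/existsNP[s /existsNP[t /negP]]; rewrite -ltNge => /ltW h.
  exists [ffun i => if i \in S then s i else t i] => //; apply: le_trans h _.
  rewrite le_eqVlt; apply/orP; left; apply/eqP; apply: eq_bigr => i Si; apply: eq_bigr => j.
  by rewrite finset.in_setC /a !ffunE Si => /negPf ->; rewrite [RHS]mulrC mulrA.
- move=> s _; apply: (le_trans (@chernoff R n S (a s) (4 * nu * q) q^-1 _ _)).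
  + by rewrite invr_ge0 ltW.
  + move=> i j; rewrite !normrM !sgn !mulr1 ger0_norm ?invr_ge0 ?(ltW q0) // div1r lef_pV2 ?posrE //; lra.
  + rewrite ler_expR; have -> : \sum_(i in S) \sum_(j in ~: S) a s i j ^+ 2 = kR * #|~: S|%:R.
      under eq_bigr do under eq_bigr do rewrite exprMn !sg1 mulr1.
      by under eq_bigr do rewrite sumr_const; rewrite sumr_const -natrM -mulrnA mulnC.
    have le : #|~: S|%:R <= nu by rewrite ler_nat -[leqRHS]card_ord max_card.
    rewrite exprVn q2 (_ : _ - _ = 2 * #|~: S|%:R - 4 * nu); first lra.
    by field; rewrite !gt_eqF.
- rewrite card_ffun card_bool card_ord natrX (_ : - (2 * nu) = - nu - nu); last by ring.
  rewrite expRD mulrA -[leRHS]mul1r ler_wpM2r ?expR_ge0 //.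
  rewrite -[nu]mulr1 -mulrN expRM_natl -exprMn exprn_ile1 //.
  by rewrite expRN ler_pdivrMr ?expR_gt0 // mul1r; have := expR_ge1Dx (1 : R); lra.
Qed.

Lemma chance_nondegrees :
  chance R S (fun F => `[< ~ small_nondegrees F S >]) <= nu * expR (- (kR / 200)).
Proof.
apply: le_trans (chance_union (J := mem (~: S)) (b := expR (- (kR / 200)))
    (Q := fun v F => kR / 5 <= \sum_(i in S) \sum_(j in ~: S) (j == v)%:R * cross_sign R F i j) _ _) _.
- move=> F /asboolP/existsNP[v /not_implyP[Sv /negP]]; rewrite -ltnNge => h; exists v => //.
  have -> : \sum_(i in S) \sum_(j in ~: S) (j == v)%:R * cross_sign R F i j =
      \sum_(i in S) (2 * (~~ is_edge F v i)%:R - 1).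
    apply: eq_bigr => i Si; rewrite (bigD1 v) //= eqxx mul1r big1 => [|j /andP[_ /negPf ->]]; last by rewrite mul0r.
    by rewrite addr0 /cross_sign /is_edge finset.setUC; case: ifP => _; rewrite ?mulr0 ?mulr1; lra.
  rewrite sumrB -mulr_sumr sumr_const -natr_sum.
  have -> : (\sum_(i in S) ~~ is_edge F v i)%N = #|[set w in S | ~~ is_edge F v w]|.
    rewrite -sum1_card [RHS](eq_bigl (fun i => (i \in S) && ~~ is_edge F v i)); last by move=> i; rewrite inE.
    by rewrite [RHS]big_mkcondr /=; apply: eq_bigr => i _; case: is_edge.
  by move: h; rewrite -(ltr_nat R) !natrM; lra.
(* [lambda = 1/20] minimises [2 lambda ^ 2 k - lambda k / 5], with value [- k / 200]. *)
- move=> v Sv; apply: (le_trans (@chernoff R n S (fun i j => (j == v)%:R) (kR / 5) (1 / 20) _ _)).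
  + by lra.
  + by move=> i j; case: eqP => _; rewrite ?mulr1 ?mulr0 ?normr0 ?ger0_norm; lra.
  + rewrite ler_expR (_ : \sum_(i in S) _ = kR); first lra.
    rewrite -sum1_card natr_sum; apply: eq_bigr => i _.
    by rewrite (bigD1 v) //= eqxx expr1n big1 ?addr0 // => j /andP[_ /negPf ->]; rewrite expr0n.
- by rewrite ler_wpM2r ?expR_ge0 // ler_nat -[leqRHS]card_ord max_card.
Qed.

Lemma bin_le_expn m L : ('C(m, L) <= m ^ L)%N.
Proof.
apply: leq_trans (_ : m ^_ L <= _)%N; first by rewrite -bin_ffact leq_pmulr ?fact_gt0.
elim: L => [|L IH]; first by rewrite ffactn0.
by rewrite ffactnSr expnSr leq_mul // leq_subr.
Qed.

(** On a hole all signs are 1 and add up to [L ^ 2], so the same Chernoff bound applies, followed by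
    a union over pairs of [L]-sets. *)
Lemma chance_hole L :
  chance R S (fun F => `[< ~ no_hole F S L >]) <= nu ^+ (2 * L) * expR (- (L%:R ^+ 2 / 8)).
Proof.
have ind (T : finType) (X : {set T}) (x : T) : ((x \in X)%:R : R) ^+ 2 = (x \in X)%:R.
  by case: (x \in X); rewrite ?expr1n ?expr0n.
have cnt (X Y : {set 'I_n}) : X \subset Y -> \sum_(i in Y) ((i \in X)%:R : R) = #|X|%:R.
  move=> XY; rewrite -natr_sum -sum1_card; congr (_%:R); rewrite [LHS]big_mkcond [RHS]big_mkcond /=.
  by apply: eq_bigr => i _; have := fintype.subsetP XY i; case: (i \in X) => [->|_] //; case: ifP.
have cnt2 (A B : {set 'I_n}) : A \subset S -> B \subset ~: S -> #|A| = L -> #|B| = L ->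
    \sum_(i in S) \sum_(j in ~: S) ((i \in A)%:R * (j \in B)%:R : R) = L%:R ^+ 2.
  move=> AS BS cA cB; under eq_bigr do rewrite -mulr_sumr cnt // cB.
  by rewrite -mulr_suml cnt // cA expr2.
apply: le_trans (chance_union
    (J := fun p : {set 'I_n} * {set 'I_n} =>
       [&& p.1 \subset S, p.2 \subset ~: S, #|p.1| == L & #|p.2| == L])
    (b := expR (- (L%:R ^+ 2 / 8)))
    (Q := fun p F => L%:R ^+ 2 <= \sum_(i in S) \sum_(j in ~: S)
        ((i \in p.1)%:R * (j \in p.2)%:R) * cross_sign R F i j) _ _) _.
- move=> F /asboolP/existsNP[A /existsNP[B /not_implyP[AS /not_implyP[BS /not_implyP[cA /not_implyP[cB h]]]]]].
  exists (A, B); first by rewrite /= AS BS cA cB eqxx.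
  rewrite /= -(cnt2 A B) //; apply: ler_sum => i Si; apply: ler_sum => j Sj.
  rewrite /cross_sign; case: ifP => Fij; last by rewrite mulr1.
  case iA : (i \in A); last by rewrite !mul0r.
  case jB : (j \in B); last by rewrite mulr0 mul0r.
  by case: h; exists i => //; exists j.
- move=> [A B] /= /and4P[AS BS /eqP cA /eqP cB];
  apply: (le_trans (@chernoff R n S (fun i j => (i \in A)%:R * (j \in B)%:R) (L%:R ^+ 2) (1 / 4) _ _)).
  + by lra.
  + by move=> i j; do 2 case: (_ \in _); rewrite ?mulr0 ?mul0r ?mulr1 ?normr0 ?ger0_norm; lra.
  + rewrite ler_expR; under eq_bigr do under eq_bigr do rewrite exprMn !ind.
    by rewrite cnt2 //; lra.
- rewrite ler_wpM2r ?expR_ge0 // -natrX ler_nat.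
  pose Z := [set A : {set 'I_n} | A \subset [set: 'I_n] & #|A| == L].
  apply: leq_trans (_ : #|finset.setX Z Z| <= _)%N.
    apply: subset_leq_card; apply/fintype.subsetP => -[A B]; rewrite finset.in_setX !inE !finset.subsetT /=.
    by case/and4P=> _ _ -> ->.
  rewrite cardsX cards_draws cardsT card_ord mul2n -addnn expnD; apply: leq_mul; exact: bin_le_expn.
Qed.

End RandomGraph.

(** * Assembling the deterministic and the random estimates *)

Lemma main_alg_few_bad (R : realType) n (E F : edge_set n) (S : {set 'I_n}) L :
  (1000 <= n)%N -> is_graph E -> F \subset E ->
  (forall i j, i \in S -> j \in S -> ~~ is_edge E i j) ->
  10 ^+ 9 * (n%:R * Num.sqrt #|S|%:R) <= #|S|%:R ^+ 2 :> R ->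
  (0 < #|S|)%N -> (n ^ 2 <= #|S| ^ 3)%N -> ((4 * L) ^ 3 <= n ^ 2)%N ->
  small_cut_norm R F S -> small_nondegrees F S -> no_hole F S L ->
  (#|[set u in S | main_alg E u != S]| ^ 3 <= 8 * n * L ^ 3)%N.
Proof.
move=> n_ge E_graph FE indep k_big k_gt0 k_cube L_small cut nondeg hole.
have n10 : (10 <= n)%N by apply: leq_trans n_ge.
rewrite (_ : [set u in S | _] =
    [set u in S | selection E (fw_iter E (mono_val n rounds_m)) u != S]).
  have n0 : (0 < n)%N by apply: leq_trans n_ge.
  exact: (few_bad FE indep nondeg hole k_gt0 n0 k_cube L_small
    (few_atypical n_ge E_graph FE indep k_big cut k_gt0)
    (ball_missing n_ge E_graph k_big k_gt0) (ball_extra n_ge E_graph FE k_big cut k_gt0)).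
by apply/setP => u; rewrite !inE main_alg_spec.
Qed.

Lemma success_prob_ge (R : realType) n (S : {set 'I_n}) (adv : edge_set n -> edge_set n) (alg : algorithm)
    (bad : pred (edge_set n)) (d : R) : (0 < #|S|)%N -> 0 <= d ->
  (forall F : edge_set n, F \subset cross_pairs S -> ~~ bad F ->
     #|[set u in S | alg n (adv F) u != S]|%:R <= d * #|S|%:R) ->
  1 - d - chance R S bad <= success_prob R S adv alg.
Proof.
move=> S0 d0 good.
have -> : 1 - d - chance R S bad = \sum_(F : edge_set n | F \subset cross_pairs S)
    (random_edges_prob R S F - d * random_edges_prob R S F - (if bad F then random_edges_prob R S F else 0)).
  by rewrite /chance big_mkcondr !sumrB -mulr_sumr random_edges_total mulr1.
apply: ler_sum => F FS.
have p0 := random_edges_prob_ge0 R S F.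
have k0 : (0 : R) < #|S|%:R by rewrite ltr0n.
have e : \sum_(u in S) #|S|%:R^-1 * (alg n (adv F) u == S)%:R =
    1 - #|[set u in S | alg n (adv F) u != S]|%:R / #|S|%:R :> R.
  rewrite -mulr_sumr -natr_sum.
  have -> : #|[set u in S | alg n (adv F) u != S]|%:R = #|S|%:R - (\sum_(u in S) (alg n (adv F) u == S))%:R :> R.
    rewrite -sum1_card [X in X%:R](eq_bigl (fun u => (u \in S) && (alg n (adv F) u != S))); last by move=> u; rewrite inE.
    rewrite big_mkcondr /= -sum1_card !natr_sum -sumrB; apply: eq_bigr => u _.
    by case: eqP; rewrite ?subrr ?subr0.
  by field; rewrite gt_eqF.
case: ifPn => [_|/(good _ FS) h].
  apply: le_trans (_ : 0 <= _).
    by move: (random_edges_prob R S F) p0 => p p0; nra.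
  by rewrite mulr_ge0 // sumr_ge0 // => u _; rewrite mulr_ge0 ?invr_ge0 ?ler0n.
rewrite e subr0 -{1}[random_edges_prob R S F]mulr1 [d * _]mulrC -mulrBr ler_wpM2l // lerD2l lerN2.
by rewrite ler_pdivrMr.
Qed.

Lemma chance_or3 (R : realType) n (S : {set 'I_n}) (P Q T : pred (edge_set n)) :
  chance R S (fun F => [|| P F, Q F | T F]) <= chance R S P + chance R S Q + chance R S T.
Proof.
rewrite /chance !big_mkcondr -!big_split /=; apply: ler_sum => F _.
by have := random_edges_prob_ge0 R S F; case: (P F); case: (Q F); case: (T F) => /= h; lra.
Qed.

(** The integer sixth root of [n] serves as the hole size: far above [log n], so that holes are
    excluded, yet small enough that [8 n m ^ 3] is negligible against [k ^ 3]. *)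
Lemma sixth_root_exists n : exists m, (m ^ 6 <= n < m.+1 ^ 6)%N.
Proof.
elim: n => [|n [m /andP[h1 h2]]]; first by exists 0%N.
have [lt|ge] := ltnP n.+1 (m.+1 ^ 6); first by exists m; rewrite lt ltnW.
by exists m.+1; rewrite ge (leq_ltn_trans h2) // ltn_exp2r.
Qed.

(** The rate [1/32] makes the union factor [n ^ (2m)] at most [expR (m ^ 2 / 16)], half of the
    exponent gained in [chance_hole]. *)
Lemma le_expR_root (R : realType) n m : (n < m.+1 ^ 6)%N -> 10 ^+ 6 <= m%:R :> R ->
  n%:R <= expR (m%:R / 32) :> R.
Proof.
move=> nm mbig; have h : n%:R <= (m%:R + 1) ^+ 6 :> R by rewrite natr1 -natrX ler_nat ltnW.
apply: le_trans h _; move: (m%:R : R) mbig => M mbig.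
have M0 : 0 <= 1 + M / 384 by lra.
have -> : M / 32 = 12%:R * (M / 384) by field.
rewrite expRM_natl -[12%N]/(2 * 6)%N exprM lerXn2r ?nnegrE ?exprn_ge0 ?expR_ge0 //; first lra.
have e := expR_ge1Dx (M / 384).
apply: le_trans (_ : (1 + M / 384) ^+ 2 <= _); last by rewrite lerXn2r ?nnegrE ?expR_ge0.
by rewrite expr2; nra.
Qed.

Lemma cube_powR (R : realType) (x : R) : 0 <= x -> (x `^ (2 / 3)) ^+ 3 = x ^+ 2.
Proof.
move=> x0; rewrite -powR_mulrn ?powR_ge0 // -powRrM -powR_mulrn //; congr (_ `^ _).
by field.
Qed.

Lemma chance_fail (R : realType) n (S : {set 'I_n}) m :
  (m ^ 6 <= n < m.+1 ^ 6)%N -> 10 ^+ 6 <= m%:R :> R ->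
  10 ^+ 18 * n%:R ^+ 2 <= #|S|%:R ^+ 3 :> R ->
  chance R S (fun F => [|| `[< ~ small_cut_norm R F S >],
      `[< ~ small_nondegrees F S >] | `[< ~ no_hole F S m >]]) <= 3 / n%:R.
Proof.
move=> /andP[mn nm] mbig kbig.
have m1 : (1 : R) <= m%:R by lra.
have n1 : (1 : R) <= n%:R.
  rewrite (ler_nat _ 1); apply: leq_trans mn; rewrite expn_gt0 -(ltr_nat R); lra.
have n0 : (0 : R) < n%:R by lra.
have nexp := le_expR_root nm mbig.
have kr0 : (0 : R) <= #|S|%:R by [].
apply: (le_trans (@chance_or3 R n S (fun F => `[< ~ small_cut_norm R F S >])
  (fun F => `[< ~ small_nondegrees F S >]) (fun F => `[< ~ no_hole F S m >]))).
have -> : 3 / n%:R = n%:R^-1 + n%:R^-1 + n%:R^-1 :> R by lra.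
apply: lerD; first apply: lerD.
- apply: le_trans (chance_cut _) _.
    rewrite leNgt; apply/negP => k4; move: kbig; move: (#|S|%:R : R) kr0 k4 => x x0 x4.
    by rewrite !exprS !expr0; nra.
  by rewrite expRN lef_pV2 ?posrE ?expR_gt0 //; have := expR_ge1Dx (n%:R : R); lra.
- apply: le_trans (chance_nondegrees _ _) _.
  rewrite expRN ler_pdivrMr ?expR_gt0 // ler_pdivlMl // -expr2.
  (* Split in three because the hypothesis bounds [n ^ 2] by a cube of [k], and [x <= expR x] is
     applied to each factor. *)
  have -> : #|S|%:R / 200 = 3%:R * (#|S|%:R / 600) :> R by lra.
  rewrite expRM_natl; move: kbig kr0; rewrite -[#|S|%:R in X in X -> _](@divfK R 600); last by rewrite pnatr_eq0.
  have -> : 0 <= #|S|%:R :> R = (0 <= #|S|%:R / 600 :> R).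
    by apply/idP/idP => h; lra.
  move: (_ / 600 : R) (n%:R : R) => x y h x0; have e := expR_ge1Dx x.
  apply: le_trans (_ : x ^+ 3 <= _); last by rewrite lerXn2r ?nnegrE ?expR_ge0 //; lra.
  by move: h; rewrite exprMn; have := sqr_ge0 y; have := exprn_ge0 3 x0; lra.
- apply: le_trans (chance_hole _ _ _) _.
  have h : n%:R ^+ (2 * m) <= expR (m%:R ^+ 2 / 16) :> R.
    have -> : m%:R ^+ 2 / 16 = (2 * m)%:R * (m%:R / 32) :> R by rewrite natrM; field.
    by rewrite expRM_natl lerXn2r ?nnegrE ?expR_ge0.
  apply: le_trans (_ : expR (m%:R ^+ 2 / 16) * expR (- (m%:R ^+ 2 / 8)) <= _).
    by rewrite ler_wpM2r ?expR_ge0.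
  rewrite -expRD; apply: le_trans (_ : expR (- (m%:R / 32)) <= _).
    by rewrite ler_expR expr2; move: (m%:R : R) m1 => x; nra.
  by rewrite expRN lef_pV2 ?posrE ?expR_gt0.
Qed.

Lemma adversary_independent n (S : {set 'I_n}) (adv : edge_set n -> edge_set n) (F : edge_set n) :
  is_adversary S adv -> F \subset cross_pairs S ->
  forall i j, i \in S -> j \in S -> ~~ is_edge (adv F) i j.
Proof.
move=> hadv FS i j Si Sj; have [_ _ h] := hadv _ FS.
have ijS : [set i; j] \subset S by rewrite finset.subUset !finset.sub1set Si.
apply/negP => ij; have := h _ ij; rewrite ijS => {}h.
have /(fintype.subsetP FS) : [set i; j] \in F by apply: contraT => /h.
case/imset2P => x y Sx; rewrite finset.in_setC => /negP Sy e; apply: Sy.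
by apply: (fintype.subsetP ijS); rewrite e !inE eqxx orbT.
Qed.

Theorem theorem2 (R : realType) :
  exists c1 : R, 0 < c1 /\
  exists alg : algorithm, poly_time alg /\
  forall eps : R, 0 < eps ->
  exists N : nat,
  forall (n k : nat) (S : {set 'I_n}) (adv : edge_set n -> edge_set n),
    (N <= n)%N -> #|S| = k -> c1 * n%:R `^ (2 / 3) <= k%:R ->
    is_adversary S adv ->
    1 - eps <= success_prob R S adv alg.
Proof.
exists (10 ^+ 6); split; first by rewrite exprn_gt0.
exists main_alg; split; first exact: main_alg_poly_time.
(* The sixth root of [n] must exceed [6 / eps]: this puts both the chance of a bad graph, [3 / n],
   and the fraction of bad [u] below [eps / 2]. *)
move=> eps eps0; pose m0 := Num.bound (10 ^+ 6 + 6 / eps : R).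
exists (m0 ^ 6)%N => n k S adv + <- {k} kbig hadv; move=> n_ge.
have [m mn] := sixth_root_exists n; have /andP[mn1 mn2] := mn.
have : (m0 <= m)%N by rewrite -ltnS -(@ltn_exp2r _ _ 6) // (leq_ltn_trans n_ge).
have e0 : 0 < 6 / eps by rewrite divr_gt0.
rewrite -(ler_nat R) => m_ge.
have {m_ge} m_ge : 10 ^+ 6 + 6 / eps <= m%:R.
  by apply: le_trans m_ge; apply/ltW/archi_boundP; rewrite addr_ge0 ?exprn_ge0 ?(ltW e0).
have mbig : 10 ^+ 6 <= m%:R :> R by lra.
have meps : 6 <= m%:R * eps by rewrite -ler_pdivrMr //; have := exprn_ge0 6 (ler0n R 10); lra.
have nm : (m%:R ^+ 6 <= n%:R :> R) by rewrite -natrX ler_nat.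
have m1 : (1 : R) <= m%:R by lra.
have m6 : m%:R <= m%:R ^+ 6 :> R by rewrite -[leLHS]expr1 ler_weXn2l.
have k3 : 10 ^+ 18 * n%:R ^+ 2 <= #|S|%:R ^+ 3 :> R.
  have -> : 10 ^+ 18 * n%:R ^+ 2 = (10 ^+ 6 * n%:R `^ (2 / 3)) ^+ 3 :> R.
    by rewrite exprMn cube_powR // -exprM.
  by rewrite lerXn2r ?nnegrE // mulr_ge0 ?powR_ge0 ?exprn_ge0.
have n_big : 10 ^+ 6 <= n%:R :> R by lra.
have n2 : 1 <= n%:R ^+ 2 :> R by rewrite exprn_ege1 //; lra.
have S0 : (0 < #|S|)%N.
  rewrite lt0n; apply/negP => /eqP k0; move: k3; rewrite k0 expr0n /=; lra.
have kR0 : (0 : R) < #|S|%:R by rewrite ltr0n.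
have kcube : (n ^ 2 <= #|S| ^ 3)%N by rewrite -(ler_nat R) !natrX; lra.
have n1000 : (1000 <= n)%N by rewrite -(ler_nat R); lra.
have msmall : ((4 * m) ^ 3 <= n ^ 2)%N.
  rewrite -(ler_nat R) !natrX natrM.
  apply: le_trans (_ : (m%:R ^+ 2) ^+ 3 <= _).
    by rewrite lerXn2r ?nnegrE ?exprn_ge0 ?mulr_ge0 // expr2; move: (m%:R : R) mbig => x; nra.
  rewrite -exprM; apply: le_trans nm _; rewrite expr2 ler_pMl; lra.
have k_big : 10 ^+ 9 * (n%:R * Num.sqrt #|S|%:R) <= #|S|%:R ^+ 2 :> R.
  rewrite -(@ler_pXn2r _ 2) ?nnegrE ?exprn_ge0 ?mulr_ge0 ?sqrtr_ge0 //.
  have -> : (10 ^+ 9 * (n%:R * Num.sqrt #|S|%:R)) ^+ 2 = 10 ^+ 18 * n%:R ^+ 2 * Num.sqrt #|S|%:R ^+ 2 :> R by ring.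
  rewrite sqr_sqrtr // (_ : (_ ^+ 2) ^+ 2 = #|S|%:R ^+ 3 * #|S|%:R); last by ring.
  by rewrite ler_wpM2r.
have good (F : edge_set n) : F \subset cross_pairs S ->
    ~~ [|| `[< ~ small_cut_norm R F S >], `[< ~ small_nondegrees F S >] | `[< ~ no_hole F S m >]] ->
    #|[set u in S | main_alg (adv F) u != S]|%:R <= eps / 2 * #|S|%:R.
  move=> FS /or3P ok.
  have h1 : small_cut_norm R F S by apply: contrapT => c; apply: ok; apply: Or31; apply/asboolP.
  have h2 : small_nondegrees F S by apply: contrapT => c; apply: ok; apply: Or32; apply/asboolP.
  have h3 : no_hole F S m by apply: contrapT => c; apply: ok; apply: Or33; apply/asboolP.
  have [FE gr _] := hadv F FS.
  have := main_alg_few_bad n1000 gr FE (adversary_independent hadv FS) k_big S0 kcube msmall h1 h2 h3.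
  set b := #|_|; rewrite -(ler_nat R) natrX.
  rewrite (_ : (8 * n * m ^ 3)%:R = 8 * n%:R * m%:R ^+ 3); last by rewrite -natrX -!natrM.
  move=> hb.
  rewrite -(@ler_pXn2r _ 3) ?nnegrE ?mulr_ge0 ?divr_ge0 ?(ltW eps0) //.
  apply: le_trans hb _; rewrite exprMn.
  apply: le_trans (_ : (eps / 2) ^+ 3 * (10 ^+ 18 * n%:R ^+ 2) <= _); last first.
    by rewrite ler_wpM2l // exprn_ge0 // divr_ge0 // ltW.
  have t : 1 <= (m%:R * eps) ^+ 3 by rewrite exprn_ege1 //; lra.
  have u : m%:R ^+ 3 <= (eps / 2) ^+ 3 * 8 * n%:R.
    apply: le_trans (_ : (m%:R * eps) ^+ 3 * m%:R ^+ 3 <= _); first by rewrite ler_peMl ?exprn_ge0.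
    rewrite (_ : _ * _ = (eps / 2) ^+ 3 * 8 * m%:R ^+ 6); last by field.
    by rewrite ler_wpM2l // mulr_ge0 ?exprn_ge0 ?divr_ge0 ?(ltW eps0).
  apply: le_trans (_ : 8 * n%:R * ((eps / 2) ^+ 3 * 8 * n%:R) <= _).
    by rewrite ler_wpM2l // mulr_ge0.
  rewrite (_ : 8 * _ * _ = 64 * ((eps / 2) ^+ 3 * n%:R ^+ 2)); last by ring.
  rewrite [leRHS](_ : _ = 10 ^+ 18 * ((eps / 2) ^+ 3 * n%:R ^+ 2)); last by rewrite mulrCA.
  have : 0 <= (eps / 2) ^+ 3 * n%:R ^+ 2 by rewrite mulr_ge0 ?exprn_ge0 ?divr_ge0 ?(ltW eps0).
  by move: (_ ^+ 3 * n%:R ^+ 2) => x; lra.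
apply: le_trans (success_prob_ge S0 _ good); last by rewrite divr_ge0 ?ltW.
have := chance_fail mn mbig k3.
have : 3 / n%:R <= eps / 2.
  rewrite ler_pdivrMr; last lra.
  have : m%:R * eps <= n%:R * eps by rewrite ler_wpM2r ?(ltW eps0) // (le_trans m6).
  by lra.
by move: (chance _ _ _) => c; lra.
Qed.
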